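(* Let $S$ be a finite set of places of $\mathbb{Q}$ containing the infinite place, let $l=\#S$, let $m,n\ge 1$ be integers, and let $\psi:\mathbb{N}\to\mathbb{R}_+$ be a non-increasing function. Let $\mathcal{W}(\psi)$ be the set of $m\times n$ matrices $A$ with entries in $\mathbb{Q}_S$ for which there exist infinitely many $\mathbf{q}\in\mathbb{Z}^n$ such that $$\bigl(\|\mathbf{p}+A\mathbf{q}\|^{l}\bigr)^{m}\le\psi\bigl(\|\mathbf{q}\|_\infty^{n}\bigr)\quad\text{for some }\mathbf{p}\in\mathbb{Z}^m.$$ Then: (1) almost every $A$ belongs to $\mathcal{W}(\psi)$ if $\int\psi(x)\,dx$ diverges; (2) almost no $A$ belongs to $\mathcal{W}(\psi)$ if $\int\psi(x)\,dx$ converges.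
   Context: $\mathbb{Q}_S=\prod_{v\in S}\mathbb{Q}_v$, where $\mathbb{Q}_v$ is the completion of $\mathbb{Q}$ at $v$ with its normalized absolute value $|\cdot|_v$ ($\mathbb{Q}_\infty=\mathbb{R}$); $\mathbb{Z}$ is embedded diagonally in $\mathbb{Q}_S$. For $\mathbf{x}=(x_1^{(v)},\dots,x_m^{(v)})\in\mathbb{Q}_v^m$ put $\|\mathbf{x}\|_v=\max_i|x_i^{(v)}|_v$, and for $\mathbf{x}\in\mathbb{Q}_S^m$ put $\|\mathbf{x}\|=\max_{v\in S}\|\mathbf{x}\|_v$, the maximum over the components of $\mathbf{x}$. $\|\mathbf{q}\|_\infty$ is the supremum norm of $\mathbf{q}$ at the infinite place. ''Almost every''/''almost no'' refers to Haar measure on the additive group of $m\times n$ matrices over $\mathbb{Q}_S$. Since $\psi$ is defined on $\mathbb{N}$ and non-increasing, convergence or divergence of $\int\psi(x)\,dx$ means convergence or divergence of $\sum_{j\ge1}\psi(j)$ (equivalently, of $\int_1^\infty\psi(\lceil x\rceil)\,dx$). The single vector $\mathbf{q}=0$ is irrelevant to the condition ''infinitely many $\mathbf{q}$''. *)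

(* Defs.v *)
From HB Require Import structures.
From mathcomp Require Import all_boot all_order all_algebra.
From mathcomp Require Import finmap.
From mathcomp Require Import generic_quotient ring_quotient.
From mathcomp Require Import all_classical all_reals all_analysis.
From mathcomp Require Import ring lra zify.

Set Implicit Arguments.
Unset Strict Implicit.
Unset Printing Implicit Defensive.

Import Order.TTheory GRing.Theory Num.Theory.
Import numFieldTopology.Exports numFieldNormedType.Exports.

Local Open Scope quotient_scope.
Local Open Scope classical_set_scope.
Local Open Scope ring_scope.

Lemma seq_cvg_unique (R : realType) (f : nat -> R) (l l' : R) :
  f @ \oo --> l -> f @ \oo --> l' -> l = l'.
Proof. by move=> /cvg_lim <- // /cvg_lim <-. Qed.

Record absolute_value (R : realType) := AbsoluteValue {
  av :> rat -> R ;
  av_ge0 : forall x, 0 <= av x ;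
  av_eq0 : forall x, (av x == 0) = (x == 0) ;
  avM : forall x y, av (x * y) = av x * av y ;
  avD : forall x y, av (x + y) <= av x + av y
}.

Section AbsoluteValue.
Variables (R : realType) (a : absolute_value R).

Lemma av0 : a 0 = 0. Proof. by apply/eqP; rewrite av_eq0. Qed.

Lemma av1 : a 1 = 1.
Proof.
have a1 : a 1 != 0 by rewrite av_eq0 oner_eq0.
by apply: (mulfI a1); rewrite -avM !mulr1.
Qed.

Lemma avN x : a (- x) = a x.
Proof.
have e : a (-1) = 1.
  have : a (-1) ^+ 2 = 1 by rewrite expr2 -avM mulrNN mulr1 av1.
  by move=> /eqP; rewrite sqrp_eq1 ?av_ge0// => /eqP.
by rewrite -mulN1r avM e mul1r.
Qed.

Lemma avB x y : a (x - y) <= a x + a y.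
Proof. by rewrite -(avN y) avD. Qed.

Lemma avV x : a x^-1 = (a x)^-1.
Proof.
have [->|x0] := eqVneq x 0; first by rewrite invr0 av0 invr0.
have ax0 : a x != 0 by rewrite av_eq0.
by apply: (mulfI ax0); rewrite -avM !mulfV// av1.
Qed.

Lemma av_dist x y : `|a x - a y| <= a (x - y).
Proof.
have h u v : a u - a v <= a (u - v) by rewrite lerBlDr -{1}(subrK v u) avD.
by rewrite ler_norml h lerNl opprB -(avN (x - y)) opprB h.
Qed.

Definition cauchy_rat (u : nat -> rat) : Prop := forall e : R, 0 < e ->
  exists N, forall i j, (N <= i)%N -> (N <= j)%N -> a (u i - u j) < e.

Definition cauchy_pred : pred (nat -> rat) := fun u => `[< cauchy_rat u >].

Lemma cauchy_bound u : cauchy_rat u ->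
  exists2 M : R, 0 < M & forall i, a (u i) <= M.
Proof.
move=> /(_ 1 ltr01)[N cu].
exists (1 + a (u N) + \sum_(i < N) a (u i)).
  by rewrite ltr_wpDr ?sumr_ge0// => [i _|]; rewrite ?av_ge0// ltr_wpDr ?av_ge0.
move=> i; have [Ni|iN] := leqP N i.
  rewrite (@le_trans _ _ (1 + a (u N)))//; last first.
    by rewrite lerDl sumr_ge0// => k _; exact: av_ge0.
  rewrite -{1}(subrK (u N) (u i)) (le_trans (avD _ _ _))// lerD2r ltW//.
  exact: cu.
rewrite (bigD1 (Ordinal iN))//= addrCA lerDl addr_ge0 ?addr_ge0 ?av_ge0//.
by rewrite sumr_ge0// => k _; exact: av_ge0.
Qed.

Fact cauchy_subring : subring_closed cauchy_pred.
Proof.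
split.
- by apply/asboolP => e e0; exists 0%N => i j _ _ /=; rewrite subrr av0.
- move=> u v /asboolP cu /asboolP cv; apply/asboolP => e e0.
  have e20 : 0 < e / 2 by rewrite divr_gt0.
  have [N1 h1] := cu _ e20; have [N2 h2] := cv _ e20.
  exists (maxn N1 N2) => i j; rewrite !geq_max => /andP[i1 i2] /andP[j1 j2].
  have -> : (u - v) i - (u - v) j = (u i - u j) - (v i - v j).
    by rewrite !fctE; ring.
  by rewrite (le_lt_trans (avB _ _))// [e]splitr ltrD ?h1 ?h2.
- move=> u v /asboolP cu /asboolP cv; apply/asboolP => e e0.
  have [M M0 hM] := cauchy_bound cu; have [K K0 hK] := cauchy_bound cv.
  have eK : 0 < e / 2 / K by rewrite !divr_gt0.
  have eM : 0 < e / 2 / M by rewrite !divr_gt0.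
  have [N1 h1] := cu _ eK; have [N2 h2] := cv _ eM.
  exists (maxn N1 N2) => i j; rewrite !geq_max => /andP[i1 i2] /andP[j1 j2].
  have -> : (u * v) i - (u * v) j = (u i - u j) * v i + u j * (v i - v j).
    by rewrite !fctE; ring.
  rewrite (le_lt_trans (avD _ _ _))// !avM [e]splitr ltrD//.
    rewrite (@le_lt_trans _ _ (a (u i - u j) * K))//.
      by rewrite ler_wpM2l ?av_ge0.
    by rewrite -ltr_pdivlMr// h1.
  rewrite (@le_lt_trans _ _ (M * a (v i - v j)))//.
    by rewrite ler_wpM2r ?av_ge0.
  by rewrite mulrC -ltr_pdivlMr// h2.
Qed.

HB.instance Definition _ :=
  GRing.isSubringClosed.Build (nat -> rat) cauchy_pred cauchy_subring.

Record cauchy_seq := CauchySeq {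
  cseq :> nat -> rat ;
  cseqP : cseq \in cauchy_pred
}.

HB.instance Definition _ := [isSub for cseq].
HB.instance Definition _ := [Choice of cauchy_seq by <:].
HB.instance Definition _ :=
  [SubChoice_isSubComNzRing of cauchy_seq by <:].

Lemma cseq_is_cauchy (u : cauchy_seq) : cauchy_rat u.
Proof. exact/asboolP/cseqP. Qed.

Lemma cauchy_av_cvg (u : cauchy_seq) : cvgn (a \o u).
Proof.
apply: cauchy_cvg; apply: cauchy_exP => e e0.
have [N h] := cseq_is_cauchy u e0; exists (a (u N)); exists N => // i /= Ni.
by rewrite /ball/= (le_lt_trans (av_dist _ _))// h.
Qed.

Definition null_pred : pred cauchy_seq := fun u => `[< a \o u @ \oo --> (0 : R) >].

Lemma null_predP (u : cauchy_seq) :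
  reflect (a \o u @ \oo --> (0 : R)) (u \in null_pred).
Proof. exact: asboolP. Qed.

Lemma null_le (u v : cauchy_seq) (w : nat -> R) :
  w @ \oo --> (0 : R) -> (forall i, a (u i) <= w i) -> u \in null_pred.
Proof.
move=> w0 h; apply/null_predP; apply: (squeeze_cvgr _ _ w0); last exact: cvg_cst.
by apply: nearW => i /=; rewrite av_ge0 h.
Qed.

Fact null_ideal_closed : idealr_closed null_pred.
Proof.
split.
- apply/null_predP; rewrite (_ : _ \o _ = cst 0); first exact: cvg_cst.
  by apply/funext => i /=; rewrite av0.
- apply/null_predP; rewrite (_ : _ \o _ = cst 1).
    move=> h; suff /eqP : (0 : R) = 1 by rewrite eq_sym oner_eq0.
    by apply: seq_cvg_unique h _; exact: cvg_cst.
  by apply/funext => i /=; rewrite av1.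
- move=> c u v /null_predP u0 /null_predP v0.
  have [M M0 hM] := cauchy_bound (@cseq_is_cauchy c).
  apply: (@null_le _ u (fun i => M * a (u i) + a (v i))).
    rewrite -(addr0 0) -[X in X + _](mulr0 M); apply: cvgD => //.
    exact: cvgMl_tmp.
  move=> i; rewrite (le_trans (avD _ _ _))// lerD2r avM.
  by rewrite ler_wpM2r ?av_ge0.
Qed.

HB.instance Definition _ := isIdealr.Build cauchy_seq null_pred null_ideal_closed.

Definition null_ideal : idealr cauchy_seq := null_pred.

(* The completion of rat with respect to a: Cauchy sequences modulo null
   sequences. *)
Definition completion : Type := {ideal_quot null_ideal}.


HB.instance Definition _ := GRing.ComNzRing.on completion.

Definition cpi (u : cauchy_seq) : completion := \pi_({ideal_quot null_ideal}) u.
Definition crepr (x : completion) : cauchy_seq := repr x.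

Lemma creprK : cancel crepr cpi. Proof. exact: reprK. Qed.

Lemma cpi0 : cpi 0 = 0. Proof. exact: (rmorph0 (\pi_({ideal_quot null_ideal}))). Qed.
Lemma cpi1 : cpi 1 = 1. Proof. exact: (rmorph1 (\pi_({ideal_quot null_ideal}))). Qed.
Lemma cpiB u v : cpi (u - v) = cpi u - cpi v.
Proof. exact: (rmorphB (\pi_({ideal_quot null_ideal}))). Qed.
Lemma cpiM u v : cpi (u * v) = cpi u * cpi v.
Proof. exact: (rmorphM (\pi_({ideal_quot null_ideal}))). Qed.

Lemma cpi_eq u v : (cpi u == cpi v) = (u - v \in null_pred).
Proof. by rewrite Quotient.idealrBE. Qed.

Definition cabs (x : completion) : R := limn (a \o crepr x).

Lemma cabs_cpi (u : cauchy_seq) : cabs (cpi u) = limn (a \o u).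
Proof.
have : crepr (cpi u) - u \in null_pred by rewrite -cpi_eq creprK.
move=> /null_predP h; apply/cvg_lim => //.
rewrite -[a \o _](subrK (a \o u)) -[lim _]add0r.
apply: cvgD; last exact: cauchy_av_cvg.
apply: norm_cvg0; apply: (squeeze_cvgr _ (cvg_cst 0) h).
by apply: nearW => i /=; rewrite normr_ge0/= !fctE av_dist.
Qed.

Lemma cpi_cabs (u : cauchy_seq) : a \o u @ \oo --> cabs (cpi u).
Proof. by rewrite cabs_cpi; exact: cauchy_av_cvg. Qed.

Lemma cabs_ge0 x : 0 <= cabs x.
Proof.
rewrite -(creprK x) cabs_cpi; apply: limr_ge; first exact: cauchy_av_cvg.
by apply: nearW => i; exact: av_ge0.
Qed.

Lemma cabs_eq0 x : (cabs x == 0) = (x == 0).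
Proof.
rewrite -(creprK x) -cpi0 cpi_eq subr0; apply/eqP/null_predP => [<-|h].
  exact: cpi_cabs.
exact: seq_cvg_unique (@cpi_cabs _) h.
Qed.

Lemma cabsM x y : cabs (x * y) = cabs x * cabs y.
Proof.
rewrite -(creprK x) -(creprK y) -cpiM.
apply: (seq_cvg_unique (@cpi_cabs _)).
rewrite (_ : _ \o _ = (a \o crepr x) \* (a \o crepr y)).
  by apply: cvgM; exact: cpi_cabs.
by apply/funext => i; exact: avM.
Qed.

Lemma cabsB x y : cabs (x - y) <= cabs x + cabs y.
Proof.
rewrite -(creprK x) -(creprK y) -cpiB.
apply: (@ler_cvg_to _ _ _ _ _ _ _ _ (@cpi_cabs _)
  (cvgD (@cpi_cabs _) (@cpi_cabs _))).
by apply: nearW => i; exact: avB.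
Qed.

Lemma cabsN x : cabs (- x) = cabs x.
Proof.
have c0 : cabs 0 = 0 by apply/eqP; rewrite cabs_eq0.
apply/eqP; rewrite eq_le; apply/andP; split.
  by have := cabsB 0 x; rewrite sub0r c0 add0r.
by have := cabsB 0 (- x); rewrite sub0r opprK c0 add0r.
Qed.

Fact inv_cauchy (u : cauchy_seq) (d : R) : 0 < d ->
  (\forall i \near \oo, d < a (u i)) -> (fun i => (u i)^-1) \in cauchy_pred.
Proof.
move=> d0 [N1 _ hN1]; apply/asboolP => e e0.
have [N2 hN2] := cseq_is_cauchy u (mulr_gt0 e0 (mulr_gt0 d0 d0)).
exists (maxn N1 N2) => i j; rewrite !geq_max => /andP[i1 i2] /andP[j1 j2].
have di : d < a (u i) := hN1 i i1.
have dj : d < a (u j) := hN1 j j1.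
have ai : 0 < a (u i) := lt_trans d0 di.
have aj : 0 < a (u j) := lt_trans d0 dj.
have ui : u i != 0 by rewrite -(av_eq0 a) gt_eqF.
have uj : u j != 0 by rewrite -(av_eq0 a) gt_eqF.
have -> : (u i)^-1 - (u j)^-1 = (u j - u i) / (u i * u j).
  by field; rewrite ui uj.
rewrite avM avV avM ltr_pdivrMr ?mulr_gt0//.
rewrite (lt_le_trans (hN2 _ _ j2 i2))// ler_pM2l// ler_pM// ltW//.
Qed.

Lemma completion_inverse (x : completion) : x != 0 -> exists y, y * x = 1.
Proof.
move=> x0; have l0 : 0 < cabs x by rewrite lt_neqAle cabs_ge0 eq_sym cabs_eq0 x0.
set u := crepr x.
have hu : \forall i \near \oo, cabs x / 2 < a (u i).
  apply: (cvgr_gt (cabs x)); last by rewrite ltr_pdivrMr// ltr_pMr// ltr1n.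
  by rewrite -(creprK x) /u; exact: cpi_cabs.
have l20 : 0 < cabs x / 2 by rewrite divr_gt0.
exists (cpi (CauchySeq (inv_cauchy l20 hu))).
rewrite -[X in _ * X](creprK x) -cpiM -cpi1; apply/eqP; rewrite cpi_eq.
apply/null_predP; apply: (@cvg_near_cst _ _ (0 : R)).
near=> i; rewrite [LHS](_ : _ = a ((u i)^-1 * u i - 1))// mulVf ?subrr ?av0//.
by rewrite -(av_eq0 a) gt_eqF// (lt_trans l20)//; near: i.
Unshelve. all: by end_near. Qed.

Definition cinv (x : completion) : completion :=
  if x == 0 then 0 else xget 0 [set y | y * x = 1].

Fact cmulVf (x : completion) : x != 0 -> cinv x * x = 1.
Proof.
move=> x0; rewrite /cinv (negbTE x0).
by apply: (@xgetPex _ 0 [set y | y * x = 1]); exact: completion_inverse.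
Qed.

Fact cinv0 : cinv 0 = 0. Proof. by rewrite /cinv eqxx. Qed.

HB.instance Definition _ :=
  GRing.ComNzRing_isField.Build completion cmulVf cinv0.

Fact const_cauchy (x : rat) : (fun _ : nat => x) \in cauchy_pred.
Proof. by apply/asboolP => e e0; exists 0%N => i j _ _; rewrite subrr av0. Qed.

Definition cembed (x : rat) : completion := cpi (CauchySeq (const_cauchy x)).

Fact cembed_zmod : zmod_morphism cembed.
Proof. by move=> x y; rewrite -cpiB; congr cpi; exact: val_inj. Qed.

Fact cembed_monoid : monoid_morphism cembed.
Proof.
split; first by rewrite -cpi1; congr cpi; exact: val_inj.
by move=> x y; rewrite -cpiM; congr cpi; exact: val_inj.
Qed.

HB.instance Definition _ := GRing.isZmodMorphism.Build rat completion cembed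
  cembed_zmod.
HB.instance Definition _ := GRing.isMonoidMorphism.Build rat completion cembed
  cembed_monoid.

Lemma ratr_cembed x : ratr x = cembed x.
Proof. by rewrite -[x in RHS]divq_num_den fmorph_div !rmorph_int. Qed.

Lemma cabs_ratr x : cabs (ratr x) = a x.
Proof.
rewrite ratr_cembed cabs_cpi (_ : a \o _ = cst (a x))//.
by apply/cvg_lim => //; exact: cvg_cst.
Qed.

Lemma cembed_dense (x : completion) (e : R) :
  0 < e -> exists r : rat, cabs (x - ratr r) < e.
Proof.
move=> e0; have e20 : 0 < e / 2 by rewrite divr_gt0.
have [N hN] := cseq_is_cauchy (crepr x) e20.
exists (crepr x N); rewrite ratr_cembed.
rewrite -[X in X - _]creprK -cpiB.
apply: (@le_lt_trans _ _ (e / 2)); last by rewrite ltr_pdivrMr// ltr_pMr// ltr1n.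
apply: (@ler_cvg_to _ _ _ _ _ _ _ _ (@cpi_cabs _) (@cvg_cst _ (e / 2) _ \oo _)).
by exists N => // i /= Ni; apply: ltW; exact: hN.
Qed.

Lemma cabs_complete (x : nat -> completion) :
  (forall e : R, 0 < e -> exists N, forall i j, (N <= i)%N -> (N <= j)%N ->
     cabs (x i - x j) < e) ->
  exists l, forall e : R, 0 < e -> exists N, forall i, (N <= i)%N ->
     cabs (x i - l) < e.
Proof.
have cabsD y z : cabs (y + z) <= cabs y + cabs z.
  by rewrite -[z in leLHS]opprK (le_trans (cabsB _ _))// cabsN.
have small e : 0 < e -> exists N, forall i, (N <= i)%N -> i.+1%:R^-1 < e :> R.
  move=> e0; have [N _ hN] := near_infty_natSinv_lt (PosNum e0).
  by exists N => i Ni; exact: hN.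
move=> cx.
have /choice[r hr] i : exists r : rat, cabs (x i - ratr r) < i.+1%:R^-1 :> R.
  by apply: cembed_dense; rewrite invr_gt0.
have cr : r \in cauchy_pred.
  apply/asboolP => e e0.
  have e30 : 0 < e / 3 by rewrite divr_gt0.
  have [N1 h1] := cx _ e30; have [N2 h2] := small _ e30.
  exists (maxn N1 N2) => i j; rewrite !geq_max => /andP[i1 i2] /andP[j1 j2].
  rewrite -cabs_ratr ratr_cembed rmorphB /= -!ratr_cembed.
  have -> : ratr (r i) - ratr (r j) =
    (x i - x j) + (x j - ratr (r j)) - (x i - ratr (r i)) by ring.
  have := cabsB (x i - x j + (x j - ratr (r j))) (x i - ratr (r i)).
  have := cabsD (x i - x j) (x j - ratr (r j)).
  have := h1 _ _ i1 j1; have := lt_trans (hr i) (h2 _ i2).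
  have := lt_trans (hr j) (h2 _ j2); lra.
exists (cpi (CauchySeq cr)) => e e0.
have e30 : 0 < e / 3 by rewrite divr_gt0.
have [N1 h1] := cseq_is_cauchy (CauchySeq cr) e30; have [N2 h2] := small _ e30.
exists (maxn N1 N2) => i; rewrite geq_max => /andP[i1 i2].
have -> : x i - cpi (CauchySeq cr) =
    (x i - ratr (r i)) + (ratr (r i) - cpi (CauchySeq cr)) by ring.
have : cabs (ratr (r i) - cpi (CauchySeq cr)) <= e / 3.
  rewrite ratr_cembed -cpiB.
  apply: (@ler_cvg_to _ _ _ _ _ _ _ _ (@cpi_cabs _) (@cvg_cst _ (e / 3) _ \oo _)).
  by exists N1 => // j /= N1j; apply: ltW; exact: h1.
have := cabsD (x i - ratr (r i)) (ratr (r i) - cpi (CauchySeq cr)).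
have := lt_trans (hr i) (h2 _ i2); lra.
Qed.

End AbsoluteValue.

Section PadicAbs.
Variables (R : realType) (p : nat) (p_prime : prime p).

Definition padic_val (x : rat) : int :=
  (logn p `|numq x|)%:Z - (logn p `|denq x|)%:Z.

Definition padic_abs (x : rat) : R :=
  if x == 0 then 0 else p%:R ^ (- padic_val x).

Let p_gt1 : (1 : R) < p%:R. Proof. by rewrite ltr1n prime_gt1. Qed.
Let p_gt0 : (0 : R) < p%:R. Proof. exact: lt_trans p_gt1. Qed.

Lemma padic_valE (a b : int) : a != 0 -> b != 0 ->
  padic_val (a%:~R / b%:~R) = (logn p `|a|)%:Z - (logn p `|b|)%:Z.
Proof.
move=> a0 b0; set x := a%:~R / b%:~R.
have bq : b%:~R != 0 :> rat by rewrite intr_eq0.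
have x0 : x != 0 by rewrite mulf_neq0 ?invr_eq0// intr_eq0.
have e : numq x * b = a * denq x.
  apply: (@intr_inj rat); rewrite !rmorphM /=.
  have := divq_num_den x; rewrite {2}/x => /eqP.
  by rewrite eqr_div ?intr_eq0 ?denq_neq0// => /eqP.
have := congr1 (fun z : int => logn p `|z|) e.
rewrite /= !abszM !lognM ?absz_gt0 ?numq_eq0 ?denq_neq0// /padic_val; lia.
Qed.

Fact padic_abs_ge0 x : 0 <= padic_abs x.
Proof. by rewrite /padic_abs; case: ifP => // _; rewrite exprz_ge0// ltW. Qed.

Fact padic_abs_eq0 x : (padic_abs x == 0) = (x == 0).
Proof.
rewrite /padic_abs; case: ifP => [|_]; first by rewrite eqxx.
by rewrite expfz_eq0 (gt_eqF p_gt0) andbF.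
Qed.

Fact padic_absM x y : padic_abs (x * y) = padic_abs x * padic_abs y.
Proof.
rewrite /padic_abs mulf_eq0.
have [->|x0] := eqVneq x 0; first by rewrite /= mul0r.
have [->|y0] := eqVneq y 0; first by rewrite /= mulr0.
rewrite /= -expfzDr ?gt_eqF//; congr (_ ^ _); rewrite -opprD; congr (- _).
rewrite -{1}(divq_num_den x) -{1}(divq_num_den y) mulf_div -!intrM.
rewrite padic_valE ?mulf_neq0 ?numq_eq0 ?denq_neq0//.
rewrite !abszM !lognM ?absz_gt0 ?numq_eq0 ?denq_neq0// /padic_val; lia.
Qed.

Fact padic_absD x y : padic_abs (x + y) <= padic_abs x + padic_abs y.
Proof.
suff : padic_abs (x + y) <= Num.max (padic_abs x) (padic_abs y).
  by move=> /le_trans; apply; rewrite ge_max lerDl lerDr !padic_abs_ge0.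
have [->|x0] := eqVneq x 0; first by rewrite add0r le_max lexx orbT.
have [->|y0] := eqVneq y 0; first by rewrite addr0 le_max lexx.
have [->|xy0] := eqVneq (x + y) 0.
  by rewrite {1}/padic_abs eqxx le_max padic_abs_ge0.
rewrite /padic_abs (negbTE x0) (negbTE y0) (negbTE xy0).
rewrite le_max !ler_eXz2l// !lerN2.
set a := numq x * denq y; set b := numq y * denq x.
set d := denq x * denq y.
have d0 : d != 0 by rewrite mulf_neq0 ?denq_neq0.
have a0 : a != 0 by rewrite mulf_neq0 ?denq_neq0 ?numq_eq0.
have b0 : b != 0 by rewrite mulf_neq0 ?denq_neq0 ?numq_eq0.
have dx : (denq x)%:~R != 0 :> rat by rewrite intr_eq0 denq_neq0.
have dy : (denq y)%:~R != 0 :> rat by rewrite intr_eq0 denq_neq0.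
have ex : x = a%:~R / d%:~R.
  rewrite -{1}(divq_num_den x) !intrM; by field; rewrite ?dx ?dy.
have ey : y = b%:~R / d%:~R.
  rewrite -{1}(divq_num_den y) !intrM; by field; rewrite ?dx ?dy.
have exy : x + y = (a + b)%:~R / d%:~R by rewrite ex ey -mulrDl -intrD.
have ab0 : a + b != 0.
  by apply: contraNneq xy0 => ab; rewrite exy ab mul0r.
rewrite exy {1}ex {1}ey !padic_valE// !lerD2r !lez_nat.
have [le_ab|le_ba] := leqP (logn p `|a|) (logn p `|b|).
  rewrite -pfactor_dvdn ?absz_gt0//.
  rewrite -[(_ ^ _)%N]/`|((p ^ logn p `|a|)%N%:Z)|%N -dvdzE.
  rewrite rpredD ?dvdzE//= ?pfactor_dvdn ?absz_gt0//.
rewrite orbC -pfactor_dvdn ?absz_gt0//.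
rewrite -[(_ ^ _)%N]/`|((p ^ logn p `|b|)%N%:Z)|%N -dvdzE.
by rewrite rpredD ?dvdzE//= ?pfactor_dvdn ?absz_gt0// ltnW.
Qed.

Definition padic_av : absolute_value R :=
  AbsoluteValue padic_abs_ge0 padic_abs_eq0 padic_absM padic_absD.

End PadicAbs.

(* Places of Q: None is the infinite place, Some p is the p-adic one. *)
Definition place : Type := option {p : nat | prime p}.
HB.instance Definition _ := Choice.on place.
Definition infinite_place : place := None.

Section LocalField.
Variable R : realType.

Definition Qv_field (v : place) : fieldType :=
  if v is Some p then completion (padic_av R (valP p)) else R.

Definition Qv (v : place) : Type := Qv_field v.

HB.instance Definition _ (v : place) := GRing.Field.copy (Qv v) (Qv_field v).

Definition absv (v : place) : Qv v -> R :=
  match v with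
  | Some p => @cabs R (padic_av R (valP p))
  | None => fun x => `|x|
  end.

Lemma absv_ge0 v (x : Qv v) : 0 <= absv x.
Proof. by case: v x => [p|] x; [exact: cabs_ge0|exact: normr_ge0]. Qed.

Lemma absv_eq0 v (x : Qv v) : (absv x == 0) = (x == 0).
Proof. by case: v x => [p|] x; [exact: cabs_eq0|exact: normr_eq0]. Qed.

Lemma absvM v (x y : Qv v) : absv (x * y) = absv x * absv y.
Proof. by case: v x y => [p|] x y; [exact: cabsM|exact: normrM]. Qed.

Lemma absvN v (x : Qv v) : absv (- x) = absv x.
Proof. by case: v x => [p|] x; [exact: cabsN|exact: normrN]. Qed.

Lemma absvB v (x y : Qv v) : absv (x - y) <= absv x + absv y.
Proof. by case: v x y => [p|] x y; [exact: cabsB|exact: ler_normB]. Qed.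

Section metric.
Variable v : place.
Let dist (x y : Qv v) : R := absv (x - y).

Fact absv_distxx x : dist x x = 0.
Proof. by apply/eqP; rewrite /dist absv_eq0 subrr. Qed.

Fact absv_dist_positivity x y : dist x y = 0 -> x = y.
Proof. by move/eqP; rewrite absv_eq0 subr_eq0 => /eqP. Qed.

Fact absv_dist_sym x y : dist x y = dist y x.
Proof. by rewrite /dist -absvN opprB. Qed.

Fact absv_dist_triangle y x z : dist x z <= dist x y + dist y z.
Proof.
rewrite [dist y z]absv_dist_sym /dist.
by rewrite (_ : x - z = (x - y) - (z - y)) ?absvB// opprB addrA subrK.
Qed.

HB.instance Definition _ := isMetric.Build R (Qv v)
  absv_distxx absv_dist_positivity absv_dist_sym absv_dist_triangle.

End metric.

Section QS.
Variable S : {fset place}.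

Definition QS : Type := prod_topology (fun v : S => Qv (val v)).

HB.instance Definition _ := Uniform.on QS.

Let add (x y : QS) : QS := fun v => x v + y v.
Let opp (x : QS) : QS := fun v => - x v.
Let mul (x y : QS) : QS := fun v => x v * y v.
Let zero : QS := fun v => 0.
Let one : QS := fun v => 1.

Let QSP (x y : QS) : (forall v, x v = y v) -> x = y.
Proof. exact: functional_extensionality_dep. Qed.

Let addA : associative add.
Proof. by move=> x y z; apply/QSP => v; exact: addrA. Qed.
Let addC : commutative add.
Proof. by move=> x y; apply/QSP => v; exact: addrC. Qed.
Let add0 : left_id zero add.
Proof. by move=> x; apply/QSP => v; exact: add0r. Qed.
Let addN : left_inverse zero opp add.
Proof. by move=> x; apply/QSP => v; exact: addNr. Qed.
HB.instance Definition _ := GRing.isZmodule.Build QS addA addC add0 addN.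
HB.instance Definition _ := isPointed.Build QS 0.

Let mulA : associative mul.
Proof. by move=> x y z; apply/QSP => v; exact: mulrA. Qed.
Let mulC : commutative mul.
Proof. by move=> x y; apply/QSP => v; exact: mulrC. Qed.
Let mul1 : left_id one mul.
Proof. by move=> x; apply/QSP => v; exact: mul1r. Qed.
Let mulDl : left_distributive mul add.
Proof. by move=> x y z; apply/QSP => v; exact: mulrDl. Qed.
HB.instance Definition _ :=
  GRing.Zmodule_isComPzRing.Build QS mulA mulC mul1 mulDl.

Definition vnorm (m : nat) (v : S) (x : 'cV[QS]_m) : R :=
  \big[Num.max/0]_(i < m) absv (x i 0 v).

Definition Snorm (m : nat) (x : 'cV[QS]_m) : R :=
  \big[Num.max/0]_(v : S) vnorm v x.

Definition diag_int (m : nat) (p : 'cV[int]_m) : 'cV[QS]_m :=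
  map_mx intr p.

End QS.
End LocalField.

Definition supnorm_int (n : nat) (q : 'cV[int]_n) : nat :=
  \max_(i < n) `|q i 0%R|%N.

Definition approximable (R : realType) (S : {fset place}) (m n : nat)
    (psi : nat -> R) : set 'M[QS R S]_(m, n) :=
  [set A | infinite_set [set q : 'cV[int]_n | exists p : 'cV[int]_m,
     (Snorm (diag_int R S p + A *m diag_int R S q) ^+ #|` S|) ^+ m
       <= psi (supnorm_int q ^ n)%N]].

Notation borel G := (g_sigma_algebraType (@open G)).

(* Regularity is not required: it is automatic on the second countable
   locally compact group of matrices over QS. *)
Definition is_haar_measure (R : realType) (S : {fset place}) (m n : nat)
    (mu : {measure set (borel 'M[QS R S]_(m, n)) -> \bar R}) : Prop :=
  [/\ forall (A : 'M[QS R S]_(m, n)) (B : set (borel 'M[QS R S]_(m, n))),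
        measurable B -> mu ((fun X => A + X) @` B) = mu B,
      forall K : set 'M[QS R S]_(m, n), compact K -> (mu K < +oo)%E &
      mu setT != 0%E].

(* Main.v *)
(* Let M be the product of the primes of S.  An inequality |y| <= 1/N at every place
   of S means, up to bounded factors, that the real component of y is at most 1/N and
   that its finite components are divisible by an integer smo N of size N^(l-1).

   Convergence.  For q <> 0, the set of A in a fundamental domain with |p + A q| <= 1/N
   for some p has measure O(N^(-lm)), uniformly in q; apply Borel-Cantelli to the
   dyadic blocks of q, and Cauchy condensation to psi.

   Divergence.  At level k put N = 2^(n k), Q = 2^(lm k), so that N^(lm) = Q^n.  By
   Dirichlet's theorem every A has some q <> 0 with |q| <= Q and |p + A q| <= 1/N; the
   convergence estimate shows that, outside a set of small measure, no such q is short
   or divisible by a high power of a prime of S.  Hence a positive proportion of the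
   cells of side 1/(N Q) contain such an A, and in each of them the points with
   |p + A q| <= 1/(N t) form a proportion t^(-lm).  Take thresholds t_k such that the
   t_k^(-lm) have divergent sum but are o(Q^n psi(Q^n)) (Abel-Dini).  A second moment
   bound shows that infinitely many of these events occur on a set of positive measure.
   The set W of all A for which, for some constant C, infinitely many levels carry an
   approximation up to the factor C is invariant under integer translations and mapped
   into itself by dilations by integers d.  For d prime to M the inverse image of W
   under such a dilation is periodic under (1/d)Z and, in the fundamental domain,
   differs from W by a null set; letting d grow, W has the same density in all
   small cells, hence full measure. *)

Require Import Defs.
From mathcomp Require Import all_boot all_order all_algebra.
From mathcomp Require Import finmap.
From mathcomp Require Import all_classical all_reals all_analysis.
From mathcomp Require Import measurable_realfun.
From mathcomp Require Import ring lra zify.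
Import Order.TTheory GRing.Theory Num.Theory.
Import numFieldTopology.Exports numFieldNormedType.Exports.

Set Implicit Arguments.
Unset Strict Implicit.
Unset Printing Implicit Defensive.

Local Open Scope classical_set_scope.
Local Open Scope ring_scope.

(** * Non-archimedean places *)

(** Of the measure only invariance, finiteness on compact sets and non-vanishing are available, so
    every volume is found by counting translates: a set is small if many disjoint translates of it
    fit in a bounded box, and large if few translates of it cover a cell. The translates are made
    along a section of [A |-> A q], and here lies the arithmetic obstacle. At the finite places, for
    integral [A], the vector [A q] is divisible by the common divisor of [q], so no integral section
    exists when [q] shares a factor with the primes of [S]. The upper bound survives because the
    vectors [p] that can occur become scarcer by the same factor. The lower bound requires
    discarding the [q] for which that factor is large; what remains is a bounded denominator,
    carried along as a multiplier.

    The thresholds are taken strictly smaller than [psi] would allow because their gain, which tends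
    to infinity, is what absorbs the unspecified constant in the definition of the set [W]. *)

(* The value 1 at the infinite place lets products and indices range over all of [S]. *)
Definition place_prime (v : place) : nat := if v is Some p then val p else 1%N.

Definition is_fin (v : place) : bool := if v is Some _ then true else false.

Lemma place_prime_gt0 v : (0 < place_prime v)%N.
Proof. by case: v => [[p pp]|//]; exact: prime_gt0. Qed.

Lemma place_prime_prime v : is_fin v -> prime (place_prime v).
Proof. by case: v => [[p pp]|//]. Qed.

Section AbsoluteValues.
Variables (R : realType) (v : place).
Hypothesis v_fin : is_fin v.
Notation p := (place_prime v).
Local Notation K := (Qv R v).

Lemma absv0 : absv (0 : K) = 0.
Proof. by apply/eqP; rewrite absv_eq0. Qed.

Lemma absv1 : absv (1 : K) = 1.
Proof.
have a1 : absv (1 : K) != 0 by rewrite absv_eq0 oner_eq0.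
by apply: (mulfI a1); rewrite -absvM !mulr1.
Qed.

Lemma absvV (x : K) : absv x^-1 = (absv x)^-1.
Proof.
have [->|x0] := eqVneq x 0; first by rewrite invr0 absv0 invr0.
have ax0 : absv x != 0 by rewrite absv_eq0.
by apply: (mulfI ax0); rewrite -absvM !mulfV// absv1.
Qed.

Lemma absv_ratr (x : rat) : absv (ratr x : K) = padic_abs R p x.
Proof. by case: v v_fin => // q _; exact: cabs_ratr. Qed.

Lemma absv_int (z : int) : absv (z%:~R : K) = padic_abs R p z%:~R.
Proof. by rewrite -absv_ratr ratr_int. Qed.

Lemma absv_nat (k : nat) : (0 < k)%N ->
  absv (k%:R : K) = p%:R ^- logn p k.
Proof.
move=> k0; have /= := absv_int k; rewrite -pmulrn => ->.
rewrite /padic_abs /padic_val -pmulrn pnatr_eq0 -[X in logn p `|numq X|]divr1.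
have -> : k%:R / 1 = k%:~R :> rat by rewrite divr1 pmulrn.
rewrite (negbTE (lt0n_neq0 k0)) -[k%:R]/(k%:~R) numq_int denq_int /= logn1 subr0.
by rewrite exprnN.
Qed.

Lemma absv_nat_gt0 (k : nat) : (0 < k)%N -> 0 < absv (k%:R : K).
Proof.
move=> k0; rewrite absv_nat// invr_gt0 exprn_gt0// ltr0n.
exact: place_prime_gt0.
Qed.

Lemma absv_natM (j k : nat) :
  absv ((j * k)%:R : K) = absv (j%:R : K) * absv (k%:R : K).
Proof. by rewrite natrM absvM. Qed.

Lemma absv_int_abs (z : int) : absv (z%:~R : K) = absv (`|z|%N%:R : K).
Proof. by case: z => k; rewrite ?NegzE ?rmorphN/= ?absvN ?pmulrn. Qed.

Lemma absv_int_le (z : int) (E : nat) : (0 < E)%N ->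
  (absv (z%:~R : K) <= absv (E%:R : K)) = (p ^ logn p E %| `|z|)%N.
Proof.
move=> E0; rewrite absv_int_abs.
have [->|z0] := posnP `|z|%N.
  by rewrite dvdn0 mulr0n absv0 absv_ge0.
rewrite !absv_nat// lef_pV2 ?posrE ?exprn_gt0 ?ltr0n ?place_prime_gt0//.
rewrite ler_eXn2l ?ltr1n ?prime_gt1 ?place_prime_prime//.
by rewrite pfactor_dvdn// place_prime_prime.
Qed.

Lemma absv_int_le1 (z : int) : absv (z%:~R : K) <= 1.
Proof.
have := @absv_int_le z 1%N isT; rewrite logn1 expn0 dvd1n.
by rewrite mulr1n absv1.
Qed.

Lemma ratrD_Qv (x y : rat) : ratr (x + y) = ratr x + ratr y :> K.
Proof.
case: v v_fin => // q _; set a := padic_av R (valP q).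
have h : ratr (x + y) = ratr x + ratr y :> completion a.
  by rewrite (ratr_cembed a x) (ratr_cembed a y) -rmorphD; exact: ratr_cembed.
exact: h.
Qed.

Lemma padic_abs_max (x y : rat) :
  padic_abs R p (x + y) <= Num.max (padic_abs R p x) (padic_abs R p y).
Proof.
wlog xy : x y / padic_abs R p x <= padic_abs R p y => [wl|].
  have [xy|/ltW yx] := leP (padic_abs R p x) (padic_abs R p y).
    by have := wl _ _ xy; rewrite (max_idPr xy).
  by have := wl _ _ yx; rewrite addrC (max_idPr yx).
rewrite (max_idPr xy).
set d : nat := (`|denq x| * `|denq y|)%N.
have d0 : (0 < d)%N by rewrite muln_gt0 !absz_gt0 !denq_neq0.
pose a := numq x * denq y; pose b := numq y * denq x.
have dE : d%:R = (denq x * denq y)%:~R :> rat.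
  by rewrite /d natrM intrM !natr_absz !ger0_norm// ?ltW ?denq_gt0.
have xd : x * d%:R = a%:~R.
  by rewrite dE intrM mulrA -numqE -intrM.
have yd : y * d%:R = b%:~R.
  by rewrite dE intrM mulrCA mulrC -numqE -intrM.
have dK : 0 < padic_abs R p d%:R.
  by rewrite pmulrn -absv_int absv_nat_gt0.
have pp := place_prime_prime v_fin.
rewrite -(ler_pM2r dK) -!padic_absM// mulrDl xd yd.
have : padic_abs R p x * padic_abs R p d%:R <=
       padic_abs R p y * padic_abs R p d%:R by rewrite ler_pM2r.
rewrite -!padic_absM// xd yd -rmorphD/= -!absv_int.
have [->|b0] := eqVneq b 0.
  rewrite addr0 => /le_trans; exact.
rewrite !(absv_int_abs b) !absv_int_le ?absz_gt0//.
set q := (_ ^ _)%N => qa.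
have qb : (q %| `|b|)%N by rewrite pfactor_dvdnn.
have : (q%:Z %| a + b)%Z by rewrite rpredD// dvdzE.
by rewrite dvdzE.
Qed.

Lemma absv_dense (x : K) (e : R) : 0 < e -> exists r : rat, absv (x - ratr r) < e.
Proof. by case: v v_fin x => // q _ x e0; exact: cembed_dense. Qed.

(** The ultrametric inequality holds on the rationals and passes to the completion by density. *)
Lemma absvD_max (x y : K) : absv (x + y) <= Num.max (absv x) (absv y).
Proof.
have max_rat (r s : rat) :
  absv (ratr (r + s) : K) <= Num.max (absv (ratr r : K)) (absv (ratr s : K)).
  by rewrite !absv_ratr// padic_abs_max.
have tri (a b : K) : absv (a + b) <= absv a + absv b.
  by rewrite -[b in leLHS]opprK (le_trans (absvB _ _))// absvN.
apply/ler_addgt0Pr => e e0.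
have e40 : 0 < e / 4 by rewrite divr_gt0.
have [r hr] := absv_dense x e40; have [s hs] := absv_dense y e40.
have -> : x + y = ratr (r + s) + ((x - ratr r) + (y - ratr s)).
  by rewrite ratrD_Qv; ring.
have h1 := tri (ratr (r + s)) ((x - ratr r) + (y - ratr s)).
have h2 := tri (x - ratr r) (y - ratr s).
have h3 := max_rat r s.
have h4 : absv (ratr r : K) <= absv x + e / 4.
  have := absvB x (x - ratr r); rewrite opprB addrC subrK; lra.
have h5 : absv (ratr s : K) <= absv y + e / 4.
  have := absvB y (y - ratr s); rewrite opprB addrC subrK; lra.
have h6 : Num.max (absv (ratr r : K)) (absv (ratr s : K)) <=
    Num.max (absv x) (absv y) + e / 4.
  by rewrite ge_max (le_trans h4) ?(le_trans h5)// lerD2r le_max lexx ?orbT.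
lra.
Qed.

Lemma absvB_max (x y : K) : absv (x - y) <= Num.max (absv x) (absv y).
Proof. by rewrite (le_trans (absvD_max _ _))// absvN. Qed.

(** Approximate [x] by a rational [r]. Being integral, [r] has a denominator prime to [p], which
    Bezout's identity inverts modulo [p ^ e]; the numerator times that inverse is the required
    integer. *)
Lemma absv_approx (x : K) (e : nat) : absv x <= 1 ->
  exists a : nat, absv (x - a%:R) <= absv ((p ^ e)%:R : K).
Proof.
move=> x1.
have pe0 : (0 < p ^ e)%N by rewrite expn_gt0 place_prime_gt0.
have [r hr] : exists r : rat, absv (x - ratr r) < absv ((p ^ e)%:R : K).
  exact/absv_dense/absv_nat_gt0.
have pe1 : absv ((p ^ e)%:R : K) <= 1.
  by have := absv_int_le1 (p ^ e)%N; rewrite pmulrn.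
have r1 : absv (ratr r : K) <= 1.
  have := absvB_max x (x - ratr r); rewrite opprB addrC subrK => /le_trans; apply.
  by rewrite ge_max x1 (le_trans (ltW hr)).
have [r0|r0] := eqVneq r 0.
  exists 0%N; move: (ltW hr); rewrite r0 (_ : ratr 0 = 0%:R)//.
  by rewrite /ratr mul0r.
have pd : logn p `|denq r| = 0%N.
  have [//|pd] := posnP (logn p `|denq r|).
  have pd' : (p %| `|denq r|)%N by rewrite -(expn1 p) pfactor_dvdn// ?absz_gt0 ?denq_neq0 ?place_prime_prime.
  have pn : logn p `|numq r| = 0%N.
    rewrite lognE; case: ifP => // /and3P[_ _ pn].
    have := coprime_num_den r; rewrite /coprime => /eqP g1.
    have : (p %| 1)%N by rewrite -g1 dvdn_gcd pn.
    by rewrite dvdn1 => /eqP p1; have := place_prime_prime v_fin; rewrite p1.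
  move: r1; rewrite absv_ratr /padic_abs (negbTE r0) /padic_val pn sub0r opprK.
  rewrite -exprnP -(expr0 (p%:R : R)) ler_eXn2l ?ltr1n ?prime_gt1 ?place_prime_prime//.
  by rewrite leqNgt pd.
have cop : coprimez (denq r) (p ^ e)%N.
  rewrite /coprimez /gcdz /= eqz_nat -/(coprime _ _).
  rewrite coprimeXr// coprime_sym prime_coprime ?place_prime_prime//.
  rewrite -(expn1 p) pfactor_dvdn ?place_prime_prime ?absz_gt0 ?denq_neq0//.
  by rewrite pd.
have [u [w uw]] := Bezoutz (denq r) (p ^ e)%N; rewrite (eqP cop) in uw.
pose a := (numq r * u %% (p ^ e)%N)%Z.
have a0 : 0 <= a by rewrite modz_ge0// eqz_nat -lt0n.
have adv : ((p ^ e)%N%:Z %| numq r - denq r * a)%Z.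
  rewrite /a.
  have -> : numq r - denq r * (numq r * u %% (p ^ e)%N)%Z =
     (p ^ e)%N%:Z * (numq r * w + denq r * (numq r * u %/ (p ^ e)%N)%Z).
    have h := divz_eq (numq r * u) (p ^ e)%N.
    have h2 : numq r = numq r * (u * denq r + w * (p ^ e)%N) by rewrite uw mulr1.
    set A := (_ %% _)%Z in h *; set B := (_ %/ _)%Z in h *.
    have -> : A = numq r * u - B * (p ^ e)%N by rewrite h; ring.
    rewrite {1}h2; ring.
  exact: dvdz_mulr.
move: (a) a0 adv => {}a a0 adv.
exists `|a|%N.
have aE : (`|a|%N%:R : K) = a%:~R by rewrite -[in RHS](gez0_abs a0) pmulrn.
rewrite aE.
have -> : x - a%:~R = (x - ratr r) + (ratr r - a%:~R) by ring.
rewrite (le_trans (absvD_max _ _))// ge_max (ltW hr)/=.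
have dr0 : (denq r)%:~R != 0 :> K.
  rewrite -absv_eq0 absv_int_abs absv_nat ?absz_gt0 ?denq_neq0// pd expr0 invr1.
  by rewrite oner_eq0.
have -> : ratr r - a%:~R = (numq r - denq r * a)%:~R / (denq r)%:~R :> K.
  by rewrite /ratr [(numq r - _)%:~R]intrB intrM mulrBl [X in _ = _ - X]mulrAC mulfV// mul1r.
rewrite absvM absvV [absv (denq r)%:~R]absv_int_abs.
rewrite (absv_nat (k := `|denq r|)) ?absz_gt0 ?denq_neq0// pd expr0 invr1 invr1 mulr1.
rewrite absv_int_le//; apply: (@dvdn_trans (p ^ e)%N).
  by rewrite pfactorK// ?place_prime_prime.
by move: adv; rewrite dvdzE.
Qed.

Lemma absv_approx_lt (x : K) (e : nat) : absv x <= 1 ->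
  exists2 a : nat, (a < p ^ e)%N & absv (x - a%:R) <= absv ((p ^ e)%:R : K).
Proof.
move=> /absv_approx-/(_ e)[a ha]; exists (a %% p ^ e)%N.
  by rewrite ltn_mod expn_gt0 place_prime_gt0.
have -> : x - (a %% p ^ e)%:R = (x - a%:R) + (a %/ p ^ e * p ^ e)%:R.
  by rewrite [in a%:R](divn_eq a (p ^ e)) [in RHS]natrD; ring.
rewrite (le_trans (absvD_max _ _))// ge_max ha/= absv_natM ger_pMl ?absv_nat_gt0//.
  by have := absv_int_le1 (a %/ p ^ e)%N; rewrite pmulrn.
by rewrite expn_gt0 place_prime_gt0.
Qed.

End AbsoluteValues.

(** * Topology of matrices over Q_S and compactness *)

Section Topology.
Variable R : realType.

Lemma nbhs_absvP v (x : Qv R v) (B : set (Qv R v)) :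
  nbhs x B <-> exists2 e : R, 0 < e & forall y, absv (x - y) < e -> B y.
Proof.
split=> [/nbhs_ballP[e /= e0 h]|[e e0 h]]; last first.
  by apply/nbhs_ballP; exists e => //= y; rewrite ballEmdist; exact: h.
by exists e => // y xy; apply: h; rewrite ballEmdist.
Qed.

Variable S : {fset place}.
Local Notation QS := (QS R S).

(** As [S] is finite, one radius can serve at all places. For the direct implication, the filter
    generated by these boxes is shown to converge to [x] coordinate by coordinate. *)
Lemma nbhs_QSP (x : QS) (B : set QS) :
  nbhs x B <->
  exists2 e : R, 0 < e & forall y, (forall v, absv (x v - y v) < e) -> B y.
Proof.
split=> [xB|[e e0 h]].
  pose F := filter_from [set e : R | 0 < e]
    (fun e => [set y : QS | forall v, absv (x v - y v) < e]).
  have FF : Filter F.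
    apply: filter_from_filter; first by exists 1 => /=.
    move=> a b /= a0 b0; exists (Num.min a b); first by rewrite lt_min a0.
    by move=> y h; split => v; have := h v; rewrite lt_min => /andP[].
  suff : F --> x by move=> /(_ _ xB)[e e0 h]; exists e.
  apply/cvg_sup => v; apply/cvg_image.
    rewrite eqEsubset; split => // y _; exists (dfwith x v y) => //.
    by rewrite dfwithin.
  move=> /= C /nbhs_absvP[e e0 hC].
  rewrite nbhs_simpl /=.
  exists (proj v @^-1` C).
    by exists e => // y /(_ v); exact: hC.
  rewrite image_preimage// eqEsubset; split => // y _.
  by exists (dfwith x v y) => //; rewrite projK.
have : nbhs x [set y : QS | forall v, absv (x v - y v) < e].
  apply: (@filter_forall _ _ (fun v (y : QS) => absv (x v - y v) < e)
    _ (nbhs_filter x)) => v.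
  have := @proj_continuous _ (fun v : S => Qv R (val v)) v x.
  by move=> /(_ [set y | absv (x v - y) < e]); apply; apply/nbhs_absvP; exists e.
by apply: filterS.
Qed.

Variables m n : nat.
Local Notation T := 'M[QS]_(m, n).

Lemma nbhs_mxP (A : T) (B : set T) :
  nbhs A B <->
  exists2 e : R, 0 < e &
    forall X : T, (forall i j v, absv (A i j v - X i j v) < e) -> B X.
Proof.
split=> [[P hP PB]|[e e0 h]].
  have /choice[f hf] (ij : 'I_m * 'I_n) : exists e : R, 0 < e /\
     forall y, (forall v, absv (A ij.1 ij.2 v - y v) < e) -> P ij.1 ij.2 y.
    by have /nbhs_QSP[e e0 h] := hP ij.1 ij.2; exists e.
  exists (\big[Num.min/1]_(ij : 'I_m * 'I_n) f ij).
    by apply: lt_bigmin => // ij _; exact: (hf ij).1.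
  move=> X hX; apply: PB => i j; apply: (hf (i, j)).2 => v.
  by rewrite (lt_le_trans (hX i j v))//; exact: bigmin_le_cond.
exists (fun i j => [set y | forall v, absv (A i j v - y v) < e]).
  by move=> i j; apply/nbhs_QSP; exists e.
by move=> X hX; apply: h.
Qed.

Lemma open_mxP (B : set T) :
  open B <-> forall A, B A -> exists2 e : R, 0 < e &
    forall X : T, (forall i j v, absv (A i j v - X i j v) < e) -> B X.
Proof.
rewrite openE; split => [h A /h/nbhs_mxP//|h A /h hA].
exact/nbhs_mxP.
Qed.

Lemma ultra_bigcup (U : Type) (F : set_system U) (I : finType)
    (B : I -> set U) : UltraFilter F -> F (\bigcup_i B i) -> exists i, F (B i).
Proof.
move=> FU FB; absurd_not => h.
have FBc i : F (~` B i).
  by have [/(h i)|] := in_ultra_setVsetC (B i) FU.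
have [x [[i _ Bx] cx]] := filter_ex (filterI FB (filter_forall _ FBc)).
exact: cx Bx.
Qed.

(** An ultrafilter on the ball of a finite place contains, for every [e], one of the finitely many
    residue classes modulo [p ^ e]. Representatives of these classes form a Cauchy sequence, and the
    ultrafilter converges to its limit. At the infinite place the ball is a segment. *)
Lemma ball_compact v : compact [set x : Qv R v | absv x <= 1].
Proof.
rewrite compact_ultra => F FU FB.
case E : v => [q|] in F FU FB *; last first.
  have /= := @segment_compact R (-1) 1; rewrite compact_ultra.
  move=> /(_ F FU)[|l [lB lF]].
    by apply: filterS FB => x /=; rewrite in_itv/= -ler_norml.
  exists l; split; first by move: lB; rewrite /= in_itv/= -ler_norml.
  move=> B /nbhs_absvP[e e0 hB]; apply: lF.
  by apply/nbhs_ballP; exists e => // y; exact: hB.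
have vf : is_fin v by rewrite E.
rewrite -{}E in F FU FB *.
pose p := place_prime v.
have cov e : exists a : nat, F [set x | absv (x - a%:R) <= absv ((p ^ e)%:R : Qv R v)].
  have [|a Fa] := @ultra_bigcup _ F 'I_(p ^ e)
    (fun a => [set x | absv (x - a%:R) <= absv ((p ^ e)%:R : Qv R v)]) FU.
    apply: filterS FB => x /= /(absv_approx_lt vf e)[a ae xa].
    by exists (Ordinal ae).
  by exists a.
have [a ha] := choice cov.
have pe0 e : (0 < p ^ e)%N by rewrite expn_gt0 place_prime_gt0.
have small (d : R) : 0 < d -> exists e, absv ((p ^ e)%:R : Qv R v) < d.
  move=> d0; have [k hk] : exists k : nat, d^-1 < k%:R.
    by have [k _ hk] := near_infty_natSinv_lt (PosNum d0); exists k.+1; rewrite invf_plt ?posrE// hk /=.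
  exists k; rewrite absv_nat// pfactorK ?place_prime_prime//.
  rewrite invf_plt ?posrE ?exprn_gt0 ?ltr0n ?place_prime_gt0// (lt_le_trans hk)//.
  by rewrite -natrX ler_nat ltnW// ltn_expl// prime_gt1// place_prime_prime.
have [l hl] : exists l : Qv R v, forall d : R, 0 < d -> exists N, forall i, (N <= i)%N ->
    absv ((a i)%:R - l) < d.
  have cau : forall d : R, 0 < d -> exists N, forall i j, (N <= i)%N -> (N <= j)%N ->
     absv ((a i)%:R - (a j)%:R : Qv R v) < d.
    move=> d /small[e he]; exists e => i j ei ej.
    (* Two of the chosen classes always meet, because both belong to the filter. *)
    have [x [hi hj]] := filter_ex (filterI (ha i) (ha j)).
    have mono k : (e <= k)%N -> absv ((p ^ k)%:R : Qv R v) <= absv ((p ^ e)%:R : Qv R v).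
      move=> ek; rewrite !absv_nat// !pfactorK ?place_prime_prime//.
      rewrite lef_pV2 ?posrE ?exprn_gt0 ?ltr0n ?place_prime_gt0//.
      by rewrite ler_eXn2l ?ltr1n ?prime_gt1 ?place_prime_prime.
    have -> : (a i)%:R - (a j)%:R = (x - (a j)%:R) - (x - (a i)%:R) by ring.
    rewrite (le_lt_trans (absvB_max vf _ _))// gt_max.
    by rewrite (le_lt_trans hj)/= ?(le_lt_trans hi)// (le_lt_trans (mono _ _)).
  case: (v) (a) cau => [q0|] a0 cau; first exact: cabs_complete.
  have : cvgn (fun i => (a0 i)%:R : R).
    apply: cauchy_cvg; apply: cauchy_exP => e e0; have [N h] := cau _ e0.
    exists ((a0 N)%:R); exists N => // i /= Ni; exact: h.
  move=> /cvg_ex[l hl]; exists l => d d0; have /= := hl (ball l d).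
  move=> /(_ (nbhsx_ballx _ _ d0))[N _ hN]; exists N => i Ni.
  by have := hN i Ni; rewrite /ball/= distrC.
exists l; split.
  have [N hN] := hl 1 ltr01.
  have [x [_ x1]] := filter_ex (filterI (ha N) FB).
  have := hN N (leqnn N) => /ltW h.
  have -> : l = (a N)%:R - ((a N)%:R - l) by ring.
  rewrite /= (le_trans (absvB_max vf _ _))// ge_max h andbT.
  by have := absv_int_le1 R vf (a N); rewrite pmulrn.
move=> B /nbhs_absvP[d d0 hB].
have [N hN] := hl d d0; have [e he] := small d d0.
have ne : (e <= maxn e N)%N by rewrite leq_maxl.
apply: filterS (ha (maxn e N)) => x /= hx; apply: hB.
have -> : l - x = - ((x - (a (maxn e N))%:R) + ((a (maxn e N))%:R - l)) by ring.
rewrite absvN (le_lt_trans (absvD_max vf _ _))// gt_max hN ?leq_maxr// andbT.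
rewrite (le_lt_trans hx)// (le_lt_trans _ he)//.
rewrite !absv_nat// !pfactorK ?place_prime_prime//.
rewrite lef_pV2 ?posrE ?exprn_gt0 ?ltr0n ?place_prime_gt0//.
by rewrite ler_eXn2l ?ltr1n ?prime_gt1 ?place_prime_prime.
Qed.

(** Tychonoff's theorem for finitely many coordinates: the images of an ultrafilter converge in the
    compact balls, and their limits assemble into a matrix. This is what makes the Haar measure of
    the unit cell finite. *)
Lemma box_compact : compact [set A : T | forall i j v, absv (A i j v) <= 1].
Proof.
rewrite compact_ultra => F FU FB.
pose f (k : ('I_m * 'I_n) * S) (A : T) : Qv R (val k.2) := A k.1.1 k.1.2 k.2.
have /choice[l hl] (k : ('I_m * 'I_n) * S) : exists y : QS,
    absv (y k.2) <= 1 /\ f k @ F --> y k.2.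
  have fsurj : f k @` setT = setT.
    rewrite eqEsubset; split => // y _.
    exists (const_mx (dfwith (0 : QS) k.2 y)) => //.
    by rewrite /f mxE dfwithin.
  have FkU : UltraFilter [set f k @` A | A in F] by exact: ultra_image.
  have := @ball_compact (val k.2); rewrite compact_ultra => /(_ _ FkU)[|y [y1 Fy]].
    exists [set A : T | forall i j v, absv (A i j v) <= 1] => //.
    rewrite eqEsubset; split => y /=; first by move=> [A h <-]; exact: h.
    move=> y1; exists (const_mx (dfwith (0 : QS) k.2 y)); last by rewrite /f mxE dfwithin.
    by move=> i j v; rewrite mxE; case: dfwithP => // w wk; rewrite absv0 ler01.
  exists (dfwith (0 : QS) k.2 y); rewrite dfwithin; split => // B By.
  have [A FA fAB] := Fy _ By; suff AB : A `<=` f k @^-1` B by apply: (filterS AB).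
  by move=> x Ax; rewrite /preimage/= -fAB; exists x.
exists (\matrix_(i, j) (fun v => l ((i, j), v) v)); split.
  by move=> i j v; rewrite mxE; exact: (hl ((i, j), v)).1.
move=> B /nbhs_mxP[e e0 hB]; apply: (filterS hB).
have Fk k : F [set X : T | absv (l k k.2 - f k X) < e].
  by apply: ((hl k).2 [set y | absv (l k k.2 - y) < e]); apply/nbhs_absvP; exists e.
apply: filterS (filter_forall _ Fk) => X hX i j v; rewrite mxE.
exact: hX ((i, j), v).
Qed.

End Topology.

(** * Arithmetic of Q_S: real component and divisibility at the finite places *)

Section QSArithmetic.
Variables (R : realType) (S : {fset place}).
Hypothesis S_infinite : infinite_place \in S.
Local Notation QS := (QS R S).

Definition v0 : S := [` S_infinite]%fset.

Lemma v0_or_finite (v : S) : v = v0 \/ is_fin (val v).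
Proof.
have : forall u : place, u = infinite_place \/ is_fin u by case; [right|left].
by move=> /(_ (val v))[vE|]; [left; apply: val_inj|right].
Qed.

Definition re (x : QS) : R := x v0.

Lemma reE x : re x = x v0. Proof. by []. Qed.

Lemma QSD (x y : QS) v : (x + y) v = x v + y v. Proof. by []. Qed.
Lemma QSN (x : QS) v : (- x) v = - x v. Proof. by []. Qed.
Lemma QSB (x y : QS) v : (x - y) v = x v - y v. Proof. by []. Qed.
Lemma QSM (x y : QS) v : (x * y) v = x v * y v. Proof. by []. Qed.

Lemma QSnat k v : (k%:R : QS) v = k%:R.
Proof. by elim: k => // k IH; rewrite !mulrS QSD IH. Qed.

Lemma QSint (z : int) v : (z%:~R : QS) v = z%:~R.
Proof. by case: z => k; rewrite ?NegzE ?rmorphN/= -?pmulrn ?QSN QSnat. Qed.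

Lemma QSsum (I : Type) (r : seq I) P (F : I -> QS) v :
  (\sum_(i <- r | P i) F i) v = \sum_(i <- r | P i) F i v.
Proof.
elim/big_rec2 : _ => // i y1 y2 _; rewrite QSD; move=> <- //.
Qed.

Lemma reD (x y : QS) : re (x + y) = re x + re y. Proof. by []. Qed.
Lemma reN (x : QS) : re (- x) = - re x. Proof. by []. Qed.
Lemma reB (x y : QS) : re (x - y) = re x - re y. Proof. by []. Qed.
Lemma reM (x y : QS) : re (x * y) = re x * re y. Proof. by []. Qed.
Lemma re0 : re 0 = 0. Proof. by []. Qed.
Lemma renat k : re k%:R = k%:R.
Proof. by elim: k => // k IH; rewrite !mulrS reD IH. Qed.

Lemma reint (z : int) : re z%:~R = z%:~R.
Proof. by case: z => k; rewrite ?NegzE ?rmorphN/= -?pmulrn ?reN renat. Qed.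

Lemma resum (I : Type) (r : seq I) P (F : I -> QS) :
  re (\sum_(i <- r | P i) F i) = \sum_(i <- r | P i) re (F i).
Proof. by elim/big_rec2 : _ => // i y1 y2 _; rewrite reD => <-. Qed.

(** The type of a component depends on its place, hence the dependent match: the real component
    becomes [x], the finite ones are kept from [y]. The two kinds of components can thus be moved
    independently. *)
Definition mkQS (x : R) (y : QS) : QS := fun v =>
  match val v as u return Qv R u -> Qv R u with
  | None => fun _ => x | Some _ => fun t => t end (y v).

Lemma re_mkQS x y : re (mkQS x y) = x. Proof. by []. Qed.

Lemma mkQS_fin x y (v : S) : is_fin (val v) -> mkQS x y v = y v.
Proof. by rewrite /mkQS; case: (val v) (y v). Qed.

(* [fin_le E x] says that the finite component of [x] lies in [E] times the
   ring of integers. *)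
Definition fin_le (E : nat) (x : QS) : Prop := forall v : S, is_fin (val v) ->
  absv (x v) <= absv (E%:R : Qv R (val v)).

Lemma fin_le0 E : fin_le E 0.
Proof. by move=> v vf; rewrite absv0 absv_ge0. Qed.

Lemma fin_leD E x y : fin_le E x -> fin_le E y -> fin_le E (x + y).
Proof.
move=> hx hy v vf; rewrite (le_trans (absvD_max vf _ _))// ge_max.
by rewrite hx ?hy.
Qed.

Lemma fin_leN E x : fin_le E x -> fin_le E (- x).
Proof. by move=> hx v vf; rewrite QSN absvN hx. Qed.

Lemma fin_leB E x y : fin_le E x -> fin_le E y -> fin_le E (x - y).
Proof. by move=> hx hy; apply: fin_leD => //; exact: fin_leN. Qed.

Lemma fin_le_sum E (I : Type) (r : seq I) (P : pred I) (F : I -> QS) :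
  (forall i, P i -> fin_le E (F i)) -> fin_le E (\sum_(i <- r | P i) F i).
Proof. by move=> h; elim/big_ind : _; [exact: fin_le0|exact: fin_leD|]. Qed.

Lemma fin_leM E F x y : fin_le E x -> fin_le F y -> fin_le (E * F) (x * y).
Proof.
by move=> hx hy v vf; rewrite QSM absv_natM absvM ler_pM ?absv_ge0 ?hx ?hy.
Qed.

Lemma fin_le_dvd E F x : (0 < E)%N -> (F %| E)%N -> fin_le E x -> fin_le F x.
Proof.
move=> E0 /dvdnP[k Ek] hx v vf; rewrite (le_trans (hx _ vf))// Ek absv_natM.
rewrite ler_piMl ?absv_ge0//.
by have := absv_int_le1 R vf k; rewrite pmulrn.
Qed.

Lemma fin_le_int1 (z : int) : fin_le 1 z%:~R.
Proof. by move=> v vf; rewrite QSint absv1 absv_int_le1. Qed.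

Lemma fin_leMint E (z : int) x : fin_le E x -> fin_le E (x * z%:~R).
Proof. by move=> hx; rewrite -(muln1 E); exact: fin_leM (fin_le_int1 z). Qed.

Lemma fin_le_pM E F x : (0 < F)%N -> fin_le (F * E) (F%:R * x) <-> fin_le E x.
Proof.
move=> F0; split=> h v vf; have := h v vf;
  rewrite QSM absvM QSnat absv_natM ler_pM2l//; exact: absv_nat_gt0.
Qed.

Lemma fin_le_nat E (k : nat) : (E %| k)%N -> fin_le E k%:R.
Proof.
move=> /dvdnP[j ->]; rewrite mulnC natrM.
have := @fin_leM E 1 E%:R j%:R; rewrite muln1; apply.
  by move=> v vf; rewrite QSnat.
by have := fin_le_int1 j; rewrite pmulrn.
Qed.

Definition Spi : nat_pred :=
  [pred p | [exists v : S, is_fin (val v) && (place_prime (val v) == p)]].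

(** All primes of [E] belong to [S], so the finite places of [S] see every prime power that divides
    [E]. *)
Lemma fin_le_intP E (z : int) : Spi.-nat E ->
  (fin_le E z%:~R <-> (E %| `|z|)%N).
Proof.
move=> SE; have E0 := part_gt0 Spi E.
have {}E0 : (0 < E)%N by case/andP: SE.
split => [h|Ez].
  apply/dvdn_partP => // p; rewrite mem_primes => /and3P[pp _ pE].
  have : p \in Spi by apply: (pnatPpi SE); rewrite mem_primes pp E0.
  move=> /existsP[v /andP[vf /eqP vp]].
  by have := h v vf; rewrite QSint absv_int_le// vp p_part.
have -> : z%:~R = `|z|%N%:R * (sgz z)%:~R :> QS.
  by rewrite pmulrn -intrM mulrC -{1}(intEsg z).
exact/fin_leMint/fin_le_nat.
Qed.

Lemma chinese_family (I : eqType) (s : seq I) (q a : I -> nat) : uniq s ->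
  (forall i j, i != j -> coprime (q i) (q j)) ->
  exists b, forall i, i \in s -> b = a i %[mod q i].
Proof.
move=> + cop; elim: s => [|i s IH /= /andP[iS us]]; first by exists 0%N.
have [b hb] := IH us.
have cq : coprime (q i) (\prod_(j <- s) q j).
  rewrite coprime_sym big_seq; elim/big_ind : _ => [|x y|j js].
  - by rewrite coprime1n.
  - by move=> hx hy; rewrite coprimeMl hx hy.
  - by rewrite coprime_sym cop//; apply: contraNneq iS => ->.
exists (chinese (q i) (\prod_(j <- s) q j) (a i) b) => j.
rewrite inE => /orP[/eqP->|js]; first by rewrite chinese_modl.
rewrite -(hb j js).
have jd : (q j %| \prod_(j <- s) q j)%N.
  by rewrite (big_rem j)//= dvdn_mulr.
have := chinese_modr cq (a i) b => /(congr1 (fun x => x %% q j)%N).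
by rewrite !modn_dvdm.
Qed.

Lemma place_prime_inj (v w : S) : is_fin (val v) -> is_fin (val w) ->
  place_prime (val v) = place_prime (val w) -> v = w.
Proof.
move=> vf wf h; apply: val_inj; case: (val v) (val w) vf wf h => [p|//] [q|//] _ _ /=.
by move=> pq; congr Some; exact: val_inj.
Qed.

Lemma place_prime_coprime (v w : S) : v != w ->
  coprime (place_prime (val v)) (place_prime (val w)).
Proof.
move=> vw.
have [->|vf] := v0_or_finite v; first by rewrite /= coprime1n.
have [->|wf] := v0_or_finite w; first by rewrite /= coprimen1.
rewrite prime_coprime ?place_prime_prime// dvdn_prime2 ?place_prime_prime//.
by apply: contraNneq vw => /place_prime_inj->.
Qed.

(** By the Chinese remainder theorem, integers approximate the integral elements at all finite
    places of [S] simultaneously. Reduction modulo [E] is harmless because [fin_le E] only involves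
    prime powers dividing [E]. *)
Lemma fin_le_approx E x : (0 < E)%N -> fin_le 1 x ->
  exists2 a, (a < E)%N & fin_le E (x - a%:R).
Proof.
move=> E0 x1; pose q (v : S) := (place_prime (val v) ^ logn (place_prime (val v)) E)%N.
have q0 v : (0 < q v)%N by rewrite expn_gt0 place_prime_gt0.
have qE v : (q v %| E)%N.
  by have [->|vf] := v0_or_finite v; rewrite ?/q/= ?exp1n ?dvd1n ?pfactor_dvdnn.
have /choice[a ha] (v : S) : exists a : nat, is_fin (val v) ->
    absv (x v - a%:R) <= absv ((q v)%:R : Qv R (val v)).
  have [->|vf] := v0_or_finite v; first by exists 0%N.
  have [|a ha] := @absv_approx R _ vf (x v) (logn (place_prime (val v)) E).
    by rewrite (le_trans (x1 v vf))// absv1.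
  by exists a.
have cop (v w : S) : v != w -> coprime (q v) (q w).
  by move=> vw; rewrite coprimeXl// coprimeXr// place_prime_coprime.
have [b hb] := chinese_family a (enum_uniq S) cop.
exists (b %% E)%N; first by rewrite ltn_mod.
move=> v vf.
have -> : absv (E%:R : Qv R (val v)) = absv ((q v)%:R : Qv R (val v)).
  by rewrite !absv_nat// pfactorK// place_prime_prime.
have modle c d : c = d %[mod q v] ->
   absv (c%:R - d%:R : Qv R (val v)) <= absv ((q v)%:R : Qv R (val v)).
  move=> cd; wlog dc : c d cd / (d <= c)%N.
    move=> wl; have [dc|/ltnW dc] := leqP d c; first exact: wl.
    by rewrite -absvN opprB; apply: wl.
  rewrite -natrB// pmulrn absv_int_le// pfactorK ?place_prime_prime//.
  by rewrite -/(q v) /= -eqn_mod_dvd// cd.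
have -> : (x - (b %% E)%:R) v = (x v - (a v)%:R) + ((a v)%:R - (b %% E)%:R).
  by rewrite QSB QSnat; ring.
rewrite (le_trans (absvD_max vf _ _))// ge_max ha//=; apply: modle.
by rewrite modn_dvdm// hb// mem_enum.
Qed.

End QSArithmetic.

(** * Integers supported on S, and linear forms with integer coefficients *)

Section Smooth.
Variables (R : realType) (S : {fset place}).
Hypothesis S_infinite : infinite_place \in S.
Local Notation QS := (QS R S).
Local Notation pr v := (place_prime (val v)).
Local Notation v0 := (v0 S_infinite).
Local Notation re := (@re R S S_infinite).
Local Notation l1 := (#|` S|.-1).

(** This is the integer M of the overview. *)
Definition Sprod : nat := \prod_(v : S) pr v.

(* The product over the finite [v] of the largest power of the prime of [v] not
   exceeding [N]: [|smo N|_v] is [1 / N] up to a bounded factor, at every finite [v]. *)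
Definition smo (N : nat) : nat := \prod_(v : S) pr v ^ trunc_log (pr v) N.

Lemma prod_place_gt0 (e : S -> nat) : (0 < \prod_(v : S) pr v ^ e v)%N.
Proof. by apply: prodn_gt0 => v; rewrite expn_gt0 place_prime_gt0. Qed.

Lemma SprodE : Sprod = (\prod_(v : S) pr v ^ 1)%N.
Proof. by apply: eq_bigr => v _; rewrite expn1. Qed.

Lemma Sprod_gt0 : (0 < Sprod)%N. Proof. by rewrite SprodE prod_place_gt0. Qed.
Lemma smo_gt0 N : (0 < smo N)%N. Proof. exact: prod_place_gt0. Qed.

Lemma prod_place_Spi (e : S -> nat) : (Spi S).-nat (\prod_(v : S) pr v ^ e v)%N.
Proof.
elim/big_ind : _ => [//|x y hx hy|v _]; first by rewrite pnatM hx hy.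
have [->|vf] := v0_or_finite S_infinite v; first by rewrite exp1n.
rewrite pnatX; apply/orP; left; rewrite pnatE ?place_prime_prime//.
by apply/existsP; exists v; rewrite vf /=.
Qed.

Lemma Sprod_Spi : (Spi S).-nat Sprod.
Proof. by rewrite SprodE prod_place_Spi. Qed.

Lemma smo_Spi N : (Spi S).-nat (smo N). Proof. exact: prod_place_Spi. Qed.

Lemma logn_prod_place (e : S -> nat) (v : S) : is_fin (val v) ->
  logn (pr v) (\prod_(w : S) pr w ^ e w) = e v.
Proof.
move=> vf; rewrite (bigD1 v)//= lognM; last 2 first.
- by rewrite expn_gt0 place_prime_gt0.
- by apply: prodn_cond_gt0 => w _; rewrite expn_gt0 place_prime_gt0.
rewrite pfactorK ?place_prime_prime// logn_coprime ?addn0//.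
rewrite big_seq_cond; elim/big_ind : _ => [|x y|w /andP[_ wv]].
- by rewrite coprimen1.
- by move=> hx hy; rewrite coprimeMr hx hy.
- by rewrite coprimeXr// place_prime_coprime// eq_sym.
Qed.

Lemma logn_smo N (v : S) : is_fin (val v) -> logn (pr v) (smo N) = trunc_log (pr v) N.
Proof. exact: logn_prod_place. Qed.

Lemma logn_Sprod (v : S) : is_fin (val v) -> logn (pr v) Sprod = 1%N.
Proof. by rewrite SprodE => vf; rewrite (@logn_prod_place (fun=> 1%N)). Qed.

Lemma smo_dvd N N' : (N <= N')%N -> (smo N %| smo N')%N.
Proof.
move=> NN'; rewrite /smo; elim/big_ind2 : _ => [//|*|v _]; first exact: dvdn_mul.
by rewrite dvdn_exp2l// leq_trunc_log.
Qed.

Lemma smo_le N : (0 < N)%N -> (smo N <= N ^ l1)%N.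
Proof.
move=> N0; rewrite /smo (bigD1 v0)//= exp1n mul1n.
have -> : l1 = #|predC1 v0| by rewrite cardC1 cardfE.
rewrite -prod_nat_const; apply: leq_prod => v _.
have [->|vf] := v0_or_finite S_infinite v; first by rewrite exp1n.
by apply: trunc_logP => //; rewrite prime_gt1 ?place_prime_prime.
Qed.

(** At each of the [l - 1] finite places one more factor of the prime brings the power above [N];
    together these factors make up [Sprod]. *)
Lemma smo_ge N : (N ^ l1 <= Sprod * smo N)%N.
Proof.
have -> : l1 = #|predC1 v0| by rewrite cardC1 cardfE.
rewrite /smo /Sprod -big_split/= [leqRHS](bigD1 v0)//= exp1n !mul1n.
rewrite -prod_nat_const; apply: leq_prod => v vv0.
have [/eqP|vf] := v0_or_finite S_infinite v; first by move: vv0; rewrite inE => /negbTE->.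
by rewrite -expnS ltnW// trunc_log_ltn// prime_gt1 ?place_prime_prime.
Qed.

(** With [absv_Sprod_smo_le] this sandwiches the inequality |x|_v <= 1/N between divisibility of [x]
    by [Sprod * smo N] and divisibility by [smo N]. *)
Lemma absv_smo_ge N (v : S) : (0 < N)%N -> is_fin (val v) ->
  N%:R^-1 <= absv ((smo N)%:R : Qv R (val v)).
Proof.
move=> N0 vf; rewrite absv_nat ?smo_gt0// logn_smo// -natrX lef_pV2.
- by rewrite ler_nat trunc_logP// prime_gt1 ?place_prime_prime.
- by rewrite posrE ltr0n.
- by rewrite posrE ltr0n expn_gt0 place_prime_gt0.
Qed.

Lemma absv_Sprod_smo_le N (v : S) : (0 < N)%N -> is_fin (val v) ->
  absv ((Sprod * smo N)%:R : Qv R (val v)) <= N%:R^-1.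
Proof.
move=> N0 vf; rewrite absv_nat ?muln_gt0 ?Sprod_gt0 ?smo_gt0//.
rewrite lognM ?Sprod_gt0 ?smo_gt0// logn_Sprod// logn_smo// -natrX lef_pV2.
- by rewrite ler_nat add1n ltnW// trunc_log_ltn// prime_gt1 ?place_prime_prime.
- by rewrite posrE ltr0n expn_gt0 place_prime_gt0.
- by rewrite posrE ltr0n.
Qed.

Section LinearForm.
Variables m n : nat.
Local Notation T := 'M[QS]_(m, n).
Implicit Types (q : 'cV[int]_n) (p : 'cV[int]_m) (A X : T).

Definition ap A q : 'cV[QS]_m := A *m diag_int R S q.

Lemma apE A q i : ap A q i 0 = \sum_j A i j * (q j 0)%:~R.
Proof. by rewrite mxE; apply: eq_bigr => j _; rewrite mxE. Qed.

Lemma apD A X q i : ap (A + X) q i 0 = ap A q i 0 + ap X q i 0.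
Proof. by rewrite /ap mulmxDl mxE. Qed.

Lemma apB A X q i : ap (A - X) q i 0 = ap A q i 0 - ap X q i 0.
Proof. by rewrite /ap mulmxBl !mxE. Qed.

Lemma fin_le_ap E A q : (forall i j, fin_le E (A i j)) ->
  forall i, fin_le E (ap A q i 0).
Proof. by move=> h i; rewrite apE; apply: fin_le_sum => j _; exact: fin_leMint. Qed.

Lemma supnorm_le q j : (`|q j 0%R| <= supnorm_int q)%N.
Proof. by rewrite /supnorm_int (bigD1 j)//= leq_maxl. Qed.

Lemma supnorm_gt0 q : q != 0 -> (0 < supnorm_int q)%N.
Proof.
apply: contraNltn; rewrite leqn0 => /eqP q0; apply/eqP/colP => j.
by have := supnorm_le q j; rewrite q0 leqn0 absz_eq0 mxE => /eqP.
Qed.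

Lemma re_ap_le (c : R) A q i : (forall j, `|re (A i j)| <= c) ->
  `|re (ap A q i 0)| <= n%:R * (supnorm_int q)%:R * c.
Proof.
move=> h; rewrite apE resum (le_trans (ler_norm_sum _ _ _))//.
have -> : n%:R * (supnorm_int q)%:R * c = \sum_(j < n) (c * (supnorm_int q)%:R).
  by rewrite sumr_const card_ord -mulrA [(_ * c)]mulrC mulr_natl.
apply: ler_sum => j _; rewrite reM normrM reint ler_pM// -intr_norm.
by rewrite -abszE -pmulrn ler_nat supnorm_le.
Qed.

(* The finite part of [A q] is divisible by [gcd_vec q] when [A] is integral; this
   is the only obstruction to solving [A q = Y] with [A] of the size of [Y]. *)
Definition gcd_vec q : nat := \big[gcdn/0%N]_(j < n) `|q j 0%R|%N.

Lemma gcd_vec_dvd q j : (gcd_vec q %| `|q j 0%R|)%N.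
Proof. by rewrite /gcd_vec (bigD1 j)//= dvdn_gcdl. Qed.

Lemma dvd_gcd_vec d q : (forall j, d %| `|q j 0%R|)%N -> (d %| gcd_vec q)%N.
Proof.
move=> h; rewrite /gcd_vec; elim/big_ind : _ => [|x y|//]; first by rewrite dvdn0.
by rewrite dvdn_gcd => -> ->.
Qed.

Lemma gcd_vec_gt0 q : q != 0 -> (0 < gcd_vec q)%N.
Proof.
apply: contraNltn; rewrite leqn0 => /eqP g0; apply/eqP/colP => j.
by have := gcd_vec_dvd q j; rewrite g0 dvd0n absz_eq0 mxE => /eqP.
Qed.

Lemma gcd_vec_le q : q != 0 -> (gcd_vec q <= supnorm_int q)%N.
Proof.
move=> q0; have [j qj] : exists j, q j 0 != 0.
  apply/existsP; apply: contraNT q0; rewrite negb_exists => /forallP h.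
  by apply/eqP/colP => j; rewrite mxE; apply/eqP; rewrite -[_ == _]negbK h.
apply: leq_trans (supnorm_le q j); apply: dvdn_leq; last exact: gcd_vec_dvd.
by rewrite absz_gt0.
Qed.

Lemma fin_le_gcd_vec A q : (forall i j, fin_le 1 (A i j)) ->
  forall i, fin_le (gcd_vec q) (ap A q i 0).
Proof.
move=> h i; rewrite apE; apply: fin_le_sum => j _; rewrite -[gcd_vec q]mul1n.
apply: fin_leM => // v vf; rewrite QSint absv_int_abs//.
have := gcd_vec_dvd q j => /dvdnP[k ->]; rewrite absv_natM ler_piMl ?absv_ge0//.
by have := absv_int_le1 R vf k; rewrite pmulrn.
Qed.

(* At each place, divide by an entry of [q] which is as large as possible. *)
Lemma section_ap q : q != 0 -> exists s : 'cV[QS]_m -> T,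
  [/\ forall (Y : 'cV[QS]_m) i, ap (s Y) q i 0 = Y i 0,
      forall (Y : 'cV[QS]_m) i j, `|re (s Y i j)| <= `|re (Y i 0)| / (supnorm_int q)%:R &
      forall E (Y : 'cV[QS]_m) i j, fin_le E (Y i 0) ->
        fin_le E ((gcd_vec q)%:R * s Y i j)].
Proof.
move=> q0; have g0 := gcd_vec_gt0 q0; have s0 := supnorm_gt0 q0.
have n0 : (0 < n)%N.
  by case: (n) q q0 {g0 s0} => // q; rewrite (_ : q = 0) ?eqxx//; apply/colP; case.
have [j0 hj0] : exists j, `|q j 0%R|%N = supnorm_int q.
  have [|j0 hj0] := @bigop.eq_bigmax 'I_n (fun j => `|q j 0%R|%N); first by rewrite card_ord.
  by exists j0; rewrite -hj0.
have /choice[ix hix] (v : S) : exists j, [/\ q j 0 != 0,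
    v = v0 -> `|q j 0%R|%N = supnorm_int q &
    is_fin (val v) -> absv ((gcd_vec q)%:R : Qv R (val v)) <= absv ((q j 0)%:~R : Qv R (val v))].
  have [->|vf] := v0_or_finite S_infinite v.
    by exists j0; split => //; rewrite -absz_gt0 hj0.
  pose p := pr v; have pp : prime p by exact: place_prime_prime.
  (* An entry of least valuation: if all entries were divisible by one more power of [p], so would
     be their gcd. *)
  have [j hj] : exists j, ~~ (p ^ (logn p (gcd_vec q)).+1 %| `|q j 0%R|)%N.
    apply/existsP; rewrite -negb_forall; apply/negP => /forallP/dvd_gcd_vec.
    by rewrite pfactor_dvdn// ltnn.
  have qj : q j 0 != 0 by apply: contraNneq hj => ->; rewrite dvdn0.
  exists j; split => //.
    by move=> vv0; move: vf; rewrite vv0.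
  move=> _; rewrite absv_int_abs// !absv_nat ?absz_gt0//.
  rewrite lef_pV2 ?posrE ?exprn_gt0 ?ltr0n ?place_prime_gt0//.
  rewrite ler_eXn2l ?ltr1n ?prime_gt1//.
  by move: hj; rewrite pfactor_dvdn ?absz_gt0// -ltnNge ltnS.
exists (fun Y => \matrix_(i, j) (fun v => if j == ix v then Y i 0 v / (q j 0)%:~R else 0)).
split.
- move=> Y i; rewrite apE; apply: functional_extensionality_dep => v.
  rewrite QSsum (bigD1 (ix v))//= big1 ?addr0 => [|j /negbTE jv]; last first.
    by rewrite mxE QSM jv mul0r.
  rewrite mxE QSM eqxx QSint divfK//.
  have [qv hv0 hvf] := hix v.
  have [vE|vf] := v0_or_finite S_infinite v; last first.
    rewrite -absv_eq0 gt_eqF// (lt_le_trans _ (hvf vf))//.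
    exact: absv_nat_gt0.
  by rewrite -absv_eq0; move: (qv); rewrite {}vE /absv/=; rewrite normr_eq0 intr_eq0.
- move=> Y i j; rewrite mxE !reE /=; case: eqP => [jv|_]; last first.
    by rewrite normr0 divr_ge0.
  have [qv hv0 _] := hix v0.
  rewrite normrM normfV; rewrite jv -intr_norm -abszE hv0// -pmulrn.
- move=> E Y i j hY v vf; rewrite QSM QSnat mxE; case: eqP => [jv|_]; last first.
    by rewrite mulr0 absv0 absv_ge0.
  have [qv _ hvf] := hix v; rewrite jv.
  have gq := hvf vf; have gg := absv_nat_gt0 R vf g0.
  rewrite !absvM absvV mulrCA (le_trans _ (hY v vf))// ler_piMr ?absv_ge0//.
  by rewrite ler_pdivrMr ?mul1r// (lt_le_trans gg).
Qed.

End LinearForm.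
End Smooth.

(** * Haar measure of boxes *)

Section Measure.
Variables (R : realType) (S : {fset place}).
Hypothesis S_infinite : infinite_place \in S.
Variables m n : nat.
Local Notation QS := (QS R S).
Local Notation T := 'M[QS]_(m, n).
Local Notation BT := (borel T).
Local Notation re := (@re R S S_infinite).
Implicit Types (A X : T) (q : 'cV[int]_n) (E : nat).

(** Continuity, spelled out with the absolute values of the entries so as to match the description
    of open sets in [open_mxP]. *)
Definition qcont (f : T -> QS) : Prop := forall A (e : R), 0 < e ->
  exists2 d : R, 0 < d & forall X,
    (forall i j v, absv (A i j v - X i j v) < d) ->
    forall v, absv (f A v - f X v) < e.

Lemma qcont_cst c : qcont (fun=> c).
Proof. by move=> A e e0; exists 1 => // X _ v; rewrite subrr absv0. Qed.

Lemma qcont_coord i j : qcont (fun X => X i j).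
Proof. by move=> A e e0; exists e => // X h v; exact: h. Qed.

Lemma qcontD f g : qcont f -> qcont g -> qcont (fun X => f X + g X).
Proof.
move=> hf hg A e e0; have e2 : 0 < e / 2 by rewrite divr_gt0.
have [d d0 hd] := hf A _ e2; have [d' d'0 hd'] := hg A _ e2.
exists (Num.min d d') => [|X h v]; first by rewrite lt_min d0.
have h1 : forall i j v, absv (A i j v - X i j v) < d.
  by move=> i j w; have := h i j w; rewrite lt_min => /andP[].
have h2 : forall i j v, absv (A i j v - X i j v) < d'.
  by move=> i j w; have := h i j w; rewrite lt_min => /andP[].
have -> : (f A + g A) v - (f X + g X) v = (f A v - f X v) - (g X v - g A v).
  by rewrite !QSD; ring.
rewrite (le_lt_trans (absvB _ _))// [e]splitr ltrD ?hd//.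
by rewrite -absvN opprB hd'.
Qed.

Lemma qcontMl c f : qcont f -> qcont (fun X => c * f X).
Proof.
move=> hf A e e0; pose C := 1 + \sum_(v : S) absv (c v).
have C0 : 0 < C by rewrite ltr_wpDr// sumr_ge0// => v _; exact: absv_ge0.
have [d d0 hd] := hf A _ (divr_gt0 e0 C0); exists d => // X h v.
have -> : (c * f A) v - (c * f X) v = c v * (f A v - f X v).
  by rewrite !QSM; ring.
rewrite absvM (@le_lt_trans _ _ (C * absv (f A v - f X v)))//.
  rewrite ler_wpM2r ?absv_ge0// /C (bigD1 v)//= addrCA lerDl.
  by rewrite addr_ge0// sumr_ge0// => w _; exact: absv_ge0.
by rewrite mulrC -ltr_pdivlMr// hd.
Qed.

Lemma qcont_sum (I : Type) (r : seq I) (F : I -> T -> QS) :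
  (forall i, qcont (F i)) -> qcont (fun X => \sum_(i <- r) F i X).
Proof.
move=> h; elim: r => [|i r IH].
  by under eq_fun do rewrite big_nil; exact: qcont_cst.
by under eq_fun do rewrite big_cons; exact: qcontD.
Qed.

Lemma qcont_ap q i : qcont (fun X => ap X q i 0).
Proof.
under eq_fun do rewrite apE.
apply: qcont_sum => j; under eq_fun do rewrite mulrC.
exact/qcontMl/qcont_coord.
Qed.

Lemma open_qcont f v (B : set R) :
  qcont f -> (forall x : R, B x -> exists2 e, 0 < e & forall y, `|x - y| < e -> B y) ->
  forall c, open [set X | B (absv (f X v - c))].
Proof.
move=> hf hB c; apply/open_mxP => A /= /hB[e e0 h].
have [d d0 hd] := hf A e e0; exists d => // X /hd hX; apply: h.
have := hX v; have h1 := absvB (f A v - c) (f X v - f A v).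
apply: le_lt_trans.
have tri (x y : Qv R (val v)) : absv x - absv y <= absv (x - y).
  have := absvB (x - y) (- y); rewrite absvN opprK subrK; lra.
have t1 := tri (f A v - c) (f X v - c); have t2 := tri (f X v - c) (f A v - c).
rewrite ler_norml; apply/andP; split.
  move: t2; have -> : f X v - c - (f A v - c) = - (f A v - f X v) by ring.
  rewrite absvN; lra.
move: t1; have -> : f A v - c - (f X v - c) = (f A v - f X v) by ring.
lra.
Qed.

Lemma measurable_open (B : set T) : open B -> measurable (B : set BT).
Proof. by move=> oB; exact: sub_sigma_algebra. Qed.

Lemma measurable_re_lt f c : qcont f -> measurable ([set X | re (f X) < c] : set BT).
Proof.
move=> hf; apply: measurable_open; apply/open_mxP => A /= h.
have e0 : 0 < c - re (f A) by rewrite subr_gt0.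
have [d d0 hd] := hf A _ e0; exists d => // X /hd/(_ (v0 S_infinite)).
rewrite -/(re (f A)) -/(re (f X)).
have -> : absv (f A (v0 S_infinite) - f X (v0 S_infinite)) = `|re (f A) - re (f X)| by [].
by rewrite ltr_norml => /andP[+ _]; rewrite ltrNl opprB ltrD2r.
Qed.

Lemma qcontN f : qcont f -> qcont (fun X => - f X).
Proof. by move=> hf; under eq_fun do rewrite -mulN1r; exact: qcontMl. Qed.

Lemma measurable_re_ge f c : qcont f -> measurable ([set X | c <= re (f X)] : set BT).
Proof.
move=> hf; rewrite (_ : [set _ | _] = ~` [set X | re (f X) < c]).
  by apply: measurableC; exact: measurable_re_lt.
by apply/seteqP; split => X /=; [move=> h; apply/negP; rewrite -leNgt|
  move=> /negP; rewrite -leNgt].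
Qed.

Lemma measurable_re_le f c : qcont f -> measurable ([set X | re (f X) <= c] : set BT).
Proof.
move=> hf; rewrite (_ : [set _ | _] = [set X | - c <= re (- f X)]).
  by apply: measurable_re_ge; exact: qcontN.
by apply/seteqP; split => X /=; rewrite reN lerN2.
Qed.

Lemma measurable_re_norm f c : qcont f -> measurable ([set X | `|re (f X)| <= c] : set BT).
Proof.
move=> hf.
rewrite (_ : [set _ | _] = [set X | - c <= re (f X)] `&` [set X | re (f X) <= c]).
  by apply: measurableI; [exact: measurable_re_ge|exact: measurable_re_le].
by apply/seteqP; split => X /=; rewrite ler_norml => /andP.
Qed.

Lemma measurable_forall (I : finType) (F : I -> set BT) :
  (forall i, measurable (F i)) -> measurable [set X | forall i, F i X].
Proof.
move=> h; rewrite (_ : [set _ | _] = \bigcap_(i in [set: I]) F i).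
  by apply: fin_bigcap_measurable => //; exact: finite_finset.
by apply/seteqP; split => X /= hX i; [move=> _; exact: hX|exact: hX].
Qed.

Lemma measurable_fin_le f E : qcont f -> measurable ([set X | fin_le E (f X)] : set BT).
Proof.
move=> hf; pose B v := [set X : T | is_fin (val v) ->
  absv (f X v - 0) <= absv (E%:R : Qv R (val v))].
rewrite (_ : [set _ | _] = [set X | forall v : S, B v X]); last first.
  by apply/seteqP; split => X /= h v; rewrite ?/B/=; [rewrite subr0; exact: h|
    move=> vf; have := h v vf; rewrite subr0].
apply: measurable_forall => v; rewrite /B; case: (is_fin _); last first.
  by rewrite (_ : [set _ | _] = setT)//; apply/seteqP; split.
set c := absv (E%:R : Qv R (val v)).
rewrite (_ : [set _ | _] = ~` [set X : T | [set x : R | c < x] (absv (f X v - 0))]).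
  apply: measurableC; apply: measurable_open.
  apply: (@open_qcont f v [set x : R | c < x]) => // x /= cx.
  exists (x - c); rewrite ?subr_gt0// => y; rewrite ltr_norml => /andP[_]; lra.
by apply/seteqP; split => X /=; [move=> h; apply/negP; rewrite -leNgt h|
  move=> /negP; rewrite -leNgt].
Qed.

Lemma measurable_preimage (f : T -> T) (B : set BT) :
  (forall i j, qcont (fun X => f X i j)) -> measurable B ->
  measurable ((f @^-1` B) : set BT).
Proof.
move=> hf; pose G : set (set BT) := [set B | measurable (f @^-1` B : set BT)].
apply: (@smallest_sub _ (@sigma_algebra BT setT) (@open T) G).
  split; first by rewrite /G /= preimage_set0.
  - by move=> C CG; rewrite /G /= setTD preimage_setC; exact: measurableC.
  - by move=> F FG; rewrite /G /= preimage_bigcup; exact: bigcupT_measurable.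
move=> O /= /open_mxP oO; apply: measurable_open; apply/open_mxP => A /= /oO[e e0 h].
have /choice[d hd] (ij : 'I_m * 'I_n) : exists d : R, 0 < d /\
   forall X, (forall i j v, absv (A i j v - X i j v) < d) ->
    forall v, absv (f A ij.1 ij.2 v - f X ij.1 ij.2 v) < e.
  by have [d d0 hd] := hf ij.1 ij.2 A e e0; exists d.
exists (\big[Num.min/1]_(ij : 'I_m * 'I_n) d ij).
  by apply: lt_bigmin => // ij _; exact: (hd ij).1.
move=> X hX; apply: h => i j v; apply: (hd (i, j)).2 => i' j' v'.
by rewrite (lt_le_trans (hX i' j' v'))//; exact: bigmin_le_cond.
Qed.

Lemma qcont_shift A i j : qcont (fun X => (A + X) i j).
Proof.
by under eq_fun do rewrite mxE; apply: qcontD; [exact: qcont_cst|exact: qcont_coord].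
Qed.

Lemma measurable_shift A (B : set BT) : measurable B ->
  measurable (((fun X => A + X) @^-1` B) : set BT).
Proof. by apply: measurable_preimage => i j; exact: qcont_shift. Qed.

(** Stated with preimages, which commute with all set operations, whereas [is_haar_measure] uses
    images. *)
Definition translation_invariant (mu : {measure set BT -> \bar R}) : Prop :=
  forall A (B : set BT), measurable B -> mu ((fun X : T => A + X) @^-1` B) = mu B.

Lemma haar_translation_invariant (mu : {measure set BT -> \bar R}) :
  is_haar_measure mu -> translation_invariant mu.
Proof.
move=> [h _ _] A B mB; rewrite -(h (- A) B mB); congr (mu _).
apply/seteqP; split => X /=.
  by move=> BX; exists (A + X) => //; rewrite addKr.
by move=> [Y BY <-]; rewrite addNKr.
Qed.

Lemma sume_ord_const (k : nat) (x : \bar R) :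
  (\sum_(i < k) x = k%:R%:E * x)%E.
Proof.
elim: k => [|k IH]; first by rewrite big_ord0 mul0e.
rewrite big_ord_recl IH -[X in (X + _)%E]mul1e -ge0_muleDl ?lee_fin//.
by rewrite -EFinD -natr1 addrC.
Qed.

End Measure.

Lemma le_div_shift (R : realFieldType) (D a x : R) : 0 < D ->
  (0 <= - (a / D) + x) = (a <= D * x).
Proof. by move=> D0; rewrite addrC subr_ge0 ler_pdivrMr// mulrC. Qed.

Lemma lt_div_shift (R : realFieldType) (D a x : R) : 0 < D ->
  (D * (- (a / D) + x) < 1) = (D * x < a + 1).
Proof.
by move=> D0; rewrite mulrDr mulrN mulrC divfK ?gt_eqF// addrC ltrBlDr addrC.
Qed.

(** * Cells, and measures obtained by counting translates *)

Section Cells.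
Variables (R : realType) (S : {fset place}).
Hypothesis S_infinite : infinite_place \in S.
Variables m n : nat.
Local Notation QS := (QS R S).
Local Notation T := 'M[QS]_(m, n).
Local Notation BT := (borel T).
Local Notation re := (@re R S S_infinite).
Local Notation mkQS := (@mkQS R S).
Implicit Types (A X : T) (D E : nat).

(** At the real place a half-open interval of the grid of mesh 1/D, at the finite places a coset of
    [E] times the integers. Comparing integer parts makes membership an equivalence relation, so two
    cells with the same [D] and [E] are equal or disjoint. *)
Definition cell D E A : set T := [set X | forall i j,
  Num.floor (D%:R * re (X i j)) = Num.floor (D%:R * re (A i j)) /\
  fin_le E (X i j - A i j)].

(** The interval [0, 1) times the rings of integers, in every entry: a fundamental domain for the
    integer matrices acting on the matrices integral at the finite places. *)
Definition unit_cell : set T := cell 1 1 0.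

Lemma cell_refl D E A : cell D E A A.
Proof. by move=> i j; rewrite subrr; split => //; exact: fin_le0. Qed.

Lemma cell_eq D E A B : cell D E A B -> cell D E A = cell D E B.
Proof.
move=> h; apply/seteqP; split => X hX i j; have [r1 f1] := h i j; have [r2 f2] := hX i j.
  split; first by rewrite r2.
  have -> : X i j - B i j = (X i j - A i j) - (B i j - A i j) by rewrite opprB addrA subrK.
  exact: fin_leB.
split; first by rewrite r2.
have -> : X i j - A i j = (X i j - B i j) + (B i j - A i j) by rewrite addrA subrK.
exact: fin_leD.
Qed.

Lemma cell0E D E X : cell D E 0 X <-> forall i j,
  [/\ 0 <= re (X i j), D%:R * re (X i j) < 1 & fin_le E (X i j)] \/
  [/\ D = 0%N & fin_le E (X i j)].
Proof.
have [->|D0] := posnP D.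
  by split => h i j; have := h i j; rewrite mxE subr0 ?mul0r; [right; case: H|
   case=> [[]|[]] *; split => //; rewrite !mul0r].
split => h i j; have := h i j; rewrite mxE subr0 re0 mulr0.
  move=> [/eqP + hf]; rewrite floor_eq floor0 add0r => /andP[h0 h1]; left; split => //.
  by move: h0; rewrite pmulr_rge0// ltr0n.
case=> [[h0 h1 hf]|[D00]]; last by rewrite D00 in D0.
split => //; apply/eqP; rewrite floor_eq floor0 add0r h1 andbT.
by rewrite mulr_ge0.
Qed.

Lemma cell0P D E X : (0 < D)%N -> (cell D E 0 X <-> forall i j,
  [/\ 0 <= re (X i j), D%:R * re (X i j) < 1 & fin_le E (X i j)]).
Proof.
move=> D0; rewrite cell0E; split => h i j; last by left.
by have [//|[D00]] := h i j; rewrite D00 in D0.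
Qed.

Definition corner D A : T :=
  \matrix_(i, j) mkQS ((Num.floor (D%:R * re (A i j)))%:~R / D%:R) (A i j).

Lemma fin_le_eq E (x y : QS) : (forall v : S, is_fin (val v) -> x v = y v) ->
  fin_le E x -> fin_le E y.
Proof. by move=> h hx v vf; rewrite -h// hx. Qed.

Lemma cell_shift D E A : (0 < D)%N ->
  cell D E A = (fun X => - corner D A + X) @^-1` (cell D E 0).
Proof.
move=> D0; have Dn : D%:R != 0 :> R by rewrite pnatr_eq0 -lt0n.
apply/seteqP; split => X; rewrite /preimage /=.
  move=> hX; apply/cell0P => // i j; have [/eqP r f] := hX i j.
  rewrite !mxE reD reN re_mkQS.
  move: r; rewrite floor_eq => /andP[r1 r2].
  rewrite intrD in r2.
  have Dp : (0 : R) < D%:R by rewrite ltr0n.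
  split.
  - by rewrite le_div_shift.
  - by rewrite lt_div_shift.
  - apply: fin_le_eq f => v vf.
    by rewrite QSB QSD QSN mkQS_fin// addrC.
move/(cell0P _ _ D0) => h i j; have [r1 r2 f] := h i j.
rewrite !mxE reD reN re_mkQS in r1 r2; rewrite !mxE in f.
split.
  apply/eqP; rewrite floor_eq intrD.
  have Dp : (0 : R) < D%:R by rewrite ltr0n.
  by move: r1 r2; rewrite le_div_shift// lt_div_shift// => -> ->.
by apply: fin_le_eq f => v vf; rewrite QSB QSD QSN mkQS_fin// addrC.
Qed.

Lemma measurable_cell0 D E : (0 < D)%N -> measurable (cell D E 0 : set BT).
Proof.
move=> D0.
rewrite (_ : cell D E 0 = [set X : T | forall ij : 'I_m * 'I_n,
    ([set X : T | 0 <= re (X ij.1 ij.2)] `&` [set X : T | re (X ij.1 ij.2) < D%:R^-1]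
      `&` [set X : T | fin_le E (X ij.1 ij.2)]) X]).
  apply: measurable_forall => ij; apply: measurableI.
    apply: measurableI; first by apply: measurable_re_ge; exact: qcont_coord.
    by apply: measurable_re_lt; exact: qcont_coord.
  by apply: measurable_fin_le; exact: qcont_coord.
have Dp : (0 : R) < D%:R by rewrite ltr0n.
apply/seteqP; split => X /=.
  move=> /(cell0P _ _ D0) h [i j] /=; have [h0 h1 hf] := h i j; split => //; split => //.
  by rewrite /= -[ltRHS]mul1r ltr_pdivlMr// mulrC.
move=> h; apply/(cell0P _ _ D0) => i j; have [[h0 h1] hf] := h (i, j); split => //.
by move: h1; rewrite /= -[ltRHS]mul1r ltr_pdivlMr// mulrC.
Qed.

Lemma measurable_cell D E A : (0 < D)%N -> measurable (cell D E A : set BT).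
Proof. by move=> D0; rewrite cell_shift//; apply: measurable_shift; exact: measurable_cell0. Qed.

Lemma measurable_unit_cell : measurable (unit_cell : set BT).
Proof. exact: measurable_cell. Qed.

Lemma unit_cellP X : unit_cell X <-> forall i j,
  [/\ 0 <= re (X i j), re (X i j) < 1 & fin_le 1 (X i j)].
Proof.
rewrite /unit_cell cell0P//; split => h i j; have := h i j; by rewrite mul1r.
Qed.

Lemma cell_re_le D E A X i j : (0 < D)%N -> cell D E A X ->
  `|re (X i j - A i j)| <= D%:R^-1.
Proof.
move=> D0 hX; have [fl _] := hX i j; rewrite reB.
have Dp : (0 : R) < D%:R by rewrite ltr0n.
have := floor_itv (D%:R * re (X i j)); have := floor_itv (D%:R * re (A i j)).
rewrite fl intrD => /andP[u1 u2] /andP[w1 w2].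
rewrite -div1r ler_pdivlMr// mulrC -[X in X * _]ger0_norm// -normrM ler_norml.
by apply/andP; split; rewrite mulrBr; lra.
Qed.

(** The inverse of the integer [c], taken place by place since [QS] is a ring with zero divisors in
    general. *)
Definition invn (c : nat) : QS := fun v => (c%:R)^-1.

Lemma invn1 : invn 1 = 1.
Proof. by apply/functional_extensionality_dep => v; rewrite /invn invr1. Qed.

Lemma Qv_nat_neq0 (v : place) c : (0 < c)%N -> (c%:R : Qv R v) != 0.
Proof.
move=> c0; case: v => [q|]; last by rewrite pnatr_eq0 -lt0n.
by rewrite -absv_eq0 gt_eqF//; exact: (@absv_nat_gt0 R (Some q)).
Qed.

Lemma mulr_invn c x : (0 < c)%N -> c%:R * (invn c * x) = x.
Proof.
move=> c0; apply: functional_extensionality_dep => v.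
by rewrite !QSM QSnat mulrA mulfV ?mul1r// Qv_nat_neq0.
Qed.

Lemma re_invn c : re (invn c) = c%:R^-1.
Proof. by []. Qed.

Lemma invn_mulr c x : (0 < c)%N -> invn c * (c%:R * x) = x.
Proof. by move=> c0; rewrite mulrCA mulr_invn. Qed.

(** A neighbourhood of [A] measured in cells: [K] of them on each side in the real direction. The
    denominator [c] at the finite places makes room for the common divisor of [q] by which a section
    of [A |-> A q] fails to be integral. *)
Definition big_box (K : nat) D E c A : set T := [set X | forall i j,
  `|re (X i j - A i j)| <= K%:R / D%:R /\ fin_le E (c%:R * (X i j - A i j))].

Lemma measurable_big_box K D E c A : measurable (big_box K D E c A : set BT).
Proof.
rewrite (_ : big_box _ _ _ _ _ = [set X : T | forall ij : 'I_m * 'I_n,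
  ([set X : T | `|re (X ij.1 ij.2 - A ij.1 ij.2)| <= K%:R / D%:R] `&`
   [set X : T | fin_le E (c%:R * (X ij.1 ij.2 - A ij.1 ij.2))]) X]); last first.
  by apply/seteqP; split => X /= h; [move=> [i j]; exact: h|move=> i j; exact: (h (i, j))].
have qc (ij : 'I_m * 'I_n) : qcont (fun X : T => X ij.1 ij.2 - A ij.1 ij.2).
  by apply: qcontD; [exact: qcont_coord|exact: qcont_cst].
apply: measurable_forall => ij; apply: measurableI.
  exact: measurable_re_norm.
by apply: measurable_fin_le; exact: qcontMl.
Qed.

Section Invariant.
Variable mu : {measure set BT -> \bar R}.
Hypothesis mu_inv : translation_invariant mu.

Lemma measure_union_le (I : finType) (F : I -> set BT) (C : set BT) (x : \bar R) :
  (forall i, measurable (F i)) -> measurable C ->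
  (forall X, C X -> exists i, F i X) -> (forall i, mu (F i) <= x)%E ->
  (mu C <= #|I|%:R%:E * x)%E.
Proof.
move=> mF mC hC hx; pose G k := if insub k is Some j then F (enum_val (j : 'I_#|I|)) else set0.
have GF (j : 'I_#|I|) : G j = F (enum_val j) by rewrite /G valK.
apply: (@le_trans _ _ (\sum_(j < #|I|) mu (G j))%E).
  apply: content_subadditive => //; first by move=> k _; rewrite /G; case: insub.
  move=> X /hC[i Fi]; rewrite (bigD1 (enum_rank i))//=; left.
  by rewrite GF enum_rankK.
rewrite -sume_ord_const; apply: lee_sum => j _; rewrite GF; exact: hx.
Qed.

Lemma measure_union_ge (I : finType) (F : I -> set BT) (C : set BT) (x : \bar R) :
  (forall i, measurable (F i)) -> measurable C -> (forall i, F i `<=` C) ->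
  (forall i j X, F i X -> F j X -> i = j) -> (forall i, x <= mu (F i))%E ->
  (#|I|%:R%:E * x <= mu C)%E.
Proof.
move=> mF mC hC hd hx; pose G (j : 'I_#|I|) := F (enum_val j).
apply: (@le_trans _ _ (\sum_(j < #|I|) mu (G j))%E).
  by rewrite -sume_ord_const; apply: lee_sum => j _; exact: hx.
rewrite -measure_bigsetU_ord; [|by move=> j; exact: mF|].
  apply: le_measure; rewrite ?inE//; first by apply: bigsetU_measurable => j _; exact: mF.
  by elim/big_ind : _ => [//|A B hA hB X [/hA|/hB]//|j _]; exact: hC.
apply/trivIsetP => i j _ _ ij; rewrite -subset0 => X [Fi Fj].
by move/eqP: ij; apply; apply: enum_val_inj; exact: hd Fi Fj.
Qed.

(** The translates of [C] by the [h i] are pairwise disjoint and contained in [D]. *)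
Lemma packing (I : finType) (h : I -> T) (C D : set BT) :
  measurable C -> measurable D ->
  (forall i X, C X -> D (h i + X)) ->
  (forall i j X Y, C X -> C Y -> h i + X = h j + Y -> i = j) ->
  (#|I|%:R%:E * mu C <= mu D)%E.
Proof.
move=> mC mD hD hinj.
apply: (@measure_union_ge _ (fun i => (fun X : T => - h i + X) @^-1` C)) => //.
- by move=> i; exact: measurable_shift.
- by move=> i X /(hD i); rewrite addNKr.
- by move=> i j X Ci Cj; apply: (hinj _ _ _ _ Ci Cj); rewrite !addNKr.
- by move=> i; rewrite mu_inv.
Qed.

Lemma covering (I : finType) (h : I -> T) (C D : set BT) :
  measurable C -> measurable D ->
  (forall X, D X -> exists i, C (- h i + X)) -> (mu D <= #|I|%:R%:E * mu C)%E.
Proof.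
move=> mC mD hD.
apply: (@measure_union_le _ (fun i => (fun X : T => - h i + X) @^-1` C)) => //.
- by move=> i; exact: measurable_shift.
- by move=> i; rewrite mu_inv.
Qed.

Lemma measure_cell D E A : (0 < D)%N -> mu (cell D E A) = mu (cell D E 0).
Proof.
by move=> D0; rewrite (cell_shift _ _ D0); apply: mu_inv; exact: measurable_cell0.
Qed.

Lemma floor_lt_nat (x : R) (D : nat) : (0 < D)%N -> 0 <= x -> x < 1 ->
  exists2 d : nat, (d < D)%N & Num.floor (D%:R * x) = d.
Proof.
move=> D0 x0 x1; have Dx0 : 0 <= D%:R * x by rewrite mulr_ge0.
exists (Num.trunc (D%:R * x)); last by rewrite truncn_floor Dx0 gez0_abs// floor_ge0.
by rewrite truncn_lt_nat// -[ltRHS]mulr1 ltr_pM2l// ltr0n.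
Qed.

Lemma fin_le_mod_inj E (a b : nat) : (Spi S).-nat E -> (a < E)%N -> (b < E)%N ->
  fin_le E (a%:R - b%:R : QS) -> a = b.
Proof.
move=> SE; wlog le : a b / (b <= a)%N.
  move=> wl aE bE h; have [le|/ltnW le] := leqP b a; first exact: wl.
  by apply/esym/wl => //; rewrite -opprB; exact: fin_leN.
move=> aE bE; rewrite -natrB// pmulrn fin_le_intP//= => dv.
apply/eqP; rewrite eqn_leq le andbT -subn_eq0.
have /(gtnNdvd _) := leq_ltn_trans (leq_subr b a) aE.
by case: (_ - _)%N dv => [|k] // dv /(_ isT); rewrite dv.
Qed.

(** In each entry a cell is labelled by the integer part of [D] times the real component and by a
    residue modulo [E]. Distinct residues give distinct cosets because all primes of [E] lie in
    [S]. *)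
Lemma unit_cell_partition D E : (0 < D)%N -> (Spi S).-nat E ->
  exists (I : finType) (h : I -> T), [/\ #|I| = ((D * E) ^ (m * n))%N,
    forall X, unit_cell X -> exists i, cell D E (h i) X,
    forall i, cell D E (h i) `<=` unit_cell &
    forall i j X, cell D E (h i) X -> cell D E (h j) X -> i = j].
Proof.
move=> D0 SE; have E0 : (0 < E)%N by case/andP: SE.
have Dp : (0 : R) < D%:R by rewrite ltr0n.
pose I : finType := 'M[('I_D * 'I_E)%type]_(m, n).
pose h (f : I) : T := \matrix_(i, j) mkQS ((f i j).1%:R / D%:R) (f i j).2%:R.
have hP f X : cell D E (h f) X <-> forall i j,
    Num.floor (D%:R * re (X i j)) = (f i j).1 /\ fin_le E (X i j - (f i j).2%:R).
  have hf i j : Num.floor (D%:R * re (h f i j)) = (f i j).1.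
    by rewrite mxE re_mkQS mulrC divfK ?gt_eqF// pmulrn intrKfloor.
  split => hX i j; have [r fl] := hX i j.
    split; first by rewrite r hf.
    by apply: fin_le_eq fl => v vf; rewrite !QSB mxE mkQS_fin.
  split; first by rewrite hf.
  by apply: fin_le_eq fl => v vf; rewrite !QSB mxE mkQS_fin.
exists I, h; split; first by rewrite card_mx card_prod !card_ord.
- move=> X /unit_cellP hX.
  have /choice[f hf] (ij : 'I_m * 'I_n) : exists de : 'I_D * 'I_E,
     Num.floor (D%:R * re (X ij.1 ij.2)) = de.1 /\ fin_le E (X ij.1 ij.2 - de.2%:R).
    have [x0 x1 xf] := hX ij.1 ij.2.
    have [d dD hd] := floor_lt_nat D0 x0 x1.
    have [a aE ha] := fin_le_approx S_infinite E0 xf.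
    by exists (Ordinal dD, Ordinal aE).
  by exists (\matrix_(i, j) f (i, j)); apply/hP => i j; rewrite mxE; exact: (hf (i, j)).
- move=> f X /hP hX; apply/unit_cellP => i j; have [/eqP r fl] := hX i j.
  move: r; rewrite floor_eq => /andP[r0 r1]; split.
  + by rewrite -(pmulr_rge0 _ Dp) (le_trans _ r0)// ler0z.
  + rewrite -(ltr_pM2l Dp) mulr1 (lt_le_trans r1)// intrD -pmulrn natr1 ler_nat.
    exact: ltn_ord.
  + rewrite -(subrK ((f i j).2%:R) (X i j)); apply: fin_leD; last exact: fin_le_nat.
    exact: fin_le_dvd fl.
- move=> f g X /hP hf /hP hg; apply/matrixP => i j.
  have [f1 f2] := hf i j; have [g1 g2] := hg i j.
  have e1 : (f i j).1 = (g i j).1 by apply: val_inj; move: f1; rewrite g1 => -[].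
  have e2 : (f i j).2 = (g i j).2.
    apply: val_inj; apply: (fin_le_mod_inj SE (ltn_ord _) (ltn_ord _)).
    rewrite (_ : _ - _ = (X i j - (g i j).2%:R) - (X i j - (f i j).2%:R) :> QS).
      exact: fin_leB.
    by rewrite opprB [RHS]addrC addrA subrK.
  by move: (f i j) (g i j) e1 e2 => [a b] [c d] /= -> ->.
Qed.

Lemma measure_unit_cell D E : (0 < D)%N -> (Spi S).-nat E ->
  mu unit_cell = (((D * E) ^ (m * n))%N%:R%:E * mu (cell D E 0))%E.
Proof.
move=> D0 SE; have [I [h [<- hF1 hF2 hd]]] := unit_cell_partition D0 SE.
have mc A : measurable (cell D E A : set BT) by exact: measurable_cell.
apply/eqP; rewrite eq_le; apply/andP; split.
  apply: (measure_union_le (fun i => mc (h i))) => //; first exact: measurable_unit_cell.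
  by move=> i; rewrite measure_cell.
apply: (measure_union_ge (fun i => mc (h i))) => //; first exact: measurable_unit_cell.
by move=> i; rewrite measure_cell.
Qed.

(** Cover the box by translates of a cell. The real digits run from -K to K inclusive, because the
    cells are half-open and the box is closed, and the multiples of E/c split into [c] classes
    modulo [E]. *)
Lemma measure_big_box K D E c A : (0 < D)%N -> (0 < E)%N -> (0 < c)%N ->
  (mu (big_box K D E c A) <=
    (((2 * K + 1) * c) ^ (m * n))%N%:R%:E * mu (cell D E 0))%E.
Proof.
move=> D0 E0 c0; have Dp : (0 : R) < D%:R by rewrite ltr0n.
pose I : finType := 'M[('I_(2 * K + 1) * 'I_c)%type]_(m, n).
have cI : #|I| = (((2 * K + 1) * c) ^ (m * n))%N by rewrite card_mx card_prod !card_ord.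
pose h (f : I) : T := A + \matrix_(i, j)
  mkQS (((f i j).1%:R - K%:R) / D%:R) (invn c * (E%:R * (f i j).2%:R)).
rewrite -cI.
apply: (covering (h := h)); [exact: measurable_cell0|exact: measurable_big_box|].
move=> X hX.
have /choice[f hf] (ij : 'I_m * 'I_n) : exists de : 'I_(2 * K + 1) * 'I_c,
   de.1%:R - K%:R <= D%:R * re (X ij.1 ij.2 - A ij.1 ij.2) < de.1%:R - K%:R + 1 /\
   fin_le E (X ij.1 ij.2 - A ij.1 ij.2 - invn c * (E%:R * de.2%:R)).
  have [xr xf] := hX ij.1 ij.2; set x := X ij.1 ij.2 - A ij.1 ij.2 in xr xf *.
  move: xr; rewrite ler_pdivlMr// mulrC -[X in X * _]ger0_norm// -normrM ler_norml => /andP[r1 r2].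
  have Dx0 : 0 <= D%:R * re x + K%:R by move: r1; lra.
  have dlt : (Num.trunc (D%:R * re x + K%:R) < 2 * K + 1)%N.
    by rewrite truncn_lt_nat// addn1 -natr1 natrM; move: r2; lra.
  have /andP[i1 i2] := trunc_itv Dx0; rewrite -natr1 in i2.
  have h1 : fin_le 1 (invn E * (c%:R * x)).
    by apply/(@fin_le_pM _ _ 1 _ _ E0); rewrite muln1 mulr_invn.
  have [a ac ha] := fin_le_approx S_infinite c0 h1.
  exists (Ordinal dlt, Ordinal ac); split; first by apply/andP; split => /=; move: i1 i2; lra.
  apply/(@fin_le_pM _ _ E _ _ c0) => /=.
  rewrite mulrBr mulr_invn// mulnC -[c%:R * x](mulr_invn _ E0) -mulrBr.
  exact/fin_le_pM.
exists (\matrix_(i, j) f (i, j)); apply/cell0P => // i j.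
have /= [/andP[r1 r2] fle] := hf (i, j).
have -> : (- h (\matrix_(i, j) f (i, j)) + X) i j =
   - mkQS (((f (i, j)).1%:R - K%:R) / D%:R) (invn c * (E%:R * (f (i, j)).2%:R)) +
   (X i j - A i j) by rewrite !mxE opprD addrC addrA addrC.
rewrite reD reN re_mkQS; split.
- by rewrite le_div_shift.
- by rewrite lt_div_shift.
- by apply: fin_le_eq fle => v vf; rewrite [RHS]QSD QSN mkQS_fin// [RHS]addrC.
Qed.

End Invariant.
End Cells.

(** * Uniqueness of the Haar measure *)

Lemma floor_natM_inj (R : realType) (c : nat) (x y : R) : (0 < c)%N ->
  Num.floor (c%:R * x) = Num.floor (c%:R * y) -> Num.floor x = Num.floor y.
Proof.
move=> c0 xy; have cp : (0 : R) < c%:R by rewrite ltr0n.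
have key (u : R) (z : int) : (z <= Num.floor u) = (c%:Z * z <= Num.floor (c%:R * u)).
  by rewrite !floor_ge_int intrM ler_pM2l.
apply/eqP; rewrite eq_le; apply/andP; split.
  by rewrite (key y) -xy -(key x).
by rewrite (key x) xy -(key y).
Qed.

Section Uniqueness.
Variables (R : realType) (S : {fset place}).
Hypothesis S_infinite : infinite_place \in S.
Variables m n : nat.
Local Notation QS := (QS R S).
Local Notation T := 'M[QS]_(m, n).
Local Notation BT := (borel T).
Local Notation re := (@re R S S_infinite).
Local Notation mkQS := (@mkQS R S).
Local Notation cell := (@cell R S S_infinite m n).
Implicit Types (A X : T) (D E k : nat).

(** A nested family of cells that shrink at all places at once; it plays the role of the dyadic
    cubes. *)
Definition cellk k A : set T := cell (2 ^ k) (Sprod S ^ k) A.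

Lemma Sprodk_gt0 k : (0 < Sprod S ^ k)%N.
Proof. by rewrite expn_gt0 Sprod_gt0. Qed.

Lemma pow2_gt0 k : (0 < 2 ^ k)%N.
Proof. by rewrite expn_gt0. Qed.

Lemma measurable_cellk k A : measurable (cellk k A : set BT).
Proof. by apply: measurable_cell; exact: pow2_gt0. Qed.

Lemma cellk_sub k k' A : (k <= k')%N -> cellk k' A `<=` cellk k A.
Proof.
move=> kk' X h i j; have [r f] := h i j; split.
  apply: (floor_natM_inj (pow2_gt0 (k' - k))).
  by rewrite !mulrA -natrM -expnD subnK.
by apply: fin_le_dvd f; rewrite ?Sprodk_gt0// dvdn_exp2l.
Qed.

Lemma cellk_small (e : R) : 0 < e -> exists k, forall A X, cellk k A X ->
  forall i j v, absv (A i j v - X i j v) < e.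
Proof.
move=> e0; have [k hk] : exists k, (2 ^ k)%:R^-1 < e.
  have [k _ hk] := near_infty_natSinv_lt (PosNum e0); exists k.+1.
  rewrite (lt_trans _ (hk k (leqnn k)))//= ltf_pV2 ?posrE ?ltr0n ?pow2_gt0//.
  by rewrite ltr_nat ltn_expl.
exists k => A X h i j v; have [r f] := h i j.
have p0 : (0 : R) < (2 ^ k)%:R by rewrite ltr0n pow2_gt0.
have [->|vf] := v0_or_finite S_infinite v.
  rewrite -/(re (A i j)) -/(re (X i j)).
  suff : `|re (A i j) - re (X i j)| < e by [].
  rewrite (lt_trans _ hk)// -[ltRHS]mulr1 -ltr_pdivrMl ?invr_gt0// invrK.
  rewrite -[X in X * _]ger0_norm ?ltW// -normrM mulrBr.
  have := floor_itv ((2 ^ k)%:R * re (A i j)); rewrite -r intrD => /andP[a1 a2].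
  have := floor_itv ((2 ^ k)%:R * re (X i j)); rewrite intrD => /andP[x1 x2].
  by rewrite ltr_norml; apply/andP; split; lra.
rewrite -absvN opprB (le_lt_trans (f v vf))// (le_lt_trans _ hk)//.
rewrite absv_nat ?Sprodk_gt0// -natrX lef_pV2 ?posrE ?ltr0n ?pow2_gt0 ?expn_gt0 ?place_prime_gt0//.
rewrite ler_nat lognX logn_Sprod// muln1.
by case: (k) => [//|k']; rewrite leq_exp2r// prime_gt1 ?place_prime_prime.
Qed.

(** A countable family that meets every cell of mesh 1/D, with independent rational components at
    the finite places; it yields the countable covers by cells. *)
Definition grid_point D (B : 'M[(int * {ffun S -> rat})%type]_(m, n)) : T :=
  \matrix_(i, j) mkQS ((B i j).1%:~R / D%:R) (fun v => ratr ((B i j).2 v)).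

Lemma grid_point_dense D E A : (0 < D)%N -> (0 < E)%N ->
  exists B, cell D E (grid_point D B) A.
Proof.
move=> D0 E0; have Dn : D%:R != 0 :> R by rewrite pnatr_eq0 -lt0n.
have /choice[r hr] (ijv : ('I_m * 'I_n) * S) : exists r : rat, is_fin (val ijv.2) ->
    absv (A ijv.1.1 ijv.1.2 ijv.2 - ratr r) < absv (E%:R : Qv R (val ijv.2)).
  have [e|vf] := v0_or_finite S_infinite ijv.2; first by exists 0; rewrite e.
  have [r hr] := absv_dense vf (A ijv.1.1 ijv.1.2 ijv.2) (absv_nat_gt0 R vf E0).
  by exists r.
exists (\matrix_(i, j) (Num.floor (D%:R * re (A i j)), [ffun v => r ((i, j), v)])).
move=> i j; rewrite !mxE re_mkQS /=; split.
  by rewrite [in RHS]mulrC divfK// intrKfloor.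
by move=> v vf; rewrite QSB mkQS_fin// ffunE ltW// (hr ((i, j), v)).
Qed.

Lemma open_bigcup_cellk (O : set T) : open O ->
  exists F : nat -> set T, (forall i, F i = set0 \/ exists k A, F i = cellk k A) /\
    O = \bigcup_i F i.
Proof.
move=> /open_mxP oO.
pose F (i : nat) : set T := match (choice.unpickle i : option (nat * 'M[(int * {ffun S -> rat})%type]_(m, n))) with
  | Some kB => if pselect (cellk kB.1 (grid_point (2 ^ kB.1) kB.2) `<=` O)
               then cellk kB.1 (grid_point (2 ^ kB.1) kB.2) else set0
  | None => set0 end.
exists F; split.
  move=> i; rewrite /F; case: choice.unpickle => [[k B]|]; last by left.
  by case: pselect => ?; [right; exists k, (grid_point (2 ^ k) B)|left].
apply/seteqP; split => [A OA|A [i _]]; last first.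
  by rewrite /F; case: choice.unpickle => [kB|//]; case: pselect => // h /h.
have [e e0 he] := oO _ OA.
have [k hk] := cellk_small e0.
have [B hB] := grid_point_dense A (pow2_gt0 k) (Sprodk_gt0 k).
exists (choice.pickle (k, B)) => //; rewrite /F choice.pickleK /=.
rewrite /cellk (cell_eq hB); case: pselect => [?|[]]; first exact: cell_refl.
move=> X hX.
by apply: he => i j v; exact: hk.
Qed.

(** Two cells are disjoint or nested, so together with the empty set they are stable under
    intersection. They generate the Borel sets since every open set is a countable union of cells,
    and countably many cells of level 0, all of finite measure, cover the space. *)
Lemma measure_eq_cellk (m1 m2 : {measure set BT -> \bar R}) :
  (forall k A, m1 (cellk k A) = m2 (cellk k A)) ->
  (forall A, m1 (cellk 0 A) < +oo)%E ->
  forall B : set BT, measurable B -> m1 B = m2 B.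
Proof.
move=> h hfin B mB.
pose G : set (set BT) := [set C | C = set0 \/ exists k A, C = cellk k A].
pose g (i : nat) : set BT := match (choice.unpickle i : option ('M[(int * {ffun S -> rat})%type]_(m, n))) with
  | Some B => cellk 0 (grid_point (2 ^ 0) B) | None => set0 end.
apply: (@g_sigma_algebra_measure_unique _ _ _ G _ g) => //.
- by move=> C [->|[k [A ->]]]; [exact: measurable0|exact: measurable_cellk].
- by move=> i; rewrite /g; case: choice.unpickle => [C|]; [right; exists 0%N, (grid_point (2 ^ 0) C)|left].
- apply/seteqP; split => // A _.
  have [C hC] := grid_point_dense A (pow2_gt0 0) (Sprodk_gt0 0).
  by exists (choice.pickle C) => //; rewrite /g choice.pickleK.
- move=> C C' [->|[k [A ->]]]; first by rewrite set0I; left.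
  move=> [->|[k' [A' ->]]]; first by rewrite setI0; left.
  wlog kk' : k k' A A' / (k <= k')%N.
    by move=> wl; have [|/ltnW] := leqP k k'; [exact: wl|rewrite setIC; exact: wl].
  have [->|/set0P[X [hX hX']]] := eqVneq (cellk k A `&` cellk k' A') set0; first by left.
  right; exists k', X; rewrite [cellk k A](cell_eq hX) [cellk k' A'](cell_eq hX').
  by rewrite setIidr//; exact: cellk_sub.
- by move=> C [->|[k [A ->]]]; rewrite ?measure0.
- by move=> i; rewrite /g; case: choice.unpickle => [C|]; rewrite ?measure0.
apply: (@smallest_sub _ (@sigma_algebra BT setT) (@open T) (<<s G>>)) mB.
  exact: smallest_sigma_algebra.
move=> O /open_bigcup_cellk[F [hF ->]].
apply: sigma_algebra_bigcup => i; apply: sub_sigma_algebra.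
exact: hF.
Qed.

Local Notation unit_cell := (@unit_cell R S S_infinite m n).

Lemma cellk0E A : cellk 0 A = cell 1 1 A.
Proof. by rewrite /cellk !expn0. Qed.

Lemma measure_cellk (mu : {measure set BT -> \bar R}) : translation_invariant mu ->
  forall k A, mu unit_cell =
    (((2 ^ k * Sprod S ^ k) ^ (m * n))%N%:R%:E * mu (cellk k A))%E.
Proof.
move=> mu_inv k A; rewrite /cellk (measure_cell _ mu_inv) ?pow2_gt0//.
by apply: measure_unit_cell => //; rewrite ?pow2_gt0// pnatX Sprod_Spi.
Qed.

(** The unit cell is tiled by translates of any [cellk k A], so its measure determines that of every
    cell. *)
Lemma translation_invariant_unique (mu nu : {measure set BT -> \bar R}) :
  translation_invariant mu -> translation_invariant nu ->
  (mu unit_cell < +oo)%E -> mu unit_cell = nu unit_cell ->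
  forall B : set BT, measurable B -> mu B = nu B.
Proof.
move=> imu inu fin eq; apply: measure_eq_cellk.
  move=> k A; have := measure_cellk imu k A; rewrite eq (measure_cellk inu k A).
  set N := ((_ * _) ^ _)%N.
  have N0 : (0 < N)%N by rewrite expn_gt0 muln_gt0 pow2_gt0 Sprodk_gt0.
  move=> /(congr1 (fun x => (N%:R^-1%:E * x)%E)).
  by rewrite !muleA -!EFinM mulVf ?pnatr_eq0 -?lt0n// !mul1e => ->.
by move=> A; rewrite cellk0E (measure_cell _ imu).
Qed.

(** Finite because the unit cell lies in a compact box; positive because countably many translates
    of it cover the whole space. *)
Lemma haar_unit_cell (mu : {measure set BT -> \bar R}) : is_haar_measure mu ->
  exists2 u : R, 0 < u & mu unit_cell = u%:E.
Proof.
move=> hmu; have imu := haar_translation_invariant hmu.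
have fin : (mu unit_cell < +oo)%E.
  have [_ hc _] := hmu; have := hc _ (@box_compact R S m n).
  apply: le_lt_trans; apply: le_measure; rewrite ?inE.
  - exact: measurable_unit_cell.
  - rewrite (_ : [set _ | _] = [set X : T | forall ij : 'I_m * 'I_n,
       ([set X : T | `|re (X ij.1 ij.2)| <= 1] `&` [set X : T | fin_le 1 (X ij.1 ij.2)]) X]).
      apply: measurable_forall => ij; apply: measurableI.
        by apply: measurable_re_norm; exact: qcont_coord.
      by apply: measurable_fin_le; exact: qcont_coord.
    apply/seteqP; split => X /= h.
      move=> [i j]; split; first exact: (h i j (v0 S_infinite)).
      by move=> v vf; rewrite absv1; exact: h.
    move=> i j v; have [h1 h2] := h (i, j).
    by have [->|vf] := v0_or_finite S_infinite v; [exact: h1|rewrite (le_trans (h2 v vf))// absv1].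
  move=> X /unit_cellP h i j v; have [h0 h1 hf] := h i j.
  have [->|vf] := v0_or_finite S_infinite v; last by rewrite (le_trans (hf v vf))// absv1.
  have : `|re (X i j)| <= 1 by rewrite ger0_norm// ltW.
  by [].
have ge0 := measure_ge0 mu unit_cell.
exists (fine (mu unit_cell)); last by rewrite fineK// ge0_fin_numE.
rewrite fine_gt0// fin andbT lt_neqAle ge0 andbT; apply/eqP => mu0.
have [_ _ /eqP] := hmu; apply.
pose g (i : nat) : set BT := match (choice.unpickle i : option ('M[(int * {ffun S -> rat})%type]_(m, n))) with
  | Some B => cellk 0 (grid_point (2 ^ 0) B) | None => set0 end.
have mg i : measurable (g i).
  by rewrite /g; case: choice.unpickle => [B|]; [exact: measurable_cellk|exact: measurable0].
apply/eqP; rewrite eq_le measure_ge0 andbT.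
have : (mu setT <= \sum_(i <oo) mu (g i))%E.
  apply: measure_sigma_subadditive => // A _.
  have [C hC] := grid_point_dense A (pow2_gt0 0) (Sprodk_gt0 0).
  by exists (choice.pickle C) => //; rewrite /g choice.pickleK.
rewrite eseries0// => i _ _; rewrite /g; case: choice.unpickle => [B|]; last exact: measure0.
by rewrite cellk0E (measure_cell _ imu).
Qed.

End Uniqueness.

(** * Dilations and the zero-one law *)

Section Dilation.
Variables (R : realType) (S : {fset place}).
Hypothesis S_infinite : infinite_place \in S.
Variables m n : nat.
Local Notation QS := (QS R S).
Local Notation T := 'M[QS]_(m, n).
Local Notation BT := (borel T).
Local Notation re := (@re R S S_infinite).
Local Notation mkQS := (@mkQS R S).
Local Notation invn := (@invn R S).
Local Notation cell := (@cell R S S_infinite m n).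
Local Notation unit_cell := (@unit_cell R S S_infinite m n).
Implicit Types (A X : T) (D E d k : nat).

Lemma fin_leM1 E (x y : QS) : fin_le E x -> fin_le 1 y -> fin_le E (x * y).
Proof. by move=> hx hy; have := fin_leM hx hy; rewrite muln1. Qed.

Definition dil d X : T := \matrix_(i, j) (d%:R * X i j).

Lemma measurable_dil d (B : set BT) : measurable B -> measurable (dil d @^-1` B : set BT).
Proof.
apply: measurable_preimage => i j; under eq_fun do rewrite mxE.
by apply: qcontMl; exact: qcont_coord.
Qed.

Variable mu : {measure set BT -> \bar R}.
Hypothesis mu_inv : translation_invariant mu.
Variable u : R.
Hypothesis u_gt0 : 0 < u.
Hypothesis mu_unit : mu unit_cell = u%:E.

(** The image of [mu] under the dilation is again translation invariant, hence proportional to [mu]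
    by uniqueness. It is finite on the unit cell because the preimage of that cell lies in a box
    with denominator [d] at the finite places. *)
Lemma measure_dil d : (0 < d)%N -> exists2 c : R, 0 <= c &
  forall B : set BT, measurable B -> mu (dil d @^-1` B) = (c%:E * mu B)%E.
Proof.
move=> d0.
have mf : measurable_fun [set: BT] (dil d : BT -> BT).
  by move=> _ B mB; rewrite setTI; exact: measurable_dil.
pose nu_of : {measure set BT -> \bar R} := pushforward mu (dil d : BT -> BT).
pose nu : {measure set BT -> \bar R} := nu_of mf.
have inu : translation_invariant nu.
  move=> A B mB; rewrite /nu /pushforward /=.
  pose A' : T := \matrix_(i, j) (invn d * A i j).
  transitivity (mu ((fun X : T => A' + X) @^-1` (dil d @^-1` B))); last first.
    by rewrite mu_inv//; exact: measurable_dil.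
  congr (mu _); apply/seteqP; split => X /=; congr B; apply/matrixP => i j;
    by rewrite !mxE mulrDr mulr_invn.
have nufin : (nu unit_cell < +oo)%E.
  have h := measure_big_box S_infinite mu_inv 1 0 (isT : (0 < 1)%N) (isT : (0 < 1)%N) d0.
  apply: (@le_lt_trans _ _ (mu (big_box S_infinite 1 1 1 d (0 : T)))).
    have -> : nu unit_cell = mu (dil d @^-1` unit_cell) by [].
    apply: le_measure; rewrite ?inE.
    - by apply: measurable_dil; exact: measurable_unit_cell.
    - exact: measurable_big_box.
    move=> X /unit_cellP hX i j; have := hX i j; rewrite !mxE reM renat subr0 => -[h0 h1 hf].
    split => //; rewrite divr1 ler_norml.
    have dp : (1 : R) <= d%:R by rewrite ler1n.
    have x0 : 0 <= re (X i j) by rewrite -(pmulr_rge0 _ (lt_le_trans ltr01 dp)).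
    have : re (X i j) <= d%:R * re (X i j) by rewrite ler_peMl.
    lra.
  rewrite (le_lt_trans h)// -/unit_cell mu_unit -EFinM; exact: ltry.
have nu0 : (0 <= nu unit_cell)%E by exact: measure_ge0.
pose c := fine (nu unit_cell) / u.
have c0 : 0 <= c by rewrite divr_ge0 ?fine_ge0// ltW.
exists c => // B mB.
pose nu' : {measure set BT -> \bar R} := mscale (NngNum c0) mu.
have inu' : translation_invariant nu' by move=> A C mC; congr (_ * _)%E; exact: mu_inv.
have eq' : nu unit_cell = nu' unit_cell.
  have -> : nu' unit_cell = (c%:E * mu unit_cell)%E by [].
  by rewrite mu_unit -EFinM /c divfK ?gt_eqF// fineK// ge0_fin_numE.
exact: (@translation_invariant_unique R S S_infinite m n nu nu' inu inu' nufin eq' B mB).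
Qed.

Definition shiftz (d : nat) (z : 'M[int]_(m, n)) : T :=
  \matrix_(i, j) ((z i j)%:~R * invn d).

Definition zperiodic d (W : set T) := forall z X, W (shiftz d z + X) <-> W X.

(** Elongated in the real direction: the side E/d compensates for the index [E] at the finite
    places. For [d] prime to M and [E] a product of primes of [S], this is a fundamental domain for
    the translations by (1/d)Z, whatever the value of [E]. *)
Definition qbox d E A : set T := [set X | forall i j,
  [/\ 0 <= re (X i j - A i j), re (X i j - A i j) < E%:R / d%:R &
      fin_le E (X i j - A i j)]].

Lemma measurable_qbox d E A : measurable (qbox d E A : set BT).
Proof.
rewrite (_ : qbox d E A = [set X : T | forall ij : 'I_m * 'I_n,
  ([set X : T | 0 <= re (X ij.1 ij.2 - A ij.1 ij.2)] `&`
   [set X : T | re (X ij.1 ij.2 - A ij.1 ij.2) < E%:R / d%:R] `&`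
   [set X : T | fin_le E (X ij.1 ij.2 - A ij.1 ij.2)]) X]); last first.
  apply/seteqP; split => X /= h; first by move=> [i j]; have [] := h i j.
  by move=> i j; have [[]] := h (i, j).
have qc (ij : 'I_m * 'I_n) : qcont (fun X : T => X ij.1 ij.2 - A ij.1 ij.2).
  by apply: qcontD; [exact: qcont_coord|exact: qcont_cst].
apply: measurable_forall => ij; apply: measurableI; last exact: measurable_fin_le.
by apply: measurableI; [exact: measurable_re_ge|exact: measurable_re_lt].
Qed.

Lemma fin_le_invn d : (0 < d)%N -> coprime d (Sprod S) -> fin_le 1 (invn d).
Proof.
move=> d0 cop v vf; rewrite absvV absv1 absv_nat// logn_coprime ?expr0 ?invr1//.
apply: coprime_dvdl (_ : coprime (Sprod S) d); last by rewrite coprime_sym.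
by rewrite /Sprod (bigD1 v)//= dvdn_mulr.
Qed.

(* Two boxes of this kind are fundamental domains for the same group of
   translations. *)
Lemma qbox_le d E A A' (W : set BT) : (0 < d)%N -> coprime d (Sprod S) ->
  (Spi S).-nat E -> measurable W -> zperiodic d W ->
  (forall i j, fin_le 1 (A i j - A' i j)) ->
  (mu (W `&` qbox d E A') <= mu (W `&` qbox d E A))%E.
Proof.
move=> d0 cop SE mW perW hA; have E0 : (0 < E)%N by case/andP: SE.
have dp : (0 : R) < d%:R by rewrite ltr0n.
have Ep : (0 : R) < E%:R by rewrite ltr0n.
(* Cut [W] inside the box at [A'] according to the translation [z] that brings a point into the box
   at [A]. The pieces are the sets [H z]; their translates [G z] have the same measure, stay in [W]
   by periodicity, and are disjoint inside the box at [A]. *)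
pose G (z : option 'M[int]_(m, n)) : set BT := if z is Some z then
  W `&` qbox d E A `&` ((fun X : T => - shiftz d z + X) @^-1` qbox d E A') else set0.
pose H (z : option 'M[int]_(m, n)) : set BT := if z is Some z then
  (fun X : T => shiftz d z + X) @^-1` (G (Some z)) else set0.
have mQ B : measurable (qbox d E B : set BT) by exact: measurable_qbox.
have mG z : measurable (G z).
  case: z => [z|]; last exact: measurable0.
  by apply: measurableI; [exact: measurableI|exact: measurable_shift].
have mH z : measurable (H z).
  case: z => [z|]; last exact: measurable0.
  by apply: measurable_shift; exact: mG (Some z).
have HG z : mu (H z) = mu (G z).
  by case: z => [z|//]; rewrite /H mu_inv//; exact: mG (Some z).
apply: (@le_trans _ _ (\sum_(k <oo) mu (H (choice.pickle_inv k)))%E).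
  apply: measure_sigma_subadditive => //; first exact: measurableI.
  move=> X [WX QX].
  have /choice[z hz] (ij : 'I_m * 'I_n) : exists z : int,
      let y := z%:~R * invn d + X ij.1 ij.2 - A ij.1 ij.2 in
      [/\ 0 <= re y, re y < E%:R / d%:R & fin_le E y].
    have [x0 x1 xf] := QX ij.1 ij.2.
    set x := X ij.1 ij.2 in x0 x1 xf *; set a := A ij.1 ij.2; set a' := A' ij.1 ij.2 in x0 x1 xf *.
    have f1 : fin_le 1 (d%:R * (a - x)).
      apply: fin_leM1; first exact: fin_le_nat.
      rewrite (_ : a - x = (a - a') - (x - a')); last by rewrite opprB addrA subrK.
      by apply: fin_leB; [exact: hA|apply: fin_le_dvd xf => //; exact: dvd1n].
    have [b bE hb] := fin_le_approx S_infinite E0 f1.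
    pose t := b%:R / d%:R + re x - re a.
    pose k := Num.floor (t * d%:R / E%:R).
    (* The residue [b] puts the finite part into the coset of [E]; subtracting multiples of [E]
       keeps it there and brings the real part into [0, E/d). *)
    exists (b%:Z - k * E%:Z) => /=.
    have -> : (b%:Z - k * E%:Z)%:~R * invn d + x - a =
      (b%:R * invn d + x - a) - k%:~R * E%:R * invn d :> QS.
      rewrite intrB intrM -!pmulrn mulrBl -!addrA; congr (_ + _).
      by rewrite addrC -addrA.
    have -> : re (b%:R * invn d + x - a - k%:~R * E%:R * invn d) =
        t - k%:~R * (E%:R / d%:R).
      by rewrite !reB !reD !reM !renat reint re_invn /t mulrA.
    have := floor_itv (t * d%:R / E%:R); rewrite -/k intrD => /andP[k1 k2].
    split.
    - rewrite subr_ge0; move: k1; rewrite ler_pdivlMr// => k1.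
      by rewrite mulrA ler_pdivrMr.
    - rewrite ltrBlDr; move: k2; rewrite ltr_pdivrMr// => k2.
      by rewrite -{1}[E%:R / d%:R]mul1r -mulrDl mulrA ltr_pdivlMr// addrC.
    - apply: fin_leB; last first.
        apply: fin_leM1; last exact: fin_le_invn.
        by rewrite mulrC; apply: fin_leMint; exact: fin_le_nat.
      rewrite (_ : b%:R * invn d + x - a = - (d%:R * (a - x) - b%:R) * invn d).
        by apply: fin_leM1; [exact: fin_leN|exact: fin_le_invn].
      rewrite opprB mulrBl [d%:R * _ * _]mulrC invn_mulr// opprB.
      by rewrite addrA.
  exists (choice.pickle (\matrix_(i, j) z (i, j))) => //.
  rewrite choice.pickleK_inv /H /G /=; split; last by rewrite /= addKr.
  split; first exact/perW.
  by move=> i j; rewrite !mxE; exact: hz (i, j).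
apply: (@le_trans _ _ (\sum_(k <oo) mu (G (choice.pickle_inv k)))%E).
  by apply: lee_nneseries => // k _; rewrite HG.
have tG : trivIset setT (fun k => G (choice.pickle_inv k)).
  move=> k k' _ _ [X []].
  case ek : (choice.pickle_inv k : option 'M[int]_(m, n)) => [z|//] [_ Xk].
  case ek' : (choice.pickle_inv k' : option 'M[int]_(m, n)) => [z'|//] [_ Xk'].
  have zz : z = z'.
    apply/matrixP => i j; have := Xk i j; have := Xk' i j; rewrite !mxE /=.
    set w := invn d; set x := X i j; set a := A' i j => -[y0 y1 yf] [x0 x1 xf].
    have fE : fin_le E ((z i j - z' i j)%:~R : QS).
      rewrite (_ : (z i j - z' i j)%:~R = d%:R * ((- ((z' i j)%:~R * w) + x - a) -
         (- ((z i j)%:~R * w) + x - a))).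
        by rewrite mulrC; apply: fin_leM1; [exact: fin_leB|exact: fin_le_nat].
      rewrite opprB addrA subrK opprD addrACA subrr addr0 opprK addrC -mulrBl -intrB.
      by rewrite [_ * w]mulrC mulr_invn.
    have dv : (E %| `|z i j - z' i j|)%N by apply/(fin_le_intP R _ SE).
    have lt : (`|z i j - z' i j| < E)%N.
      have rew (t : int) : re (- (t%:~R * w) + x - a) = - (t%:~R / d%:R) + (re x - re a).
        by rewrite reB reD reN reM reint addrA.
      rewrite !rew in x0 x1 y0 y1.
      rewrite -(ltr_nat R) pmulrn abszE intr_norm -(ltr_pM2r (_ : 0 < d%:R^-1)) ?invr_gt0//.
      rewrite -[X in _ * X]ger0_norm ?invr_ge0// -normrM intrB mulrBl.
      by rewrite ltr_norml; apply/andP; split; lra.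
    apply/eqP; rewrite -subr_eq0 -absz_eq0; apply/negPn/negP => zz'.
    by move: dv; rewrite gtnNdvd// lt0n.
  pose M : countType := 'M[int]_(m, n).
  have := @choice.pickle_invK M k; have := @choice.pickle_invK M k'.
  by rewrite ek ek' /= zz => -> ->.
have <- : mu (\bigcup_k G (choice.pickle_inv k)) =
    (\sum_(k <oo) mu (G (choice.pickle_inv k)))%E.
  by rewrite measure_bigcup//; apply: eq_eseriesl => k; rewrite in_setT.
apply: le_measure; rewrite ?inE//.
- by apply: bigcupT_measurable.
- exact: measurableI.
- by move=> X [k _]; rewrite /G; case: choice.pickle_inv => // z [].
Qed.

Lemma measurable_periodic_cell (W : set BT) D E A : (0 < D)%N -> measurable W ->
  measurable (W `&` cell D E A).
Proof. by move=> D0 mW; apply: measurableI => //; exact: measurable_cell. Qed.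

(** In each entry stack [K] boxes of side E/d along the real interval of length 1/D: they cover it
    when d <= K D E. By [qbox_le] they all carry the same share of [W]. The reverse inequality in
    [cell_qbox_ge] packs them instead. *)
Lemma cell_qbox_le K d D E A (W : set BT) : (0 < D)%N -> (0 < d)%N ->
  coprime d (Sprod S) -> (Spi S).-nat E -> measurable W -> zperiodic d W ->
  (d <= K * (D * E))%N ->
  (mu (W `&` cell D E A) <= (K ^ (m * n))%N%:R%:E * mu (W `&` qbox d E A))%E.
Proof.
move=> D0 d0 cop SE mW perW dK; have E0 : (0 < E)%N by case/andP: SE.
have dp : (0 : R) < d%:R by rewrite ltr0n.
have Ep : (0 : R) < E%:R by rewrite ltr0n.
have Dp : (0 : R) < D%:R by rewrite ltr0n.
pose I : finType := 'M['I_K]_(m, n).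
have -> : (K ^ (m * n))%N = #|I| by rewrite card_mx card_ord.
pose h (f : I) : T := \matrix_(i, j)
  mkQS ((Num.floor (D%:R * re (A i j)))%:~R / D%:R + (f i j)%:R * (E%:R / d%:R)) (A i j).
have hA f i j : fin_le 1 (A i j - h f i j).
  by apply: (@fin_le_eq _ _ _ 0) => [v vf|]; [rewrite QSB mxE mkQS_fin// subrr|exact: fin_le0].
apply: (@measure_union_le _ _ _ _ mu _ (fun f => W `&` qbox d E (h f))).
- by move=> f; apply: measurableI => //; exact: measurable_qbox.
- exact: measurable_periodic_cell.
- move=> X [WX cX].
  have /choice[f hf] (ij : 'I_m * 'I_n) : exists k : 'I_K,
     let y := re (X ij.1 ij.2) - ((Num.floor (D%:R * re (A ij.1 ij.2)))%:~R / D%:R +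
       k%:R * (E%:R / d%:R)) in 0 <= y /\ y < E%:R / d%:R.
    have [/eqP + _] := cX ij.1 ij.2; rewrite floor_eq intrD => /andP[].
    set x := re (X _ _); set z := (Num.floor _)%:~R => x0 x1.
    pose t := x - z / D%:R.
    have t0 : 0 <= t by rewrite subr_ge0 ler_pdivrMr// mulrC.
    have t1 : t < D%:R^-1.
      by rewrite ltrBlDr -[X in X + _]mul1r -mulrDl ltr_pdivlMr// mulrC addrC.
    have s0 : 0 <= t * d%:R / E%:R by rewrite divr_ge0// ?mulr_ge0// ltW.
    have kK : (Num.trunc (t * d%:R / E%:R) < K)%N.
      rewrite truncn_lt_nat// ltr_pdivrMr// -natrM (@lt_le_trans _ _ (D%:R^-1 * d%:R))//.
        by rewrite ltr_pM2r.
      by rewrite mulrC ler_pdivrMr// -natrM ler_nat mulnAC -mulnA.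
    have /andP[k1 k2] := trunc_itv s0; rewrite -natr1 in k2.
    exists (Ordinal kK) => /=; rewrite opprD addrA -/t; split.
      by rewrite subr_ge0 mulrA ler_pdivrMr// -ler_pdivlMr.
    rewrite ltrBlDr -{1}[E%:R / d%:R]mul1r -mulrDl mulrA ltr_pdivlMr//.
    by rewrite -ltr_pdivrMr// addrC.
  exists (\matrix_(i, j) f (i, j)); split => // i j.
  have [y0 y1] := hf (i, j); have [_ fl] := cX i j.
  rewrite !reB mxE re_mkQS mxE; split => //.
  by apply: fin_le_eq fl => v vf; rewrite !QSB mkQS_fin.
- by move=> f; exact: qbox_le.
Qed.

Lemma cell_qbox_ge K d D E A (W : set BT) : (0 < D)%N -> (0 < d)%N ->
  coprime d (Sprod S) -> (Spi S).-nat E -> measurable W -> zperiodic d W ->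
  (K * (D * E) <= d)%N ->
  ((K ^ (m * n))%N%:R%:E * mu (W `&` qbox d E A) <= mu (W `&` cell D E A))%E.
Proof.
move=> D0 d0 cop SE mW perW dK; have E0 : (0 < E)%N by case/andP: SE.
have dp : (0 : R) < d%:R by rewrite ltr0n.
have Ep : (0 : R) < E%:R by rewrite ltr0n.
have Dp : (0 : R) < D%:R by rewrite ltr0n.
pose I : finType := 'M['I_K]_(m, n).
have -> : (K ^ (m * n))%N = #|I| by rewrite card_mx card_ord.
pose h (f : I) : T := \matrix_(i, j)
  mkQS ((Num.floor (D%:R * re (A i j)))%:~R / D%:R + (f i j)%:R * (E%:R / d%:R)) (A i j).
have hA f i j : fin_le 1 (h f i j - A i j).
  by apply: (@fin_le_eq _ _ _ 0) => [v vf|]; [rewrite QSB mxE mkQS_fin// subrr|exact: fin_le0].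
apply: (@measure_union_ge _ _ _ _ mu _ (fun f => W `&` qbox d E (h f))).
- by move=> f; apply: measurableI => //; exact: measurable_qbox.
- exact: measurable_periodic_cell.
- move=> f X [WX qX]; split => // i j; have [y0 y1 fl] := qX i j.
  rewrite reB mxE re_mkQS in y0 y1.
  split; last by apply: fin_le_eq fl => v vf; rewrite !QSB mxE mkQS_fin.
  set z := Num.floor _ in y0 y1 *; set x := re (X i j) in y0 y1 *.
  have Ed : 0 < E%:R / d%:R :> R by rewrite divr_gt0.
  have k0 : 0 <= (f i j)%:R * (E%:R / d%:R) :> R by rewrite mulr_ge0// ltW.
  have k1 : ((f i j)%:R + 1) * (E%:R / d%:R) <= D%:R^-1 :> R.
    rewrite natr1 (@le_trans _ _ (K%:R * (E%:R / d%:R)))//.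
      by rewrite ler_pM2r// ler_nat ltn_ord.
    by rewrite mulrA ler_pdivrMr// ler_pdivlMl// -!natrM ler_nat mulnCA.
  rewrite mulrDl mul1r in k1.
  apply/eqP; rewrite floor_eq intrD; apply/andP; split.
    by rewrite mulrC -ler_pdivrMr//; lra.
  rewrite mulrC -ltr_pdivlMr// mulrDl div1r; lra.
- move=> f g X [_ qf] [_ qg]; apply/matrixP => i j.
  have [] := qf i j; have [] := qg i j; rewrite !reB !mxE !re_mkQS.
  set x := re (X _ _); set z := _ / D%:R; set e := E%:R / d%:R => g0 g1 _ f0 f1 _.
  have e0 : 0 < e by rewrite divr_gt0.
  have eqn (a b : nat) : (a%:R : R) * e < (b%:R + 1) * e -> b%:R * e < (a%:R + 1) * e -> a = b.
    rewrite !ltr_pM2r// !natr1 !ltr_nat !ltnS => ab ba.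
    by apply/eqP; rewrite eqn_leq ab.
  apply: val_inj; apply: eqn; rewrite mulrDl mul1r; lra.
- by move=> f; exact: qbox_le.
Qed.

End Dilation.

Lemma bernoulli_le (R : realFieldType) (t : R) (N : nat) : 0 <= t <= 1 ->
  1 - N%:R * t <= (1 - t) ^+ N.
Proof.
move=> /andP[t0 t1]; elim: N => [|N IH]; first by rewrite mul0r subr0 expr0.
rewrite exprSr (@le_trans _ _ ((1 - N%:R * t) * (1 - t)))//.
  rewrite -natr1; have : 0 <= N%:R * t * t by rewrite !mulr_ge0.
  lra.
by rewrite ler_wpM2r// subr_ge0.
Qed.

(** The ratio (K / (K + 1))^N tends to 1, which Bernoulli's inequality makes quantitative. *)
Lemma le_of_pow_ratio (R : realType) (x y : R) (N : nat) : 0 <= x ->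
  (forall j, exists K, (j <= K)%N /\ K%:R ^+ N * x <= K.+1%:R ^+ N * y) -> x <= y.
Proof.
move=> x0 h; apply/ler_addgt0Pr => e e0.
have [j hj] : exists j : nat, N%:R * x / e <= j%:R.
  have s0 : 0 <= N%:R * x / e by rewrite divr_ge0 ?mulr_ge0// ltW.
  exists (Num.trunc (N%:R * x / e)).+1; apply/ltW.
  by have /andP[] := trunc_itv s0.
have [K [jK hK]] := h j.
have Kp : (0 : R) < K.+1%:R by [].
pose t : R := K.+1%:R^-1.
have t01 : 0 <= t <= 1 by rewrite invr_ge0 ler0n/= invf_le1// ler1n.
have tE : 1 - t = K%:R / K.+1%:R.
  have KE : K%:R = K.+1%:R - 1 :> R by rewrite -natr1 addrK.
  by rewrite KE mulrBl mulfV ?gt_eqF// mul1r.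
have h1 : (1 - t) ^+ N * x <= y.
  rewrite tE expr_div_n mulrAC ler_pdivrMr ?exprn_gt0// mulrC.
  by rewrite mulrC [y * _]mulrC.
have h2 : (1 - N%:R * t) * x <= y.
  by rewrite (le_trans _ h1)// ler_wpM2r// bernoulli_le.
have h3 : N%:R * t * x <= e.
  rewrite mulrAC ler_pdivrMr//; move: hj; rewrite ler_pdivrMr// => hj.
  rewrite (le_trans hj)// mulrC ler_wpM2l ?(ltW e0)// ler_nat.
  exact: leqW.
rewrite mulrBl mul1r in h2; lra.
Qed.

Section ZeroOne.
Variables (R : realType) (S : {fset place}).
Hypothesis S_infinite : infinite_place \in S.
Variables m n : nat.
Local Notation QS := (QS R S).
Local Notation T := 'M[QS]_(m, n).
Local Notation BT := (borel T).
Local Notation re := (@re R S S_infinite).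
Local Notation cell := (@cell R S S_infinite m n).
Local Notation cellk := (@cellk R S S_infinite m n).
Local Notation unit_cell := (@unit_cell R S S_infinite m n).
Local Notation qbox := (@qbox R S S_infinite m n).
Local Notation invn := (@invn R S).
Implicit Types (A X : T) (D E d k : nat).

Variable mu : {measure set BT -> \bar R}.
Hypothesis mu_inv : translation_invariant mu.
Variable u : R.
Hypothesis u_gt0 : 0 < u.
Hypothesis mu_unit : mu unit_cell = u%:E.

Lemma dil_shiftz d z X : (0 < d)%N -> dil d (shiftz R S d z + X) = shiftz R S 1 z + dil d X.
Proof.
move=> d0; apply/matrixP => i j; rewrite !mxE mulrDr; congr (_ + _).
rewrite mulrCA -[invn d]mulr1 mulr_invn//; congr (_ * _).
by rewrite invn1.
Qed.

Lemma periodic_dil d W : (0 < d)%N -> zperiodic 1 W -> zperiodic d (dil d @^-1` W : set T).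
Proof. by move=> d0 perW z X; rewrite /preimage /= dil_shiftz//; exact: perW. Qed.

Lemma qbox_dil d : (0 < d)%N -> coprime d (Sprod S) ->
  qbox d 1 0 = dil d @^-1` unit_cell.
Proof.
move=> d0 cop; have dp : (0 : R) < d%:R by rewrite ltr0n.
apply/seteqP; split => X.
  move=> h; apply/unit_cellP => i j; have := h i j; rewrite !mxE subr0 => -[h0 h1 hf].
  rewrite reM renat; split; first by rewrite mulr_ge0.
    by move: h1; rewrite ltr_pdivlMr// mulrC.
  by rewrite mulrC; apply: fin_leM1 => //; exact: fin_le_nat.
move=> /unit_cellP h i j; have := h i j; rewrite !mxE subr0 reM renat => -[h0 h1 hf].
split; first by rewrite -(pmulr_rge0 _ dp).
  by rewrite ltr_pdivlMr// mulrC.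
rewrite -[X i j](invn_mulr _ d0) mulrC; apply: fin_leM1 => //; exact: fin_le_invn.
Qed.

(** Multiplication by [d] on the quotient by the integer matrices preserves the measure. The unit
    cell consists of [d ^ (m * n)] boxes, each dilated onto the unit cell, and the resulting factor
    is seen to be 1 by taking the whole space for [W]. *)
Lemma measure_dil_periodic d (W : set BT) : (0 < d)%N -> coprime d (Sprod S) ->
  measurable W -> zperiodic 1 W ->
  mu (dil d @^-1` W `&` unit_cell) = mu (W `&` unit_cell).
Proof.
move=> d0 cop mW perW.
have [c c0 hc] := measure_dil mu_inv u_gt0 mu_unit d0.
have key (V : set BT) : measurable V -> zperiodic 1 V ->
    mu (dil d @^-1` V `&` unit_cell) =
    ((d ^ (m * n))%N%:R%:E * (c%:E * mu (V `&` unit_cell)))%E.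
  move=> mV perV.
  have mdV : measurable (dil d @^-1` V : set BT) by exact: measurable_dil.
  have pdV : zperiodic d (dil d @^-1` V : set T) by exact: periodic_dil.
  rewrite -hc; last by apply: measurableI => //; exact: measurable_unit_cell.
  rewrite preimage_setI -qbox_dil//; apply/eqP; rewrite eq_le; apply/andP; split.
    by apply: cell_qbox_le => //; rewrite ?muln1.
  by apply: cell_qbox_ge => //; rewrite ?muln1.
have hT := key setT measurableT (fun z X => iff_refl _).
rewrite preimage_setT !setTI mu_unit -!EFinM in hT.
have e1 : (d ^ (m * n))%N%:R * c = 1 :> R.
  by apply: (mulIf (lt0r_neq0 u_gt0)); case: hT => {2}->; ring.
by rewrite key// muleA -EFinM e1 mul1e.
Qed.

Lemma measure_fin_sub (B : set BT) : measurable B -> B `<=` unit_cell -> (mu B < +oo)%E.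
Proof.
move=> mB sB; apply: (@le_lt_trans _ _ (mu unit_cell)).
  by apply: le_measure; rewrite ?inE//; exact: measurable_unit_cell.
by rewrite mu_unit ltry.
Qed.

Lemma cellk_unit k A : unit_cell A -> cellk k A `<=` unit_cell.
Proof.
move=> hA; have := @cellk_sub R S S_infinite m n 0 k A (leq0n k).
by rewrite [cellk 0 A]cellk0E -(cell_eq hA).
Qed.

Section Invariant.
Variable W : set BT.
Hypothesis mW : measurable W.
Hypothesis perW : zperiodic 1 W.
Hypothesis dilW : forall d, (0 < d)%N -> coprime d (Sprod S) ->
  W `<=` dil d @^-1` W.

Let mWc k A : measurable (W `&` cellk k A : set BT).
Proof. by apply: measurableI => //; exact: measurable_cellk. Qed.

(** [W] is contained in its preimage and both have the same finite measure in the unit cell, so they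
    differ there by a null set. *)
Lemma dil_ae d (C : set BT) : (0 < d)%N -> coprime d (Sprod S) -> measurable C ->
  C `<=` unit_cell -> mu (dil d @^-1` W `&` C) = mu (W `&` C).
Proof.
move=> d0 cop mC sC; pose Wd : set BT := dil d @^-1` W.
rewrite -/Wd.
have mdW : measurable Wd by exact: measurable_dil.
have mU := @measurable_unit_cell R S S_infinite m n.
have nul : mu ((Wd `\` W) `&` unit_cell) = 0%E.
  have -> : (Wd `\` W) `&` unit_cell =
     (Wd `&` unit_cell) `\` (W `&` unit_cell) :> set BT.
    apply/seteqP; split => X /= [].
      by move=> [h1 h2] h3; split => // -[].
    by move=> [h1 h2] h3; split => //; split => // WX; apply: h3.
  rewrite measureD; [|exact: measurableI|exact: measurableI|]; last first.
    by apply: measure_fin_sub; [exact: measurableI|move=> X []].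
  have -> : Wd `&` unit_cell `&` (W `&` unit_cell) = W `&` unit_cell.
    by rewrite setIidr//; apply: setSI; exact: dilW.
  transitivity (mu (W `&` unit_cell) - mu (W `&` unit_cell))%E.
    by congr (_ - _)%E; exact: measure_dil_periodic.
  rewrite subee// ge0_fin_numE//.
  by apply: measure_fin_sub; [exact: measurableI|move=> X []].
apply/eqP; rewrite eq_le; apply/andP; split; last first.
  apply: le_measure; rewrite ?inE; [exact: measurableI|exact: measurableI|].
  by apply: setSI; exact: dilW.
apply: (@le_trans _ _ (mu ((W `&` C) `|` ((Wd `\` W) `&` unit_cell)))).
  apply: le_measure; rewrite ?inE; [exact: measurableI| |].
    by apply: measurableU; apply: measurableI => //; exact: measurableD.
  by move=> X [h1 h2]; have [WX|nWX] := pselect (W X); [left|right; split; [|exact: sC]].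
apply: (le_trans (measureU2 _ _ _)); [exact: measurableI| |].
  by apply: measurableI => //; exact: measurableD.
by rewrite -[leRHS]adde0; apply: leeD => //; rewrite le_eqVlt; apply/orP; left; apply/eqP.
Qed.

(** Replace [W] by its preimage under a dilation [d], which is periodic under (1/d)Z and agrees with
    [W] up to a null set. With d = K D E + 1, each cell contains [K ^ (m * n)] boxes of this period
    and is covered by [K.+1 ^ (m * n)] of them, all with equal shares; let [K] grow. *)
Lemma cellk_le k A A' : unit_cell A -> unit_cell A' ->
  (mu (W `&` cellk k A) <= mu (W `&` cellk k A'))%E.
Proof.
move=> hA hA'.
have fin B : unit_cell B -> mu (W `&` cellk k B) \is a fin_num.
  move=> hB; rewrite ge0_fin_numE//; apply: measure_fin_sub => // X [_].
  exact: cellk_unit.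
rewrite -(fineK (fin _ hA)) -(fineK (fin _ hA')) lee_fin.
apply: (@le_of_pow_ratio _ _ _ (m * n)); first exact: fine_ge0.
move=> j; pose D := (2 ^ k)%N; pose E := (Sprod S ^ k)%N.
have D0 : (0 < D)%N := pow2_gt0 k; have E0 : (0 < E)%N := Sprodk_gt0 S k.
have SE : (Spi S).-nat E by rewrite pnatX Sprod_Spi.
(* A multiple of M, so that [d] is 1 modulo M and hence prime to it. *)
pose K := (Sprod S * j)%N; exists K; split; first by rewrite leq_pmull// Sprod_gt0.
pose d := (K * (D * E)).+1.
have cop : coprime d (Sprod S).
  by rewrite /d /K -mulnA mulnC coprime_sym /coprime -addn1 gcdnMDl gcdn1.
have DE0 : (0 < D * E)%N by rewrite muln_gt0 D0.
have perd := periodic_dil (d := d) (isT : (0 < d)%N) perW.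
have mdW : measurable (dil d @^-1` W : set BT) by exact: measurable_dil.
have h1 : (mu (W `&` cellk k A) <= (K.+1 ^ (m * n))%N%:R%:E *
    mu (dil d @^-1` W `&` qbox d E A))%E.
  rewrite -(@dil_ae d)//; [|exact: measurable_cellk|exact: cellk_unit].
  by apply: cell_qbox_le => //; rewrite /d mulSn -add1n leq_add2r.
have h2 : ((K ^ (m * n))%N%:R%:E * mu (dil d @^-1` W `&` qbox d E A') <=
    mu (W `&` cellk k A'))%E.
  rewrite -(@dil_ae d (cellk k A'))//; [|exact: measurable_cellk|exact: cellk_unit].
  by apply: cell_qbox_ge => //; rewrite leqnSn.
have h3 : (mu (dil d @^-1` W `&` qbox d E A) <= mu (dil d @^-1` W `&` qbox d E A'))%E.
  apply: qbox_le => // i j'; have [_ _ f1] := (unit_cellP _ _).1 hA' i j'.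
  by have [_ _ f2] := (unit_cellP _ _).1 hA i j'; exact: fin_leB.
rewrite -!natrX -lee_fin !EFinM !fineK ?fin//.
apply: (@le_trans _ _ ((K ^ (m * n))%N%:R%:E * ((K.+1 ^ (m * n))%N%:R%:E *
    mu (dil d @^-1` W `&` qbox d E A)))%E).
  by apply: lee_wpmul2l.
rewrite muleCA; apply: lee_wpmul2l => //; apply: le_trans h2.
by apply: lee_wpmul2l.
Qed.

Lemma measure_periodic_cellk k A : unit_cell A ->
  mu (W `&` unit_cell) =
    (((2 ^ k * Sprod S ^ k) ^ (m * n))%N%:R%:E * mu (W `&` cellk k A))%E.
Proof.
move=> hA; have D0 := pow2_gt0 k; have E0 := Sprodk_gt0 S k.
have SE : (Spi S).-nat (Sprod S ^ k)%N by rewrite pnatX Sprod_Spi.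
have [I [h [<- h1 h2 h3]]] := @unit_cell_partition R S S_infinite m n _ _ D0 SE.
have hU i : unit_cell (h i) by apply: (h2 i); exact: cell_refl.
have mWU : measurable (W `&` unit_cell).
  by apply: measurableI => //; exact: measurable_unit_cell.
apply/eqP; rewrite eq_le; apply/andP; split.
  apply: (@measure_union_le _ _ _ _ mu _ (fun i => W `&` cellk k (h i))) => //.
    by move=> X [WX /h1[i hi]]; exists i.
  by move=> i; exact: cellk_le.
apply: (@measure_union_ge _ _ _ _ mu _ (fun i => W `&` cellk k (h i))) => //.
- by move=> i X [WX /h2]; split.
- by move=> i j X [_ hi] [_ hj]; exact: h3 hi hj.
- by move=> i; exact: cellk_le.
Qed.

(** [W] has the same density in all cells of the unit cell, so the restriction of [mu] to [W] is a
    positive multiple of its restriction to the unit cell. Evaluate both measures on the complement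
    of [W]. *)
Lemma zero_one : (0 < mu (W `&` unit_cell))%E -> mu (unit_cell `\` W) = 0%E.
Proof.
move=> pos; have mU := @measurable_unit_cell R S S_infinite m n.
have mWU : measurable (W `&` unit_cell) by exact: measurableI.
have finW : (mu (W `&` unit_cell) < +oo)%E by apply: measure_fin_sub => // X [].
pose w := fine (mu (W `&` unit_cell)).
have wE : mu (W `&` unit_cell) = w%:E by rewrite fineK// ge0_fin_numE.
have w0 : 0 < w by rewrite -lte_fin -wE.
have k0 : 0 <= w / u by rewrite divr_ge0 ?ltW.
pose m1 : {measure set BT -> \bar R} := mrestr mu mWU.
pose m2 : {measure set BT -> \bar R} := mscale (NngNum k0) (mrestr mu mU).
have m1E B : m1 B = mu (B `&` (W `&` unit_cell)) by [].
have m2E B : m2 B = ((w / u)%:E * mu (B `&` unit_cell))%E by [].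
have eq12 : forall k A, m1 (cellk k A) = m2 (cellk k A).
  move=> k A; rewrite m1E m2E.
  have [e0|/set0P[X [cX UX]]] := eqVneq (cellk k A `&` unit_cell) set0.
    by rewrite e0 measure0 mule0 [W `&` _]setIC setIA e0 set0I measure0.
  rewrite [cellk k A](cell_eq cX) -[cell _ _ X]/(cellk k X).
  have sub := cellk_unit (k := k) UX.
  have -> : cellk k X `&` unit_cell = cellk k X by exact/setIidl.
  have -> : cellk k X `&` (W `&` unit_cell) = W `&` cellk k X.
    by rewrite [W `&` _]setIC setIA (setIidl sub) setIC.
  have := measure_periodic_cellk k UX; have := measure_cellk S_infinite mu_inv k X.
  set N := ((_ * _) ^ _)%N.
  have N0 : (0 < N)%N by rewrite expn_gt0 muln_gt0 pow2_gt0 Sprodk_gt0.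
  have Nn : N%:R != 0 :> R by rewrite pnatr_eq0 -lt0n.
  have inv (x : \bar R) : (N%:R^-1%:E * (N%:R%:E * x) = x)%E.
    by rewrite muleA -EFinM mulVf// mul1e.
  rewrite mu_unit wE => /(congr1 (fun x => (N%:R^-1%:E * x)%E)).
  rewrite inv => <- /(congr1 (fun x => (N%:R^-1%:E * x)%E)).
  rewrite inv => <-; rewrite -!EFinM; congr EFin.
  by field; rewrite Nn gt_eqF.
have fin0 A : (m1 (cellk 0 A) < +oo)%E.
  rewrite m1E; apply: measure_fin_sub; last by move=> X [_ []].
  by apply: measurableI => //; exact: measurable_cellk.
have mWC : measurable (~` W : set BT) by exact: measurableC.
have := @measure_eq_cellk R S S_infinite m n m1 m2 eq12 fin0 _ mWC.
rewrite m1E m2E setIA setICl set0I measure0 => /esym/eqP.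
rewrite mule_eq0 => /orP[|/eqP h]; first by rewrite eqe mulf_eq0 invr_eq0 !gt_eqF.
by rewrite setDE setIC.
Qed.

End Invariant.
End ZeroOne.

(** * Matrices with a small value at a given integer vector *)

Definition vec_of (k K : nat) (f : 'cV['I_(2 * K + 1)]_k) : 'cV[int]_k :=
  \col_i ((f i 0)%:Z - K%:Z).

Lemma vec_of_surj (k K : nat) (q : 'cV[int]_k) :
  (forall i, `|q i 0%R| <= K)%N -> exists f, q = vec_of (f : 'cV['I_(2 * K + 1)]_k).
Proof.
move=> h.
have lt i : (`|(q i 0%R + K%:Z)%R| < 2 * K + 1)%N by have := h i; lia.
exists (\col_i Ordinal (lt i)); apply/colP => i; rewrite !mxE /=.
have := h i; lia.
Qed.

Lemma dvdn_div_gcd (E g k : nat) : (0 < E)%N -> (E %| k * g)%N -> (E %/ gcdn g E %| k)%N.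
Proof.
move=> E0 h; have d0 : (0 < gcdn g E)%N by rewrite gcdn_gt0 E0 orbT.
have [Ed gd] : E = (E %/ gcdn g E * gcdn g E)%N /\ g = (g %/ gcdn g E * gcdn g E)%N.
  by rewrite !divnK ?dvdn_gcdl ?dvdn_gcdr.
have cop : coprime (E %/ gcdn g E) (g %/ gcdn g E).
  rewrite /coprime -(eqn_pmul2r d0) mul1n muln_gcdl -Ed -gd gcdnC.
  by apply/eqP; rewrite [RHS]gcdnC gcdnC.
rewrite -(Gauss_dvdl k cop) -(@dvdn_pmul2r (gcdn g E))// -Ed.
by rewrite -mulnA -gd.
Qed.

Section Strip.
Variables (R : realType) (S : {fset place}).
Hypothesis S_infinite : infinite_place \in S.
Variables m n : nat.
Local Notation QS := (QS R S).
Local Notation T := 'M[QS]_(m, n).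
Local Notation BT := (borel T).
Local Notation re := (@re R S S_infinite).
Local Notation mkQS := (@mkQS R S).
Local Notation cell := (@cell R S S_infinite m n).
Local Notation unit_cell := (@unit_cell R S S_infinite m n).
Local Notation big_box := (@big_box R S S_infinite m n).
Implicit Types (A X : T) (D E d k : nat) (q : 'cV[int]_n).

(* The multiplier [c] absorbs a bounded common divisor of [q] and the primes of [S]. *)
Definition strip (w : R) E c q (y : 'cV[QS]_m) : set T := [set X | forall i,
  `|re (y i 0 + ap X q i 0)| <= w /\ fin_le E (c%:R * (y i 0 + ap X q i 0))].

Lemma measurable_strip w E c q y : measurable (strip w E c q y : set BT).
Proof.
rewrite (_ : strip _ _ _ _ _ = [set X : T | forall i : 'I_m,
  ([set X : T | `|re (y i 0 + ap X q i 0)| <= w] `&`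
   [set X : T | fin_le E (c%:R * (y i 0 + ap X q i 0))]) X])//.
have qc (i : 'I_m) : qcont (fun X : T => y i 0 + ap X q i 0).
  by apply: qcontD; [exact: qcont_cst|exact: qcont_ap].
apply: measurable_forall => i; apply: measurableI; first exact: measurable_re_norm.
by apply: measurable_fin_le; exact: qcontMl.
Qed.

Variable mu : {measure set BT -> \bar R}.
Hypothesis mu_inv : translation_invariant mu.

(* Moving along the section [sec] of [A |-> A q] produces disjoint translates of
   the strip. *)
Lemma strip_packing q (sec : 'cV[QS]_m -> T) (y : 'cV[QS]_m) w s E c E0 B E1
    (C D : set BT) :
  (forall Y i, ap (sec Y) q i 0 = Y i 0) -> measurable C -> measurable D ->
  0 <= w -> 2 * w < s -> C `<=` strip w E c q y ->
  (forall k : int, fin_le E (c%:R * (k%:~R * E0%:R) : QS) -> (E1 %| `|k|)%N) ->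
  (forall (f : 'cV[('I_B * 'I_E1)%type]_m) X, C X ->
     D (sec (\col_i mkQS ((f i 0).1%:R * s) ((f i 0).2%:R * E0%:R)) + X)) ->
  (((B * E1) ^ m)%N%:R%:E * mu C <= mu D)%E.
Proof.
move=> hsec mC mD w0 ws Cstrip hE1 hD.
pose I : finType := 'cV[('I_B * 'I_E1)%type]_m.
have -> : ((B * E1) ^ m)%N = #|I| by rewrite card_mx card_prod !card_ord muln1.
apply: (packing mu_inv (h := fun f : I =>
  sec (\col_i mkQS ((f i 0).1%:R * s) ((f i 0).2%:R * E0%:R)))) => //.
move=> f g X Y CX CY XY; apply/matrixP => i j; rewrite [j]ord1 {j}.
pose Yt (f : I) i := mkQS ((f i 0).1%:R * s) ((f i 0).2%:R * E0%:R).
have YtE (f' : I) : (\col_i mkQS ((f' i 0).1%:R * s) ((f' i 0).2%:R * E0%:R)) i 0 = Yt f' i.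
  by rewrite mxE.
have := congr1 (fun Z => ap Z q i 0) XY; rewrite !apD !hsec !YtE /Yt => e.
have [Xr Xf] := Cstrip _ CX i; have [Yr Yf] := Cstrip _ CY i.
have e1 : (f i 0).1 = (g i 0).1.
  have := congr1 re e; rewrite !reD !re_mkQS => er.
  rewrite reD in Xr; rewrite reD in Yr.
  move: Xr Yr; rewrite !ler_norml => /andP[x1 x2] /andP[y1 y2].
  have s0 : 0 < s by lra.
  have eqn (a b : nat) : (a%:R : R) * s < (b%:R + 1) * s -> b%:R * s < (a%:R + 1) * s -> a = b.
    rewrite !ltr_pM2r// !natr1 !ltr_nat !ltnS => ab ba.
    by apply/eqP; rewrite eqn_leq ab.
  by apply: val_inj; apply: eqn; rewrite mulrDl mul1r; lra.
have e2 : (f i 0).2 = (g i 0).2.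
  have : (E1 %| `|(f i 0%R).2%:Z - (g i 0%R).2%:Z|)%N.
    apply: hE1.
    apply: (@fin_le_eq _ _ _ (c%:R * (y i 0 + ap Y q i 0) - c%:R * (y i 0 + ap X q i 0))).
      move=> v vf; rewrite intrB -!pmulrn; have := congr1 (fun x : QS => x v) e.
      rewrite !QSD !mkQS_fin// !QSM => ev.
      rewrite QSD QSN !QSM !QSD QSN; move: ev.
      set a := ((f i 0).2%:R : QS) v; set b := ((g i 0).2%:R : QS) v.
      move=> ev; have -> : ap Y q i 0 v = a * (E0%:R : QS) v + ap X q i 0 v
         - b * (E0%:R : QS) v by rewrite ev; ring.
      by ring.
    exact: fin_leB.
  have := ltn_ord (f i 0).2; have := ltn_ord (g i 0).2 => g2 f2 dv.
  apply: val_inj => /=; apply/eqP; rewrite -eqz_nat -subr_eq0 -absz_eq0.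
  apply/negPn/negP => ne; move: dv; rewrite gtnNdvd// ?lt0n//.
  by move: f2 g2; set a := nat_of_ord _; set b := nat_of_ord _; lia.
by move: (f i 0) (g i 0) e1 e2 => [a b] [c' d] /= -> ->.
Qed.

Variable u : R.
Hypothesis u_gt0 : 0 < u.
Hypothesis mu_unit : mu unit_cell = u%:E.
Hypothesis n_gt0 : (0 < n)%N.

(** Real steps of 3/N exceed the width 2/N of the strip, and |q| N / 3 of them move the entries by
    at most 1. Finite steps are multiples of [gcd_vec q], which keeps the section integral, and they
    give E / gcd(gcd_vec q, E) classes. All translates stay in a box covered by [5 ^ (m * n)] unit
    cells. *)
Lemma strip_unit_le q N E (y : 'cV[QS]_m) : q != 0 -> (2 < N)%N -> (Spi S).-nat E ->
  ((((supnorm_int q * N) %/ 3 * (E %/ gcdn (gcd_vec q) E)) ^ m)%N%:R%:E *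
    mu (unit_cell `&` strip N%:R^-1 E 1 q y) <= ((5 ^ (m * n))%N%:R * u)%:E)%E.
Proof.
move=> q0 N3 SE; have E0 : (0 < E)%N by case/andP: SE.
have g0 := gcd_vec_gt0 q0; have s0 := supnorm_gt0 q0.
have Np : (0 : R) < N%:R by rewrite ltr0n (leq_trans _ N3).
have sp : (0 : R) < (supnorm_int q)%:R by rewrite ltr0n.
have [sec [hsec hre hfin]] := @section_ap R S S_infinite m n q q0.
apply: (@le_trans _ _ (mu (big_box 2 1 1 1 0))); last first.
  have := measure_big_box S_infinite mu_inv 2 (0 : T) (isT : (0 < 1)%N)
    (isT : (0 < 1)%N) (isT : (0 < 1)%N).
  by rewrite -/unit_cell mu_unit -EFinM muln1.
apply: (@strip_packing q sec y N%:R^-1 (3 / N%:R) E 1 (gcd_vec q)) => //.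
- by apply: measurableI; [exact: measurable_unit_cell|exact: measurable_strip].
- exact: measurable_big_box.
- by rewrite ltr_pM2r ?invr_gt0// ltr_nat.
- move=> k; rewrite mul1r => hk; apply: dvdn_div_gcd => //.
  have := hk; rewrite pmulrn -intrM => /(fin_le_intP R _ SE).
  by rewrite abszM.
- move=> f X [/unit_cellP hX _] i j; have [x0 x1 xf] := hX i j.
  rewrite !mxE subr0 divr1 mul1r; set Y := \col_i _.
  split; last first.
    apply: fin_leD => //; apply/(@fin_le_pM _ _ 1 _ _ g0); rewrite muln1.
    apply: hfin; rewrite mxE; apply: (@fin_le_eq _ _ _ ((f i 0).2%:R * (gcd_vec q)%:R)).
      by move=> v vf; rewrite mkQS_fin.
    by rewrite mulrC; apply: fin_leM1; exact: fin_le_nat.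
  rewrite reD (le_trans (ler_normD _ _))// -[leRHS]/(1 + 1) lerD//; last first.
    by rewrite ger0_norm// ltW.
  rewrite (le_trans (hre _ _ _))// mxE re_mkQS ger0_norm; last first.
    by rewrite mulr_ge0 ?divr_ge0.
  rewrite ler_pdivrMr// mul1r mulrA ler_pdivrMr// -!natrM ler_nat.
  apply: leq_trans (leq_trunc_div _ 3); rewrite leq_mul2r.
  by rewrite ltnW.
Qed.

(* The integer vectors [p] that occur are divisible by [gcd (gcd_vec q, E)], which
   compensates for the loss of that factor in the width of a single strip. *)
Lemma near_measure_le q N E : q != 0 -> (2 < N)%N -> (Spi S).-nat E ->
  exists V : set BT, [/\ measurable V, V `<=` unit_cell,
    forall A (p : 'cV[int]_m), unit_cell A ->
      strip N%:R^-1 E 1 q (diag_int R S p) A -> V A &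
    (mu V <= ((30 * n)%:R ^+ m / (N * E)%:R ^+ m * (5 ^ (m * n))%N%:R * u)%:E)%E].
Proof.
move=> q0 N3 SE; have E0 : (0 < E)%N by case/andP: SE.
have g0 := gcd_vec_gt0 q0; have s0 := supnorm_gt0 q0.
pose d := gcdn (gcd_vec q) E.
have d0 : (0 < d)%N by rewrite gcdn_gt0 g0.
have ds : (d <= supnorm_int q)%N.
  by apply: leq_trans (gcd_vec_le q0); apply: dvdn_leq => //; exact: dvdn_gcdl.
have Sd : (Spi S).-nat d by apply: pnat_dvd SE; exact: dvdn_gcdr.
pose K := ((n * supnorm_int q + 1) %/ d)%N.
pose I : finType := 'cV['I_(2 * K + 1)]_m.
pose Z (f : I) : 'cV[int]_m := \col_i (d%:Z * vec_of f i 0).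
pose G (f : I) : set BT := unit_cell `&` strip N%:R^-1 E 1 q (diag_int R S (Z f)).
have mG f : measurable (G f).
  by apply: measurableI; [exact: measurable_unit_cell|exact: measurable_strip].
exists (\bigcup_f G f); split.
- by apply: fin_bigcup_measurable => //; exact: finite_finset.
- by move=> X [f _ []].
- move=> A p UA sA.
  have hp i : (d %| `|p i 0%R|)%N /\ (`|p i 0%R| <= n * supnorm_int q + 1)%N.
    have [r f] := sA i; rewrite mxE mul1r in r f; split.
      apply/(fin_le_intP R _ Sd).
      rewrite -(addrK (ap A q i 0) ((p i 0)%:~R)); apply: fin_leB.
        by apply: fin_le_dvd f => //; exact: dvdn_gcdr.
      apply: (@fin_le_dvd _ _ (gcd_vec q)) => //; first exact: dvdn_gcdl.
      apply: fin_le_gcd_vec => // i' j'.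
      by have [] := (unit_cellP _ _).1 UA i' j'.
    have h : `|re (ap A q i 0)| <= n%:R * (supnorm_int q)%:R * 1.
      apply: re_ap_le => j; have [a0 a1 _] := (unit_cellP _ _).1 UA i j.
      by rewrite ger0_norm// ltW.
    rewrite -(ler_nat R) natrD natrM pmulrn abszE intr_norm.
    rewrite -[X in `|X|](addrK (re (ap A q i 0))) (le_trans (ler_normB _ _))// addrC.
    rewrite mulr1 in h; apply: lerD => //; move: r; rewrite reD reint => /le_trans; apply.
    by rewrite invf_le1 ?ler1n ?ltr0n// (leq_trans _ N3).
  have [|f hf] := @vec_of_surj m K (\col_i divz (p i 0) d).
    move=> i; have [dp ple] := hp i; rewrite mxE leq_divRL//.
    by have : (`|(p i 0%R %/ d)%Z| * d <= n * supnorm_int q + 1)%N;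
      first by rewrite -[X in (_ * X)%N]/`|d%:Z|%N -abszM divzK// dvdzE.
  exists f => //; split => //; rewrite (_ : Z f = p)//.
  apply/colP => i; rewrite mxE -hf mxE mulrC divzK//.
  by rewrite dvdzE; have [] := hp i.
- have B0 : (0 < (supnorm_int q * N) %/ 3)%N.
    by rewrite divn_gt0// (leq_trans N3)// leq_pmull.
  have E1 : (0 < E %/ d)%N by rewrite divn_gt0// dvdn_leq// dvdn_gcdr.
  set BE := ((supnorm_int q * N) %/ 3 * (E %/ d))%N.
  have BE0 : (0 < BE)%N by rewrite muln_gt0 B0.
  have BEp : (0 : R) < BE%:R ^+ m by rewrite exprn_gt0// ltr0n.
  pose x := (5 ^ (m * n))%N%:R * u / BE%:R ^+ m.
  have hG f : (mu (G f) <= x%:E)%E.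
    have := @strip_unit_le q N E (diag_int R S (Z f)) q0 N3 SE.
    rewrite -/d -/BE -/(G f) natrX => h.
    have : (((BE%:R ^+ m)^-1)%:E * ((BE%:R ^+ m)%:E * mu (G f)) <= x%:E)%E.
      by rewrite [x]mulrC EFinM; apply: lee_wpmul2l => //; rewrite lee_fin invr_ge0 ltW.
    by rewrite muleA -EFinM mulVf ?gt_eqF// mul1e.
  apply: (@le_trans _ _ (#|I|%:R%:E * x%:E)%E).
    apply: (measure_union_le (F := G)) => //; last by move=> X [f _ GX]; exists f.
    by apply: fin_bigcup_measurable => //; exact: finite_finset.
  rewrite -EFinM lee_fin card_mx card_ord muln1 /x.
  have u50 : 0 <= (5 ^ (m * n))%N%:R * u by rewrite mulr_ge0// ltW.
  have NEp : (0 : R) < (N * E)%:R by rewrite ltr0n muln_gt0 E0 (leq_trans _ N3).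
  rewrite -[leRHS]mulrA mulrCA [leRHS]mulrC ler_wpM2l// natrX -!expr_div_n.
  apply: lerXn2r; rewrite ?nnegrE ?divr_ge0//.
  rewrite ler_pdivlMr// mulrAC ler_pdivrMr ?ltr0n// -!natrM ler_nat.
  (* The constant 30 is 5 times 6: the 5 bounds the number of vectors [p], and the 6 compensates for
     the rounding in the quotient by 3. *)
  have K1 : ((2 * K + 1) * d <= 5 * n * supnorm_int q)%N.
    have := leq_trunc_div (n * supnorm_int q + 1) d; rewrite -/K => hK.
    have : (supnorm_int q <= n * supnorm_int q)%N by rewrite leq_pmull.
    by move: hK ds; rewrite mulnDl mul1n -mulnA -[(5 * n * _)%N]mulnA; lia.
  have B1 : (supnorm_int q * N <= 6 * ((supnorm_int q * N) %/ 3))%N.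
    move: B0; have := divn_eq (supnorm_int q * N) 3.
    have := ltn_pmod (supnorm_int q * N) (isT : (0 < 3)%N).
    set a := (_ %/ _)%N; set b := (_ %% _)%N; lia.
  have dE : (E = E %/ d * d)%N by rewrite divnK// dvdn_gcdr.
  rewrite -(leq_pmul2r s0) /BE {1}dE.
  apply: (@leq_trans (((2 * K + 1) * d) * (supnorm_int q * N) * (E %/ d))%N).
    by rewrite !mulnA; apply/eq_leq; ring.
  apply: (@leq_trans ((5 * n * supnorm_int q) * (6 * ((supnorm_int q * N) %/ 3)) * (E %/ d))%N).
    by rewrite leq_mul2r leq_mul ?orbT.
  by apply/eq_leq; ring.
Qed.

End Strip.

(** * Convergence *)

Section Condensation.
Variables (R : realType) (psi : nat -> R).
Hypothesis psi_ge0 : forall j, 0 <= psi j.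
Hypothesis psi_noninc : forall i j, (i <= j)%N -> psi j <= psi i.
Variable b : nat.
Hypothesis b_gt1 : (1 < b)%N.

(** Since b >= 2, the block after b^k up to b^(k+1) contains at least half of b^(k+1) terms, each at
    least [psi] at its right end; hence the factor 2. *)
Lemma condensation_le K : \sum_(k < K.+1) (b ^ k)%N%:R * psi (b ^ k)%N <=
  2 * \sum_(1 <= j < (b ^ K).+1) psi j.
Proof.
elim: K => [|K IH].
  by rewrite big_ord1 expn0 big_nat1 ler_wpM2r// ler_nat.
have bK : (b ^ K <= b ^ K.+1)%N by rewrite leq_exp2l.
rewrite big_ord_recr /= (@big_cat_nat _ _ _ (b ^ K).+1)//= mulrDr lerD//.
have h : ((b ^ K.+1).+1 - (b ^ K).+1)%N%:R * psi (b ^ K.+1)%N <=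
    \sum_((b ^ K).+1 <= j < (b ^ K.+1).+1) psi j.
  rewrite mulr_natl -sumr_const_nat; apply: ler_sum_nat => j /andP[_ jK].
  exact: psi_noninc.
apply: le_trans (ler_wpM2l _ h) => //; rewrite mulrA -natrM ler_wpM2r// ler_nat.
rewrite subSS; have : (2 * b ^ K <= b ^ K.+1)%N by rewrite expnS leq_mul2r b_gt1 orbT.
lia.
Qed.

Lemma condensation_ge K : \sum_(1 <= j < b ^ K) psi j <=
  \sum_(k < K) (b ^ k.+1)%N%:R * psi (b ^ k)%N.
Proof.
elim: K => [|K IH]; first by rewrite expn0 big_geq// big_ord0.
have bK : (b ^ K <= b ^ K.+1)%N by rewrite leq_exp2l.
have b0 k : (0 < b ^ k)%N by rewrite expn_gt0 (ltnW b_gt1).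
rewrite big_ord_recr /= (@big_cat_nat _ _ _ (b ^ K))//= lerD//.
apply: (@le_trans _ _ (\sum_(b ^ K <= j < b ^ K.+1) psi (b ^ K)%N)).
  by apply: ler_sum_nat => j /andP[jK _]; exact: psi_noninc.
rewrite sumr_const_nat -[leLHS]mulr_natl ler_wpM2r// ler_nat.
by rewrite leq_subr.
Qed.

End Condensation.

Section Convergence.
Variables (R : realType) (S : {fset place}).
Hypothesis S_infinite : infinite_place \in S.
Variables m n : nat.
Local Notation QS := (QS R S).
Local Notation T := 'M[QS]_(m, n).
Local Notation BT := (borel T).
Local Notation re := (@re R S S_infinite).
Local Notation v0 := (v0 S_infinite).
Local Notation unit_cell := (@unit_cell R S S_infinite m n).
Local Notation strip := (@strip R S S_infinite m n).
Local Notation l := #|` S|.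
Implicit Types (A X : T) (D E d k : nat) (q : 'cV[int]_n) (p : 'cV[int]_m).

Lemma Snorm_leP k (x : 'cV[QS]_k) (c : R) : 0 <= c ->
  Snorm x <= c <-> forall i v, absv (x i 0 v) <= c.
Proof.
move=> c0; split=> [h i v|h].
  apply: le_trans h; apply: le_trans (le_bigmax _ _ v).
  by rewrite /vnorm; apply: (le_bigmax _ (fun i => absv (x i 0 v)) i).
by apply: bigmax_le => // v _; apply: bigmax_le => // i _; exact: h.
Qed.

Lemma Snorm_ge0 k (x : 'cV[QS]_k) : 0 <= Snorm x.
Proof. exact: bigmax_ge_id. Qed.

Lemma card_places_gt0 : (0 < l)%N.
Proof. by rewrite cardfs_gt0; apply/fset0Pn; exists infinite_place. Qed.

Lemma strip_of_Snorm N q p A : (0 < N)%N ->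
  Snorm (diag_int R S p + ap A q) <= N%:R^-1 ->
  strip N%:R^-1 (smo S N) 1 q (diag_int R S p) A.
Proof.
have c0 : (0 : R) <= N%:R^-1 by rewrite invr_ge0.
move=> N0 /(Snorm_leP _ c0) h i; have {}h := h i; split.
  by have := h v0; rewrite mxE.
move=> v vf; rewrite mul1r; have := h v; rewrite mxE => /le_trans; apply.
exact: absv_smo_ge.
Qed.

(** [N] is the integer part of t^(-1/k), which is 0 when t > 1. *)
Lemma max_power (k : nat) (t : R) : (0 < k)%N -> 0 < t ->
  exists N, N%:R ^+ k * t <= 1 /\ 1 < N.+1%:R ^+ k * t.
Proof.
move=> k0 t0; pose P N := N%:R ^+ k * t <= 1.
have exP : exists N, P N by exists 0%N; rewrite /P expr0n gtn_eqF//= mul0r.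
have ub N : P N -> (N <= Num.trunc t^-1)%N.
  rewrite /P -ler_pdivlMr// mul1r => h.
  have : N%:R <= t^-1; last by rewrite truncn_ge_nat// ltW ?invr_gt0.
  apply: le_trans h; case: N => [|N]; first by rewrite expr0n gtn_eqF.
  by rewrite -natrX ler_nat -[leqLHS]expn1 leq_pexp2l.
case: (ex_maxnP exP ub) => N PN hN; exists N; split => //.
by rewrite ltNge; apply/negP => /hN; rewrite ltnn.
Qed.

Variable mu : {measure set BT -> \bar R}.
Hypothesis mu_inv : translation_invariant mu.
Variable u : R.
Hypothesis u_gt0 : 0 < u.
Hypothesis mu_unit : mu unit_cell = u%:E.
Hypotheses (m_gt0 : (0 < m)%N) (n_gt0 : (0 < n)%N).

(** With [N] the integer part of t^(-1/(lm)), the inequality implies a norm of at most 1/N, and (N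
    smo N)^m is of order 1/t. Sum [near_measure_le] over the O(Q^n) vectors [q]; the radius 2 Q
    makes the lemma apply to the dyadic block that starts at [Q]. *)
Lemma near_cover : exists2 C : R, 0 <= C & forall Q (t : R), (0 < Q)%N -> 0 < t ->
  exists V : set BT, [/\ measurable V,
    forall A q p, unit_cell A -> q != 0 -> (supnorm_int q <= 2 * Q)%N ->
      (Snorm (diag_int R S p + ap A q) ^+ l) ^+ m <= t -> V A &
    (mu V <= (C * (Q ^ n)%N%:R * t)%:E)%E].
Proof.
have l0 := card_places_gt0.
pose C2 : R := (5 ^ n)%N%:R * ((30 * n)%:R ^+ m * (5 ^ (m * n))%N%:R * u *
  ((Sprod S)%:R ^+ m * (2%:R ^+ (l * m)))).
have C20 : 0 <= C2 by rewrite !mulr_ge0 ?exprn_ge0// ltW.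
have C10 : 0 <= 3 ^+ (l * m) * u by rewrite mulr_ge0 ?exprn_ge0// ltW.
exists (3 ^+ (l * m) * u + C2); first by rewrite addr_ge0.
move=> Q t Q0 t0.
have Qn1 : 1 <= (Q ^ n)%N%:R :> R by rewrite ler1n expn_gt0 Q0.
have [N [N1 N2]] := max_power (ltac:(by rewrite muln_gt0 l0) : (0 < l * m)%N) t0.
(* If N <= 2 then t > 3^(-lm), and the whole unit cell is an admissible [V]. *)
have [N3|N3] := leqP N 2.
  exists unit_cell; split => //; first exact: measurable_unit_cell.
  rewrite mu_unit lee_fin mulrDl mulrDl -[leLHS]addr0 lerD//; last first.
    by rewrite !mulr_ge0// ltW.
  have -> : 3 ^+ (l * m) * u * (Q ^ n)%N%:R * t = u * ((Q ^ n)%N%:R * (3 ^+ (l * m) * t)).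
    by ring.
  rewrite ler_pMr// -[leLHS]mulr1 ler_pM// (le_trans (ltW N2))// ler_wpM2r ?(ltW t0)//.
  by rewrite lerXn2r ?nnegrE// ler_nat.
pose I : finType := 'cV['I_(2 * (2 * Q) + 1)]_n.
pose x := (30 * n)%:R ^+ m / (N * smo S N)%:R ^+ m * (5 ^ (m * n))%N%:R * u.
have x0 : 0 <= x by rewrite !mulr_ge0 ?invr_ge0 ?exprn_ge0// ltW.
have /choice[V hV] (f : I) : exists V : set BT, [/\ measurable V,
    vec_of f != 0 -> forall A p, unit_cell A ->
      Snorm (diag_int R S p + ap A (vec_of f)) <= N%:R^-1 -> V A & (mu V <= x%:E)%E].
  have [f0|f0] := eqVneq (vec_of f) 0.
    by exists set0; split => //; rewrite measure0 lee_fin.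
  have [V [mV _ hV muV]] := near_measure_le mu_inv u_gt0 mu_unit n_gt0
    f0 N3 (smo_Spi S_infinite N).
  exists V; split => // _ A p UA h; apply: (hV A p) => //.
  by apply: strip_of_Snorm => //; exact: ltnW (ltnW _).
exists (\bigcup_f V f).
have mV : measurable (\bigcup_f V f).
  by apply: fin_bigcup_measurable => [|f _]; [exact: finite_finset|case: (hV f)].
split => //.
  move=> A q p UA q0 qQ h.
  have [f qf] : exists f : I, q = vec_of f.
    by apply: vec_of_surj => i; apply: leq_trans qQ; exact: supnorm_le.
  exists f => //; have [_ + _] := hV f; rewrite -qf => /(_ q0 A p UA); apply.
  have Np : (0 : R) < N%:R by rewrite ltr0n (leq_trans _ N3).
  rewrite -div1r ler_pdivlMr// -(@expr_le1 _ (l * m)) ?muln_gt0 ?l0 ?mulr_ge0 ?Snorm_ge0//.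
  rewrite exprMn exprM (le_trans (ler_wpM2r _ h)) ?exprn_ge0//.
  by rewrite mulrC.
apply: (@le_trans _ _ (#|I|%:R%:E * x%:E)%E).
  apply: (measure_union_le (F := V)) => //; first by move=> f; case: (hV f).
  - by move=> X [f _ ?]; exists f.
  - by move=> f; case: (hV f).
rewrite -EFinM lee_fin card_mx card_ord muln1.
rewrite mulrDl mulrDl -[leLHS]add0r lerD//; first by rewrite !mulr_ge0// ltW.
have cI : ((2 * (2 * Q) + 1) ^ n)%N%:R <= (5 ^ n)%N%:R * (Q ^ n)%N%:R :> R.
  by rewrite -natrM ler_nat -expnMn leq_exp2r// mulnA (mulnDl 4 1) leq_add2l mul1n.
apply: le_trans (ler_wpM2r x0 cI) _.
pose c : R := (30 * n)%:R ^+ m * (5 ^ (m * n))%N%:R * u.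
have -> : C2 * (Q ^ n)%N%:R * t =
    (5 ^ n)%N%:R * (Q ^ n)%N%:R * (c * ((Sprod S)%:R ^+ m * (2 ^+ (l * m) * t))).
  by rewrite /C2 /c; ring.
have -> : x = c / (N * smo S N)%:R ^+ m by rewrite /x /c; ring.
have Np : (0 : R) < (N * smo S N)%:R ^+ m.
  by rewrite exprn_gt0// ltr0n muln_gt0 smo_gt0 (leq_trans _ N3).
(* From N + 1 <= 2 N, the maximality of [N], and N^(l-1) <= M smo N. *)
have h : 1 <= (N * smo S N)%:R ^+ m * ((Sprod S)%:R ^+ m * (2 ^+ (l * m) * t)).
  apply: le_trans (ltW N2) _; rewrite !mulrA ler_wpM2r ?(ltW t0)//.
  rewrite exprM [X in _ <= _ * X]exprM -!exprMn lerXn2r ?nnegrE ?exprn_ge0 ?mulr_ge0//.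
  rewrite -natrM -!natrX -natrM ler_nat.
  apply: (@leq_trans ((2 * N) ^ l)%N).
    by rewrite leq_exp2r// mul2n -addnn -addn1 leq_add2l (leq_trans _ N3).
  rewrite expnMn mulnC leq_mul2r; apply/orP; right.
  rewrite -{1}(prednK l0) expnS -mulnA leq_mul2l mulnC smo_ge//.
  by rewrite orbT.
rewrite ler_wpM2l// ler_wpM2l ?mulr_ge0 ?(ltW u_gt0)//.
by rewrite -div1r ler_pdivrMr// mulrC.
Qed.

Lemma geometric_half_le K : \sum_(k < K) (2%:R ^+ k)^-1 <= 2 :> R.
Proof.
suff -> : \sum_(k < K) (2%:R ^+ k)^-1 = 2 - 2 / 2%:R ^+ K :> R.
  by rewrite gerBl divr_ge0// exprn_ge0.
elim: K => [|K IH]; first by rewrite big_ord0 expr0 divr1 subrr.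
rewrite big_ord_recr /= IH exprS; field.
by rewrite expf_neq0.
Qed.

Lemma finite_supnorm_lt K : finite_set [set q : 'cV[int]_n | (supnorm_int q < K)%N].
Proof.
apply: (@sub_finite_set _ _ ((fun f : 'cV['I_(2 * K + 1)]_n => vec_of f) @` setT)).
  move=> q /= qK; have [f qf] := @vec_of_surj n K q
    (fun i => leq_trans (supnorm_le q i) (ltnW qK)).
  by exists f.
by apply: finite_image; exact: finite_finset.
Qed.

Lemma approximable_unit_negligible (psi : nat -> R) : (forall j, 0 <= psi j) ->
  (forall i j, (i <= j)%N -> psi j <= psi i) ->
  cvgn (fun k => \sum_(1 <= j < k) psi j) ->
  mu.-negligible (unit_cell `&` approximable psi : set BT).
Proof.
move=> psi_ge0 psi_noninc cv; have [C C0 hC] := near_cover.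
have b1 : (1 < 2 ^ n)%N by rewrite -{1}(expn0 2) ltn_exp2l.
pose b := (2 ^ n)%N.
(* [near_cover] requires a positive threshold while [psi] may vanish; the added term keeps the
   series of b^k t_k convergent. *)
pose t k : R := psi (b ^ k)%N + ((b ^ k)%N%:R ^+ 2)^-1.
have bk0 k : (0 < b ^ k)%N by rewrite expn_gt0 (ltnW b1).
have bkp k : (0 : R) < (b ^ k)%N%:R by rewrite ltr0n.
have t0 k : 0 < t k by rewrite ltr_wpDl// invr_gt0 exprn_gt0.
have /choice[V hV] k := hC (2 ^ k)%N (t k) (ltac:(by rewrite expn_gt0) : (0 < 2 ^ k)%N) (t0 k).
have mV k : measurable (V k) by case: (hV k).
exists (lim_sup_set V); split.
- by apply: bigcap_measurable => // k _; apply: bigcup_measurable.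
- apply: lim_sup_set_cvg0 => //.
  pose L := limn (fun k => \sum_(1 <= j < k) psi j).
  have hL k : \sum_(1 <= j < k) psi j <= L.
    apply: (@nondecreasing_cvgn_le _ (fun k => \sum_(1 <= j < k) psi j)) => //.
    apply/nondecreasing_seqP => j; case: j => [|j]; first by rewrite !big_geq.
    by rewrite [leRHS]big_nat_recr//= lerDl.
  apply: (@le_lt_trans _ _ (C * (2 * L + 2))%:E); last exact: ltry.
  apply: lime_le; first exact: is_cvg_nneseries.
  apply: nearW => K; rewrite big_mkord.
  apply: (@le_trans _ _ (\sum_(k < K) (C * ((b ^ k)%N%:R * t k))%:E)%E).
    apply: lee_sum => k _; have [_ _] := hV k.
    by rewrite -expnM mulnC expnM -/b mulrA.
  rewrite sumEFin lee_fin -mulr_sumr ler_wpM2l//.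
  apply: (@le_trans _ _ (\sum_(k < K.+1) (b ^ k)%N%:R * psi (b ^ k)%N +
     \sum_(k < K) (2%:R ^+ k)^-1)).
    rewrite (@le_trans _ _ (\sum_(k < K) (b ^ k)%N%:R * psi (b ^ k)%N +
     \sum_(k < K) (2%:R ^+ k)^-1))//; last first.
      by rewrite lerD2r [leRHS]big_ord_recr /= lerDl mulr_ge0.
    rewrite -big_split; apply: ler_sum => k _ /=; rewrite /t mulrDr lerD2l.
    rewrite expr2 invfM mulrA divff ?gt_eqF// mul1r lef_pV2 ?posrE ?exprn_gt0//.
    by rewrite -natrX ler_nat /b -expnM leq_exp2l// leq_pmull.
  apply: lerD; last exact: geometric_half_le.
  apply: le_trans (condensation_le psi_ge0 psi_noninc b1 K) _.
  by rewrite ler_wpM2l.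
- move=> A [UA apA] K _ /=; rewrite /bigcup /=.
  have [q qA qK] : exists2 q, [set q : 'cV[int]_n | exists p : 'cV[int]_m,
     (Snorm (diag_int R S p + A *m diag_int R S q) ^+ #|` S|) ^+ m
       <= psi (supnorm_int q ^ n)%N] q & (2 ^ K <= supnorm_int q)%N.
    apply: contrapT => h; apply: apA.
    apply: sub_finite_set (finite_supnorm_lt (2 ^ K)) => q hq /=.
    by rewrite ltnNge; apply/negP => qK; apply: h; exists q.
  have [p hp] := qA.
  have s0 : (0 < supnorm_int q)%N by apply: leq_trans qK; rewrite expn_gt0.
  have /andP[k1 k2] := trunc_log_bounds (isT : (1 < 2)%N) s0.
  set k := trunc_log 2 (supnorm_int q) in k1 k2.
  have Kk : (K <= k)%N by rewrite -ltnS -(ltn_exp2l _ _ (isT : (1 < 2)%N)) (leq_ltn_trans qK).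
  exists k => //; have [_ hk _] := hV k; apply: (hk A q p) => //.
  + apply: contraTneq s0 => ->; rewrite -leqNgt; apply/bigmax_leqP => i _.
    by rewrite mxE.
  + by rewrite -expnS ltnW.
  + apply: le_trans hp _; rewrite (@le_trans _ _ (psi (b ^ k)%N))//; last first.
      by rewrite lerDl invr_ge0 exprn_ge0.
    by apply: psi_noninc; rewrite /b -expnM mulnC expnM leq_exp2r.
Qed.

End Convergence.

(** * Passage from the unit cell to all matrices *)

Section Reduction.
Variables (R : realType) (S : {fset place}).
Hypothesis S_infinite : infinite_place \in S.
Variables m n : nat.
Local Notation QS := (QS R S).
Local Notation T := 'M[QS]_(m, n).
Local Notation BT := (borel T).
Local Notation re := (@re R S S_infinite).
Local Notation unit_cell := (@unit_cell R S S_infinite m n).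
Local Notation l := #|` S|.
Implicit Types (A X : T) (D E d k : nat) (q : 'cV[int]_n) (p : 'cV[int]_m).

Lemma shiftz1E (z : 'M[int]_(m, n)) i j : shiftz R S 1 z i j = (z i j)%:~R.
Proof.
by rewrite mxE invn1 mulr1.
Qed.

Lemma ap_shiftz (z : 'M[int]_(m, n)) X q :
  ap (shiftz R S 1 z + X) q = diag_int R S (z *m q) + ap X q.
Proof.
apply/colP => i; rewrite [RHS]mxE apD; congr (_ + _).
rewrite apE !mxE rmorph_sum; apply: eq_bigr => j _.
by rewrite shiftz1E rmorphM.
Qed.

Lemma ap_dil d A q i : ap (dil d A) q i 0 = d%:R * ap A q i 0.
Proof. by rewrite !apE big_distrr; apply: eq_bigr => j _; rewrite mxE [RHS]mulrA. Qed.

Lemma diag_intD k (p p' : 'cV[int]_k) :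
  diag_int R S (p + p') = diag_int R S p + diag_int R S p'.
Proof. by apply/colP => i; rewrite !mxE rmorphD. Qed.

Lemma approximable_periodic (psi : nat -> R) : zperiodic 1 (@approximable R S m n psi).
Proof.
suff h z X : approximable psi (shiftz R S 1 z + X) -> approximable psi X.
  move=> z X; split; first exact: h.
  have e : shiftz R S 1 (- z) + (shiftz R S 1 z + X) = X.
    by apply/matrixP => i j; rewrite !mxE !rmorphN mulNr addKr.
  by move=> a; apply: (h (- z)); rewrite e.
apply: contra_not; apply: sub_finite_set => q [p hp]; exists (p + z *m q).
move: hp; rewrite -/(ap _ _) ap_shiftz addrA -/(ap X q).
by rewrite diag_intD.
Qed.

Lemma bounded_denominator A : exists2 d, (0 < d)%N & forall i j, fin_le 1 (d%:R * A i j).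
Proof.
pose K := \max_(i < m) \max_(j < n) \max_(v : S) (Num.trunc (absv (A i j v))).+1.
exists (Sprod S ^ K)%N; first by rewrite expn_gt0 Sprod_gt0.
move=> i j v vf; rewrite QSM absvM QSnat.
have aK : absv (A i j v) <= 2 ^+ K.
  apply: (@le_trans _ _ K%:R); last by rewrite -natrX ler_nat ltnW// ltn_expl.
  have : ((Num.trunc (absv (A i j v))).+1 <= K)%N.
    apply: leq_trans (leq_bigmax i); apply: leq_trans (leq_bigmax j).
    exact: (leq_bigmax v).
  rewrite -(ler_nat R) => /(le_trans _); apply.
  by have /andP[_ /ltW] := truncn_itv (absv_ge0 (A i j v)).
have p2 : (2 <= place_prime (val v))%N by rewrite prime_gt1 ?place_prime_prime.
rewrite absv_nat// ?expn_gt0 ?Sprod_gt0// lognX logn_Sprod// muln1.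
rewrite mulrC ler_pdivrMr ?exprn_gt0// ?ltr0n ?place_prime_gt0//.
by rewrite absv1 mul1r (le_trans aK)// lerXn2r ?nnegrE// ler_nat.
Qed.

Variable mu : {measure set BT -> \bar R}.
Hypothesis mu_inv : translation_invariant mu.
Variable u : R.
Hypothesis u_gt0 : 0 < u.
Hypothesis mu_unit : mu unit_cell = u%:E.

(* Every matrix becomes integral at the finite places after multiplication by an
   integer, and is then an integer translate of a point of the unit cell. *)
Lemma negligible_of_dil (Q : set T) (P : nat -> set T) :
  (forall d, (0 < d)%N -> mu.-negligible (unit_cell `&` P d : set BT)) ->
  (forall d, zperiodic 1 (P d)) ->
  (forall A d, (0 < d)%N -> Q A -> P d (dil d A)) ->
  mu.-negligible (Q : set BT).
Proof.
move=> hP perP QP.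
have /choice[N hN] d : exists N : set BT, [/\ measurable N, mu N = 0%E &
    unit_cell `&` P d.+1 `<=` N] := hP d.+1 isT.
pose I : countType := (nat * 'M[int]_(m, n))%type.
pose F k : set BT := if (choice.unpickle k : option I) is Some (d, z) then
  dil d.+1 @^-1` ((fun X => shiftz R S 1 (- z) + X) @^-1` N d) else set0.
apply: (@negligibleS _ _ _ mu (\bigcup_k F k)); last first.
  apply: negligible_bigcup => k; rewrite /F.
  case: (choice.unpickle k) => [[d z]|]; last exact: negligible_set0.
  have [mN N0 _] := hN d.
  have mN' := measurable_shift (shiftz R S 1 (- z)) mN.
  apply/negligibleP; first exact: measurable_dil.
  have [c _ hc] := measure_dil mu_inv u_gt0 mu_unit (ltn0Sn d).
  by apply: (etrans (hc _ mN')); rewrite (mu_inv _ mN) N0 mule0.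
move=> A QA; have [[//|d] d0 hd] := bounded_denominator A.
pose z : 'M[int]_(m, n) := \matrix_(i, j) Num.floor (re (dil d.+1 A i j)).
exists (choice.pickle ((d, z) : I)) => //.
rewrite /F choice.pickleK; have [_ _] := hN d; apply; split.
  apply/unit_cellP => i j.
  have -> : (shiftz R S 1 (- z) + dil d.+1 A) i j = - (z i j)%:~R + dil d.+1 A i j.
    by rewrite mxE shiftz1E mxE rmorphN.
  rewrite reD reN reint [z i j]mxE; set x := re _.
  have /andP[x1 x2] := floor_itv x; split; [lra| |].
    by rewrite intrD in x2; lra.
  apply: fin_leD; first by apply: fin_leN; exact: fin_le_int1.
  by rewrite mxE.
by apply/perP; exact: QP.
Qed.

Lemma Snorm_natM_le d k (x : 'cV[QS]_k) : (0 < d)%N ->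
  Snorm (\col_i (d%:R * x i 0)) <= d%:R * Snorm x.
Proof.
move=> d0; apply/Snorm_leP; first by rewrite mulr_ge0 ?Snorm_ge0.
move=> i v; rewrite mxE QSM absvM ler_pM ?absv_ge0//; last first.
  by move: i v; apply/Snorm_leP => //; exact: Snorm_ge0.
rewrite QSnat; have [->|vf] := v0_or_finite S_infinite v.
  by rewrite /= normr_nat.
by rewrite pmulrn (le_trans (absv_int_le1 R vf _))// ler1n.
Qed.

Hypotheses (m_gt0 : (0 < m)%N) (n_gt0 : (0 < n)%N).

(** If [A] is approximable for [psi], then d A is approximable for d^(lm) psi with the same vectors
    [q] and with [p] multiplied by [d]; the constant does not affect convergence. *)
Theorem approximable_negligible (psi : nat -> R) : (forall j, 0 <= psi j) ->
  (forall i j, (i <= j)%N -> psi j <= psi i) ->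
  cvgn (fun k => \sum_(1 <= j < k) psi j) ->
  mu.-negligible (approximable psi : set BT).
Proof.
move=> psi_ge0 psi_noninc cv.
pose c d : R := (d%:R ^+ l) ^+ m.
have c0 d : 0 <= c d by rewrite !exprn_ge0.
apply: (@negligible_of_dil _ (fun d => approximable (fun j => c d * psi j))).
- move=> d d0; apply: (approximable_unit_negligible mu_inv u_gt0 mu_unit) => //.
  + by move=> j; rewrite mulr_ge0.
  + by move=> i j ij; rewrite ler_wpM2l// psi_noninc.
  + under eq_fun do rewrite -mulr_sumr.
    exact: is_cvgMr.
- by move=> d; exact: approximable_periodic.
move=> A d d0; apply: contra_not; apply: sub_finite_set => q [p hp].
exists (\col_i (d%:Z * p i 0)).
have -> : diag_int R S (\col_i (d%:Z * p i 0)) + dil d A *m diag_int R S q =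
    \col_i (d%:R * (diag_int R S p + ap A q) i 0).
  apply/colP => i; rewrite -/(ap _ _) -/(ap A q) [LHS]mxE ap_dil [RHS]mxE [in RHS]mxE mulrDr.
  by rewrite !mxE rmorphM.
apply: (@le_trans _ _ (((d%:R * Snorm (diag_int R S p + ap A q)) ^+ l) ^+ m)).
  rewrite lerXn2r ?nnegrE ?exprn_ge0 ?mulr_ge0 ?Snorm_ge0// lerXn2r ?nnegrE ?mulr_ge0 ?Snorm_ge0//.
  exact: Snorm_natM_le.
by rewrite !exprMn ler_wpM2l.
Qed.

End Reduction.

(** * Dirichlet's theorem *)

Section Dirichlet.
Variables (R : realType) (S : {fset place}).
Hypothesis S_infinite : infinite_place \in S.
Variables m n : nat.
Local Notation QS := (QS R S).
Local Notation T := 'M[QS]_(m, n).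
Local Notation BT := (borel T).
Local Notation re := (@re R S S_infinite).
Local Notation unit_cell := (@unit_cell R S S_infinite m n).
Local Notation strip := (@strip R S S_infinite m n).
Local Notation pr v := (place_prime (val v)).
Local Notation l := #|` S|.
Implicit Types (A X : T) (D E d k : nat) (q : 'cV[int]_n) (p : 'cV[int]_m).

Lemma apBr A q q' i : ap A (q - q') i 0 = ap A q i 0 - ap A q' i 0.
Proof.
rewrite !apE -sumrB; apply: eq_bigr => j _.
by rewrite mxE [(- q') j 0]mxE intrB mulrBr.
Qed.

Lemma box_index N (y : QS) : (0 < N)%N -> fin_le 1 y ->
  exists t : int * ('I_N * 'I_(smo S N)),
    Num.floor (N%:R * (re y - t.1%:~R)) = t.2.1 /\
    fin_le (smo S N) (y - t.1%:~R - t.2.2%:R).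
Proof.
move=> N0 y1; pose z := Num.floor (re y).
have /andP[z1 z2] := floor_itv (re y); rewrite -/z in z1 z2.
rewrite intrD in z2.
have [b bN hb] : exists2 d : nat, (d < N)%N & Num.floor (N%:R * (re y - z%:~R)) = d.
  by apply: floor_lt_nat => //; [rewrite subr_ge0|rewrite ltrBlDr addrC].
have y'1 : fin_le 1 (y - z%:~R) by apply: fin_leB => //; exact: fin_le_int1.
have [a aE ha] := fin_le_approx S_infinite (smo_gt0 S N) y'1.
by exists (z, (Ordinal bN, Ordinal aE)).
Qed.

(** Pigeonhole principle: the (Q + 1)^n vectors with entries in 0..Q fall into (N smo N)^m <= N^(lm)
    <= Q^n boxes, each given by a real digit and a residue modulo [smo S N]. The difference of two
    vectors in one box is the required [q]. *)
Lemma dirichlet N Q A : (0 < N)%N -> (N ^ (l * m) <= Q ^ n)%N -> (0 < n)%N ->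
  (forall i j, fin_le 1 (A i j)) ->
  exists q p, [/\ q != 0, (supnorm_int q <= Q)%N &
    strip N%:R^-1 (smo S N) 1 q (diag_int R S p) A].
Proof.
move=> N0 NQ n0 A1.
pose I : finType := 'cV['I_Q.+1]_n; pose J : finType := 'cV['I_N * 'I_(smo S N)]_m.
pose qv (f : I) : 'cV[int]_n := \col_j (f j 0 : nat)%:Z.
have /choice[g hg] (fi : I * 'I_m) : exists t : int * ('I_N * 'I_(smo S N)),
    Num.floor (N%:R * (re (ap A (qv fi.1) fi.2 0) - t.1%:~R)) = t.2.1 /\
    fin_le (smo S N) (ap A (qv fi.1) fi.2 0 - t.1%:~R - t.2.2%:R).
  by apply: box_index => //; exact: fin_le_ap.
pose G (f : I) : J := \col_i (g (f, i)).2.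
have : ~~ injectiveb G.
  apply/negP => /injectiveP /leq_card; rewrite !card_mx card_prod !card_ord !muln1 leqNgt.
  move/negP; apply; apply: (@leq_ltn_trans (N ^ (l * m))%N); last first.
    by rewrite (leq_ltn_trans NQ)// ltn_exp2r.
  have h : (N * smo S N <= N ^ l)%N.
    rewrite -[X in (_ <= N ^ X)%N](prednK (card_places_gt0 S_infinite)) expnS leq_mul2l.
    by rewrite (smo_le S_infinite)// orbT.
  by rewrite expnM; case: (posnP m) => [->|m0]; [rewrite !expn0|rewrite leq_exp2r].
move=> /injectivePn[f [f' ne eG]].
exists (qv f - qv f'), (\col_i ((g (f', i)).1 - (g (f, i)).1)); split.
- apply: contra_neq ne => e; apply/colP => j; apply: val_inj => /=.
  have := congr1 (fun M : 'cV[int]_n => M j 0) e; rewrite !mxE => /eqP.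
  by rewrite subr_eq0 eqz_nat => /eqP.
- apply/bigmax_leqP => j _; rewrite !mxE.
  have := ltn_ord (f j 0); have := ltn_ord (f' j 0).
  by set a := nat_of_ord _; set b := nat_of_ord _; lia.
move=> i; rewrite apBr [_ i 0]mxE [X in X%:~R + _]mxE.
have eg : (g (f, i)).2 = (g (f', i)).2.
  by have := congr1 (fun M : J => M i 0) eG; rewrite !mxE.
have [/= r1 f1] := hg (f, i); have [/= r2 f2] := hg (f', i).
move: r1 f1 r2 f2; rewrite eg; set y := ap A (qv f) i 0; set y' := ap A (qv f') i 0.
set z := (g (f, i)).1; set z' := (g (f', i)).1; set a := (g (f', i)).2 => r1 f1 r2 f2.
have -> : (z' - z)%:~R + (y - y') = (y - z%:~R) - (y' - z'%:~R) :> QS.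
  by rewrite intrB opprB [LHS]addrC addrACA [RHS]addrACA; congr (_ + _); exact: addrC.
split.
  rewrite !reB !reint; have /andP[u1 u2] := floor_itv (N%:R * (re y - z%:~R)).
  have /andP[w1 w2] := floor_itv (N%:R * (re y' - z'%:~R)).
  rewrite r1 intrD in u1 u2; rewrite r2 intrD in w1 w2.
  have Np : (0 : R) < N%:R by rewrite ltr0n.
  rewrite -div1r ler_pdivlMr// mulrC -[X in X * _]ger0_norm// -normrM ler_norml.
  by apply/andP; split; rewrite mulrBr; lra.
rewrite mul1r -[X in fin_le _ X](subrKA a.2%:R) opprB.
apply: fin_leD => //; rewrite -[z'%:~R - y']opprB -[a.2%:R - _]opprB.
exact: fin_leN.
Qed.

(* Neither short nor divisible by a high power of a prime of [S]. *)
Definition good_int c Q q : Prop := [/\ q != 0, (supnorm_int q <= Q)%N,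
  (Q <= 2 ^ c * supnorm_int q)%N &
  forall v : S, is_fin (val v) -> ~~ (pr v ^ c %| gcd_vec q)%N].

Lemma good_int_fin_le c Q q E (x : QS) : good_int c Q q ->
  fin_le E ((gcd_vec q)%:R * x) -> fin_le E ((Sprod S ^ c)%N%:R * x).
Proof.
move=> [q0 _ _ hq] h v vf; have g0 := gcd_vec_gt0 q0.
apply: le_trans (h v vf); rewrite !QSM !absvM ler_wpM2r ?absv_ge0// !QSnat.
rewrite !absv_nat// ?expn_gt0 ?Sprod_gt0// lognX logn_Sprod// muln1.
rewrite lef_pV2 ?posrE ?exprn_gt0 ?ltr0n ?place_prime_gt0//.
rewrite ler_eXn2l ?ltr1n ?prime_gt1 ?place_prime_prime// ltnW//.
by have := hq v vf; rewrite pfactor_dvdn ?place_prime_prime// -ltnNge.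
Qed.

(* The place [v0], for which [pr v = 1], accounts for the short vectors. *)
Lemma not_good_int c Q q : q != 0 -> (supnorm_int q <= Q)%N -> ~ good_int c Q q ->
  exists (v : S) (q' : 'cV[int]_n), (supnorm_int q' <= Q %/ 2 ^ c)%N /\
    forall j, q j 0 = (pr v ^ c)%N%:Z * q' j 0.
Proof.
move=> q0 qQ bad; have c0 : (0 < 2 ^ c)%N by rewrite expn_gt0.
have [h|h] := leqP Q (2 ^ c * supnorm_int q); last first.
  exists (v0 S_infinite), q; rewrite leq_divRL// mulnC ltnW//; split => // j.
  by rewrite exp1n mul1r.
have [v [vf dv]] : exists v : S, is_fin (val v) /\ (pr v ^ c %| gcd_vec q)%N.
  apply: contrapT => no; apply: bad; split => // v vf.
  by apply/negP => dv; apply: no; exists v.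
have p0 : (0 < pr v ^ c)%N by rewrite expn_gt0 place_prime_gt0.
have dq j : ((pr v ^ c)%N%:Z %| q j 0%R)%Z.
  by rewrite dvdzE/=; apply: dvdn_trans dv (gcd_vec_dvd q j).
exists v, (\col_j divz (q j 0%R) (pr v ^ c)%N); split; last first.
  by move=> j; rewrite mxE mulrC divzK.
apply/bigmax_leqP => j _; rewrite mxE leq_divRL//.
apply: (@leq_trans (`|divz (q j 0%R) (pr v ^ c)%N| * pr v ^ c)%N).
  rewrite leq_mul2l; apply/orP; right; have := place_prime_prime vf.
  by case: (c) => // c' /prime_gt1 p1; rewrite leq_exp2r.
rewrite -[X in (_ * X)%N]/`|(pr v ^ c)%N%:Z|%N -abszM divzK//.
by apply: leq_trans qQ; exact: supnorm_le.
Qed.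

Variable mu : {measure set BT -> \bar R}.
Hypothesis mu_inv : translation_invariant mu.
Variable u : R.
Hypothesis u_gt0 : 0 < u.
Hypothesis mu_unit : mu unit_cell = u%:E.
Hypotheses (m_gt0 : (0 < m)%N) (n_gt0 : (0 < n)%N).

(** An exceptional [q] is p_v^c times a vector of norm at most Q / 2^c, so there are few of them;
    the bound of [near_measure_le] is uniform in [q], hence applies to these despite their large
    common divisors. *)
Lemma bad_measure : exists c, forall N Q, (2 < N)%N -> (N ^ (l * m))%N = (Q ^ n)%N ->
  exists V : set BT, [/\ measurable V, (mu V <= (u / 2)%:E)%E &
    forall A, unit_cell A -> ~ V A -> exists q p, good_int c Q q /\
      strip N%:R^-1 (smo S N) 1 q (diag_int R S p) A].
Proof.
pose C := (#|{: S}| * 3 ^ n * ((30 * n) ^ m * 5 ^ (m * n) * Sprod S ^ m))%N.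
(* [C] collects the number of places, the count of vectors and the constants of [near_measure_le].
   The exceptional set then has measure at most C 2^(-cn) u, and 2^c > c = 2 C. *)
exists (2 * C)%N => N Q N3 NQ; set c := (2 * C)%N.
pose K := (Q %/ 2 ^ c)%N.
pose I : finType := (S * 'cV['I_(2 * K + 1)]_n)%type.
pose qv (f : I) : 'cV[int]_n := \col_j ((pr f.1 ^ c)%N%:Z * vec_of f.2 j 0).
pose y : R := (30 * n)%:R ^+ m / (N * smo S N)%:R ^+ m * (5 ^ (m * n))%N%:R * u.
have y0 : 0 <= y by rewrite !mulr_ge0 ?invr_ge0 ?exprn_ge0// ltW.
have /choice[V hV] (f : I) : exists V : set BT, [/\ measurable V,
    qv f != 0 -> forall A p, unit_cell A ->
      strip N%:R^-1 (smo S N) 1 (qv f) (diag_int R S p) A -> V A,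
    qv f = 0 -> V = set0 & (mu V <= y%:E)%E].
  have [f0|f0] := eqVneq (qv f) 0.
    by exists set0; split => //; rewrite measure0 lee_fin.
  have [V [mV _ hV muV]] := near_measure_le mu_inv u_gt0 mu_unit n_gt0
    f0 N3 (smo_Spi S_infinite N).
  by exists V; split => //; move/eqP; rewrite (negPf f0).
have cover A : unit_cell A -> (forall f, ~ V f A) ->
    exists q p, good_int c Q q /\ strip N%:R^-1 (smo S N) 1 q (diag_int R S p) A.
  move=> UA nV; have N0 : (0 < N)%N by rewrite (leq_trans _ N3).
  have A1 i j : fin_le 1 (A i j) by have [_ _ ?] := (unit_cellP _ _).1 UA i j.
  have [q [p [q0 qQ sA]]] := dirichlet N0 (eq_leq NQ) n_gt0 A1.
  exists q, p; split => //; apply: contrapT => /(not_good_int q0 qQ) [v [q' [q'K hq]]].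
  have [g hg] := @vec_of_surj n K q' (fun j => leq_trans (supnorm_le q' j) q'K).
  have qE : qv (v, g) = q by apply/colP => j; rewrite mxE /= -hg hq.
  by apply: (nV (v, g)); have [_ h _ _] := hV (v, g); apply: (h _ A p) => //; rewrite qE.
(* When Q < 2^c the reduced vector vanishes, so no nonzero [q] is exceptional. *)
have [K0|K0] := posnP K.
  exists set0; split; rewrite ?measure0 ?lee_fin ?divr_ge0 ?(ltW u_gt0)// => A UA _.
  apply: cover => // f; have [_ _ hf _] := hV f; rewrite hf//.
  apply/colP => j; rewrite !mxE; have := ltn_ord (f.2 j 0).
  move: (nat_of_ord _) (_ ^ c)%N => a b; rewrite K0.
  by case: a => // _; rewrite subrr mulr0.
exists (\bigcup_f V f).
have mV : measurable (\bigcup_f V f).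
  by apply: fin_bigcup_measurable => [|f _]; [exact: finite_finset|case: (hV f)].
split => //; last first.
  by move=> A UA nV; apply: cover => // f Vf; apply: nV; exists f.
apply: (@le_trans _ _ (#|I|%:R%:E * y%:E)%E).
  apply: (measure_union_le (F := V)) => //; first by move=> f; case: (hV f).
  - by move=> X [f _ ?]; exists f.
  - by move=> f; case: (hV f).
rewrite -EFinM lee_fin card_prod card_mx card_ord muln1 /y.
have h : (2 * (#|{: S}| * (2 * K + 1) ^ n * ((30 * n) ^ m * 5 ^ (m * n))) <=
    (N * smo S N) ^ m)%N.
  have Sm : (0 < Sprod S ^ m)%N by rewrite expn_gt0 Sprod_gt0.
  rewrite -(leq_pmul2r Sm); apply: (@leq_trans (2 * C * K ^ n)%N).
    have : ((2 * K + 1) ^ n <= 3 ^ n * K ^ n)%N.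
      by rewrite -expnMn leq_exp2r// (mulnDl 2 1) leq_add2l mul1n.
    move=> hK; apply: (@leq_trans (2 * (#|{: S}| * (3 ^ n * K ^ n) *
        ((30 * n) ^ m * 5 ^ (m * n))) * Sprod S ^ m)).
      by rewrite leq_mul2r leq_mul2l leq_mul2r leq_mul2l hK !orbT.
    by rewrite /C; apply: eq_leq; ring.
  apply: (@leq_trans ((2 ^ c * K) ^ n)%N).
    rewrite expnMn leq_mul2r; apply/orP; right; apply: leq_trans (ltnW (ltn_expl _ (isT : (1 < 2)%N))) _.
    by rewrite -[leqLHS]expn1 leq_pexp2l// expn_gt0.
  apply: (@leq_trans (Q ^ n)%N).
    by rewrite leq_exp2r// mulnC leq_trunc_div.
  rewrite -NQ expnM -expnMn leq_exp2r//.
  rewrite -(prednK (card_places_gt0 S_infinite)) expnS -mulnA leq_mul2l [X in (_ <= X)%N]mulnC.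
  by rewrite smo_ge ?orbT.
have Np : (0 : R) < (N * smo S N)%:R ^+ m.
  by rewrite exprn_gt0// ltr0n muln_gt0 smo_gt0 (leq_trans _ N3).
move: h; rewrite -(ler_nat R) natrX natrM => /(ler_wpM2r (ltW u_gt0)) h.
set a : R := (#|_| * _)%N%:R; set P : R := (N * _)%:R ^+ m.
have -> : a * ((30 * n)%:R ^+ m / P * (5 ^ (m * n))%N%:R * u) =
  (a * ((30 * n)%:R ^+ m * (5 ^ (m * n))%N%:R)) * u / P by ring.
rewrite ler_pdivrMr//; move: h; rewrite -/P.
by rewrite natrM -/a natrM natrX; lra.
Qed.

End Dirichlet.

(** * Second moment *)

Section Thick.
Variables (R : realType) (S : {fset place}).
Hypothesis S_infinite : infinite_place \in S.
Variables m n : nat.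
Local Notation QS := (QS R S).
Local Notation T := 'M[QS]_(m, n).
Local Notation BT := (borel T).
Local Notation re := (@re R S S_infinite).
Local Notation mkQS := (@mkQS R S).
Local Notation unit_cell := (@unit_cell R S S_infinite m n).
Local Notation cell := (@cell R S S_infinite m n).
Local Notation big_box := (@big_box R S S_infinite m n).
Local Notation strip := (@strip R S S_infinite m n).
Local Notation l := #|` S|.
Local Notation M := (Sprod S).
Implicit Types (A X : T) (D E d k : nat) (q : 'cV[int]_n) (p : 'cV[int]_m).

Variable mu : {measure set BT -> \bar R}.
Hypothesis mu_inv : translation_invariant mu.
Variable u : R.
Hypothesis u_gt0 : 0 < u.
Hypothesis mu_unit : mu unit_cell = u%:E.
Hypotheses (m_gt0 : (0 < m)%N) (n_gt0 : (0 < n)%N).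

Definition cellvol D E : R := u / ((D * E) ^ (m * n))%N%:R.

Lemma cellvol_ge0 D E : 0 <= cellvol D E.
Proof. by rewrite divr_ge0// ltW. Qed.

Lemma measure_cellvol D E A : (0 < D)%N -> (Spi S).-nat E ->
  mu (cell D E A) = (cellvol D E)%:E.
Proof.
move=> D0 SE; have E0 : (0 < E)%N by case/andP: SE.
have := measure_unit_cell S_infinite mu_inv D0 SE.
rewrite measure_cell// mu_unit => h.
have k0 : (0 : R) < ((D * E) ^ (m * n))%N%:R by rewrite ltr0n expn_gt0 muln_gt0 D0 E0.
by rewrite /cellvol mulrC EFinM h muleA -EFinM mulVf ?gt_eqF// mul1e.
Qed.

(** Refining the precision from 1/N to 1/(N r) multiplies [smo] by about r^(l-1), up to powers of M.
    The quotient by the gcd is the number of finite steps available in [strip_packing]. *)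
Lemma smo_ratio_ge c N r : (0 < N)%N ->
  (r ^ l.-1 <= smo S (N * r) %/ gcdn (M ^ c * smo S N) (smo S (N * r)) * M ^ c.+1)%N.
Proof.
move=> N0; set E := smo S (N * r); set g := gcdn _ _.
have E0 : (0 < E)%N := smo_gt0 S _.
have s0 := smo_gt0 S N; have M0 := Sprod_gt0 S.
have g0 : (0 < g)%N by rewrite gcdn_gt0 E0 orbT.
have gle : (g <= M ^ c * smo S N)%N by rewrite dvdn_leq ?dvdn_gcdl// muln_gt0 expn_gt0 M0.
have -> : (E %/ g * M ^ c.+1 = E %/ g * M ^ c * M)%N by rewrite expnSr mulnA.
rewrite -(leq_pmul2r s0).
apply: (@leq_trans ((N * r) ^ l.-1)%N).
  by rewrite expnMn mulnC leq_mul2r smo_le// orbT.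
apply: leq_trans (smo_ge S_infinite _) _.
have -> : (E %/ g * M ^ c * M * smo S N = M * (E %/ g * (M ^ c * smo S N)))%N by ring.
rewrite leq_mul2l -/E; apply/orP; right.
apply: (@leq_trans (E %/ g * g)%N); first by rewrite divnK// dvdn_gcdr.
by rewrite leq_mul2l gle orbT.
Qed.

(** Pack translates of the set into a slightly larger box: [r] real steps and about r^(l-1) residue
    classes for each of the [m] forms. Goodness of [q] bounds the displacement of the section at the
    real place and its denominator at the finite places. *)
Lemma thick_measure_le c W K : exists2 C : R, 0 < C & forall N Q r q A (y : 'cV[QS]_m),
  (0 < N)%N -> (0 < r)%N -> good_int S c Q q ->
  (mu (big_box K (N * Q) (smo S N) (M ^ c) A `&`
     strip (W.+1%:R / (N * r)%N%:R) (smo S (N * r)) (M ^ c) q y) <=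
   (C / (r ^ (l * m))%N%:R * cellvol (N * Q) (smo S N))%:E)%E.
Proof.
(* The real steps add up to at most 3 (W + 1) / N; divided by |q| >= Q / 2^c this is at most [K']
   units of 1/(N Q). *)
pose K' := (3 * W.+1 * 2 ^ c)%N.
pose Z := (((2 * (K + K') + 1) * M ^ c) ^ (m * n))%N.
have M0 := Sprod_gt0 S; have l0 := card_places_gt0 S_infinite.
have Z0 : (0 < Z)%N by rewrite expn_gt0 muln_gt0 expn_gt0 M0 addn1.
exists (Z * (M ^ c.+1) ^ m)%N%:R; first by rewrite ltr0n muln_gt0 Z0 !expn_gt0 M0.
move=> N Q r q A y N0 r0 gq; have [q0 qQ Qq _] := gq.
have Q0 : (0 < Q)%N := leq_trans (supnorm_gt0 q0) qQ.
have s0 := supnorm_gt0 q0; have E0 := smo_gt0 S N.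
have [sec [hsec hre hfin]] := @section_ap R S S_infinite m n q q0.
set E := smo S (N * r); have Ep : (0 < E)%N := smo_gt0 S _.
pose E1 := (E %/ gcdn (M ^ c * smo S N) E)%N.
have hE1 := smo_ratio_ge c r N0; rewrite -/E -/E1 in hE1.
have NQ0 : (0 < N * Q)%N by rewrite muln_gt0 N0.
have Mc0 : (0 < M ^ c)%N by rewrite expn_gt0 M0.
have Nrp : (0 : R) < (N * r)%:R by rewrite ltr0n muln_gt0 N0.
have := @strip_packing R S S_infinite m n mu mu_inv q sec y (W.+1%:R / (N * r)%:R)
  (3 * W.+1%:R / (N * r)%:R) E (M ^ c) (smo S N) r E1
  (big_box K (N * Q) (smo S N) (M ^ c) A `&`
     strip (W.+1%:R / (N * r)%N%:R) E (M ^ c) q y)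
  (big_box (K + K') (N * Q) (smo S N) (M ^ c) A) hsec.
have mbox K1 : measurable (big_box K1 (N * Q) (smo S N) (M ^ c) A : set BT).
  exact: measurable_big_box.
move=> /(_ (measurableI _ _ (mbox K) (measurable_strip _ _ _ _ _ _)) (mbox _)).
have -> : 0 <= W.+1%:R / (N * r)%:R :> R by rewrite divr_ge0.
have -> : 2 * (W.+1%:R / (N * r)%:R) < 3 * W.+1%:R / (N * r)%:R :> R.
  by rewrite mulrA ltr_pM2r ?invr_gt0// ltr_pM2r ?ltr0n// ltr_nat.
move=> /(_ isT isT) h.
have {}h : (((r * E1) ^ m)%N%:R%:E *
  mu (big_box K (N * Q) (smo S N) (M ^ c) A `&`
     strip (W.+1%:R / (N * r)%N%:R) E (M ^ c) q y) <=
  (Z%:R * cellvol (N * Q) (smo S N))%:E)%E.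
  apply: (@le_trans _ _ (mu (big_box (K + K') (N * Q) (smo S N) (M ^ c) A))); last first.
    have := measure_big_box S_infinite mu_inv (K + K') A NQ0 E0 Mc0.
    by rewrite (measure_cellvol _ NQ0 (smo_Spi S_infinite N)) -EFinM.
  apply: h; first by move=> X [].
    move=> k; rewrite pmulrn [X in _ * X]mulrC pmulrn -!intrM => hk.
    apply: dvdn_div_gcd => //.
    move: hk => /(fin_le_intP R _ (smo_Spi S_infinite (N * r))).
    by rewrite [X in (_ -> _ %| X)%N]mulnC -mulnA !abszM.
  move=> f X [hX _] i j; have [x0 x1] := hX i j.
  rewrite !mxE -addrA; set Y := \col_i _.
  split; last first.
    rewrite mulrDr; apply: fin_leD => //; apply: (good_int_fin_le S_infinite gq).
    apply: hfin; rewrite mxE.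
    apply: (@fin_le_eq _ _ _ ((f i 0).2%:R * (smo S N)%:R)).
      by move=> v vf; rewrite mkQS_fin.
    by rewrite mulrC; apply: fin_leM1; [exact: fin_le_nat|rewrite pmulrn; exact: fin_le_int1].
  rewrite reD (le_trans (ler_normD _ _))// natrD mulrDl [leRHS]addrC lerD//.
  rewrite (le_trans (hre _ _ _))// mxE re_mkQS ger0_norm; last first.
    by rewrite mulr_ge0 ?divr_ge0 ?mulr_ge0.
  rewrite ler_pdivrMr ?ltr0n//.
  have Np : (0 : R) < N%:R by rewrite ltr0n.
  have Qp : (0 : R) < Q%:R by rewrite ltr0n.
  have rp : (0 : R) < r%:R by rewrite ltr0n.
  apply: (@le_trans _ _ (3 * W.+1%:R / N%:R)).
    rewrite mulrA ler_pdivrMr//.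
    have -> : 3 * W.+1%:R / N%:R * (N * r)%:R = r%:R * (3 * W.+1%:R) :> R.
      by rewrite natrM; field; rewrite gt_eqF.
    by rewrite ler_wpM2r ?mulr_ge0// ler_nat ltnW.
  rewrite ler_pdivrMr//.
  rewrite /K'; have -> : (3 * W.+1 * 2 ^ c)%:R / (N * Q)%:R * (supnorm_int q)%:R * N%:R =
     (3 * W.+1 * 2 ^ c)%:R * (supnorm_int q)%:R / Q%:R :> R.
    by rewrite (natrM _ N); field; rewrite !gt_eqF.
  rewrite ler_pdivlMr// -!natrM ler_nat.
  by rewrite -[X in (_ <= X)%N]mulnA leq_mul2l Qq orbT.
have E1r : (r ^ (l * m) <= (r * E1) ^ m * (M ^ c.+1) ^ m)%N.
  rewrite expnM -expnMn leq_exp2r// -mulnA -(prednK l0) expnS leq_mul2l.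
  by rewrite hE1 orbT.
have rl0 : (0 < r ^ (l * m))%N by rewrite expn_gt0 r0.
have B0 : (0 < (r * E1) ^ m)%N.
  by move: E1r; rewrite lt0n; apply: contraTneq => ->; rewrite mul0n -ltnNge.
rewrite -lee_pdivlMl ?ltr0n// in h; apply: (le_trans h).
rewrite -EFinM lee_fin mulrA ler_wpM2r ?cellvol_ge0//.
rewrite ler_pdivlMr ?ltr0n// mulrAC natrM mulrC ler_wpM2l//.
by rewrite ler_pdivrMl ?ltr0n// -natrM ler_nat.
Qed.

(* Inside a neighbourhood of the cell of [A], the points at which [q] is an
   approximation [t] times better than the one given by Dirichlet's theorem. *)
Definition target c N Q t q (y : 'cV[QS]_m) A : set T :=
  big_box (n.+1 * 2 ^ c).+1 (N * Q) (smo S N) (M ^ c) A `&`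
  strip (N * t)%N%:R^-1 (M * smo S (N * t)) 1 q y.

Lemma measurable_target c N Q t q (y : 'cV[QS]_m) A :
  measurable (target c N Q t q y A : set BT).
Proof.
by apply: measurableI; [exact: measurable_big_box|exact: measurable_strip].
Qed.

Lemma floor_bound (x : R) (B : nat) : `|x| <= B%:R -> (`|(Num.floor x + B%:Z)%R| < 2 * B + 1)%N.
Proof.
rewrite ler_norml => /andP[x1 x2].
have h1 : - B%:Z <= Num.floor x by rewrite floor_ge_int rmorphN.
have h2 : Num.floor x < B%:Z + 1.
  by rewrite -(ltr_int R) intrD (le_lt_trans (floor_le_tmp x))// ltr_pwDr.
by move: h1 h2; lia.
Qed.

Lemma smo_ratio_le N t : (0 < N)%N -> (0 < t)%N ->
  (M * smo S (N * t) %/ smo S N <= M ^ 2 * t ^ l.-1)%N.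
Proof.
move=> N0 t0; have s0 := smo_gt0 S N.
have h : (M * smo S (N * t) <= M * (N * t) ^ l.-1)%N.
  by rewrite leq_mul2l (smo_le S_infinite) ?orbT// muln_gt0 N0.
apply: leq_trans (leq_div2r _ h) _.
rewrite -[X in (_ <= X)%N](mulnK _ s0) leq_div2r// expnMn.
rewrite mulnC -mulnA; apply: (@leq_trans ((M * smo S N) * (t ^ l.-1 * M))%N).
  by rewrite leq_mul2r (smo_ge S_infinite) orbT.
by apply: eq_leq; ring.
Qed.

(** Translates of the target along the section cover the cell of [A]. The values at [q] of the
    points of the cell are cut into real intervals of length 1/(N t) and into classes modulo
    [M * smo S (N * t)], which makes O(t^(lm)) pieces. *)
Lemma target_measure_ge c : exists2 C : R, 0 < C & forall N Q t q A (y : 'cV[QS]_m),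
  (0 < N)%N -> (0 < t)%N -> good_int S c Q q ->
  strip N%:R^-1 (smo S N) 1 q y A ->
  ((C / (t ^ (l * m))%N%:R * cellvol (N * Q) (smo S N))%:E <=
    mu (target c N Q t q y A))%E.
Proof.
have M0 := Sprod_gt0 S; have l0 := card_places_gt0 S_infinite.
pose Z := ((2 * n.+1 + 1) * M ^ 2)%N.
have Z0 : (0 < Z)%N by rewrite muln_gt0 addn1 expn_gt0 M0.
exists ((Z ^ m)%N%:R^-1); first by rewrite invr_gt0 ltr0n expn_gt0 Z0.
move=> N Q t q A y N0 t0 gq sA; have [q0 qQ Qq _] := gq.
have Q0 : (0 < Q)%N := leq_trans (supnorm_gt0 q0) qQ.
have s0 := supnorm_gt0 q0; have E0 := smo_gt0 S N.
have [sec [hsec hre hfin]] := @section_ap R S S_infinite m n q q0.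
have NQ0 : (0 < N * Q)%N by rewrite muln_gt0 N0.
have Np : (0 : R) < N%:R by rewrite ltr0n.
have Qp : (0 : R) < Q%:R by rewrite ltr0n.
have tp : (0 : R) < t%:R by rewrite ltr0n.
pose G := (M * smo S (N * t) %/ smo S N)%N.
have GE : (smo S N * G = M * smo S (N * t))%N.
  by rewrite mulnC divnK// dvdn_mull// smo_dvd// leq_pmulr.
have G0 : (0 < G)%N.
  by have := smo_gt0 S (N * t); rewrite -(ltn_pmul2l M0) muln0 -GE muln_gt0 => /andP[].
(* The value at [A] contributes 1/N, and moving inside the cell at most n |q| / (N Q) <= n / N; the
   sum (n + 1) / N is [B] units of 1/(N t). *)
pose B := (n.+1 * t)%N.
have NQp : (0 : R) < (N * Q)%:R by rewrite ltr0n.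
have Ntp : (0 : R) < (N * t)%:R by rewrite ltr0n muln_gt0 N0.
have cre X i j : cell (N * Q) (smo S N) A X ->
    `|re (X i j - A i j)| <= (N * Q)%:R^-1.
  exact: cell_re_le.
pose I : finType := 'cV[('I_(2 * B + 1) * 'I_G)%type]_m.
pose Y (f : I) : 'cV[QS]_m := \col_i mkQS (((f i 0).1%:R - B%:R) / (N * t)%:R)
  ((smo S N)%:R * (f i 0).2%:R).
have bnd (X : T) i : cell (N * Q) (smo S N) A X ->
    `|re (y i 0 + ap X q i 0)| <= n.+1%:R / N%:R /\ fin_le (smo S N) (y i 0 + ap X q i 0).
  move=> hX; have [ra fa] := sA i; rewrite mul1r in fa.
  have -> : y i 0 + ap X q i 0 = (y i 0 + ap A q i 0) + ap (X - A) q i 0.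
    by rewrite apB -addrA; congr (_ + _); rewrite addrC subrK.
  split; last first.
    apply: fin_leD => //; apply: fin_le_ap => i' j'; rewrite mxE [(- A) _ _]mxE.
    by have [] := hX i' j'.
  rewrite reD (le_trans (ler_normD _ _))// -natr1 mulrDl addrC mul1r lerD//.
  have h : `|re (ap (X - A) q i 0)| <= n%:R * (supnorm_int q)%:R * (N * Q)%:R^-1.
    by apply: re_ap_le => j; rewrite mxE [(- A) _ _]mxE; exact: cre.
  apply: le_trans h _; rewrite natrM invfM -mulrA ler_wpM2l//.
  rewrite [X in _ * X]mulrC mulrA -[leRHS]mul1r ler_wpM2r ?invr_ge0//.
  by rewrite ler_pdivrMr// mul1r ler_nat.
have := @covering R S m n mu mu_inv I (fun f => sec (Y f)) (target c N Q t q y A)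
  (cell (N * Q) (smo S N) A) (measurable_target _ _ _ _ _ _ _)
  (measurable_cell S_infinite _ _ NQ0).
move=> h; have {}h : (mu (cell (N * Q) (smo S N) A) <=
    #|I|%:R%:E * mu (target c N Q t q y A))%E.
  apply: h => X hX.
  have /choice[f hf] i : exists f : 'I_(2 * B + 1) * 'I_G,
      f.1%:R - B%:R = (Num.floor ((N * t)%:R * re (y i 0 + ap X q i 0)))%:~R :> R /\
      fin_le (M * smo S (N * t)) (y i 0 + ap X q i 0 - (smo S N)%:R * f.2%:R).
    have [br bf] := bnd X i hX; set x := y i 0 + ap X q i 0 in br bf *.
    have hB : `|(N * t)%:R * re x| <= B%:R.
      rewrite normrM ger0_norm// mulrC -ler_pdivlMr//; apply: le_trans br _.
      by rewrite /B !natrM; rewrite le_eqVlt; apply/orP; left; apply/eqP; field; rewrite !gt_eqF.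
    have [a aG ha] : exists2 a, (a < G)%N & fin_le G (invn R (smo S N) * x - a%:R).
      apply: (fin_le_approx S_infinite G0); apply/(@fin_le_pM R S _ _ _ E0).
      by rewrite muln1 mulr_invn.
    exists (Ordinal (floor_bound hB), Ordinal aG) => /=; split; last first.
      rewrite -GE; move: ha => /(@fin_le_pM R S _ _ _ E0).
      by rewrite mulrBr mulr_invn.
    rewrite natr_absz ger0_norm; first by rewrite intrD -pmulrn addrK.
    by rewrite -lerBlDr sub0r floor_ge_int rmorphN /=; move: hB; rewrite ler_norml => /andP[].
  exists (\col_i f i); set F := \col_i f i.
  have FE i : F i 0 = f i by rewrite mxE.
  have Yre i : `|re (Y F i 0)| <= n.+1%:R / N%:R.
    rewrite mxE re_mkQS FE normrM [X in _ * X]ger0_norm ?invr_ge0// ler_pdivrMr//.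
    have -> : n.+1%:R / N%:R * (N * t)%:R = B%:R :> R.
      by rewrite /B !natrM; field; rewrite gt_eqF.
    have : ((f i).1 <= 2 * B)%N by have := ltn_ord (f i).1; rewrite [X in (_ < X)%N]addn1.
    rewrite -(ler_nat R) natrM ler_norml => fB.
    by apply/andP; split; [rewrite -subr_ge0 opprK subrK|lra].
  have Yf i : fin_le (smo S N) (Y F i 0).
    rewrite mxE; apply: (@fin_le_eq _ _ _ ((smo S N)%:R * (F i 0).2%:R)).
      by move=> v vf; rewrite mkQS_fin.
    by apply: fin_leM1; [exact: fin_le_nat|rewrite pmulrn; exact: fin_le_int1].
  rewrite addrC; split.
    move=> i j; have [fl fX] := hX i j.
    have -> : (X - sec (Y F)) i j - A i j = (X i j - A i j) - sec (Y F) i j.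
      by rewrite mxE [(- sec _) _ _]mxE addrAC.
    split; last first.
      rewrite mulrBr; apply: fin_leB.
        by rewrite pmulrn mulrC; exact: fin_leMint.
      by apply: (good_int_fin_le S_infinite gq); exact: hfin.
    rewrite reB (le_trans (ler_normB _ _))// -natr1 mulrDl [leRHS]addrC lerD//.
      by rewrite mul1r; exact: cre.
    apply: le_trans (hre _ _ _) _; rewrite ler_pdivrMr ?ltr0n//.
    apply: le_trans (Yre i) _; rewrite ler_pdivrMr//.
    have -> : (n.+1 * 2 ^ c)%:R / (N * Q)%:R * (supnorm_int q)%:R * N%:R =
       n.+1%:R * (2 ^ c * supnorm_int q)%:R / Q%:R :> R.
      by rewrite !natrM; field; rewrite !gt_eqF.
    by rewrite ler_pdivlMr// ler_wpM2l// ler_nat.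
  move=> i; rewrite apB hsec addrA; have [fr ff] := hf i.
  set x := y i 0 + ap X q i 0 in fr ff *; split.
    rewrite reB mxE re_mkQS FE fr; have := floor_itv ((N * t)%:R * re x).
    rewrite intrD => /andP[u1 u2]; rewrite -[leRHS]div1r ler_pdivlMr// mulrC.
    rewrite -[X in X * _]ger0_norm// -normrM mulrBr [X in _ - X]mulrC divfK ?gt_eqF// ler_norml.
    by apply/andP; split; lra.
  rewrite mul1r; apply: fin_le_eq ff => v vf.
  by rewrite !QSB mxE mkQS_fin// FE.
rewrite (measure_cellvol _ NQ0 (smo_Spi S_infinite N)) in h.
have cI : (#|I| <= Z ^ m * t ^ (l * m))%N.
  rewrite card_mx card_prod !card_ord muln1 expnM -expnMn leq_exp2r//.
  apply: (@leq_trans (((2 * n.+1 + 1) * t) * (M ^ 2 * t ^ l.-1))%N).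
    apply: leq_mul; last exact: smo_ratio_le.
    by rewrite /B mulnDl mulnA leq_add2l mul1n.
  by rewrite mulnACA -/Z -expnS prednK.
have cp : (0 : R) < (Z ^ m * t ^ (l * m))%N%:R.
  by rewrite ltr0n muln_gt0 !expn_gt0 Z0 t0.
have {}h : ((cellvol (N * Q) (smo S N))%:E <=
   (Z ^ m * t ^ (l * m))%N%:R%:E * mu (target c N Q t q y A))%E.
  by apply: le_trans h _; apply: lee_wpmul2r => //; rewrite lee_fin ler_nat.
have -> : (Z ^ m)%:R^-1 / (t ^ (l * m))%:R * cellvol (N * Q) (smo S N) =
   (Z ^ m * t ^ (l * m))%N%:R^-1 * cellvol (N * Q) (smo S N) :> R.
  by rewrite (natrM _ (Z ^ m)) invfM.
by rewrite EFinM lee_pdivrMl.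
Qed.

End Thick.

Section SecondMoment.
Context d (T : measurableType d) (R : realType) (mu : {measure set T -> \bar R}).

Lemma integral_scaled_indic (A : set T) (c : R) : 0 <= c -> measurable A ->
  (\int[mu]_x (c * \1_A x)%:E = c%:E * mu A)%E.
Proof.
move=> c0 mA; under eq_integral do rewrite EFinM.
rewrite ge0_integralZl_EFin//.
  by rewrite integral_indic// setIT.
by apply/measurable_EFinP; exact: measurable_indic.
Qed.

(* Integrate the pointwise bound [2 c Z <= 1 + c^2 Z^2], valid where the
   multiplicity [Z] is positive. *)
Lemma second_moment (I : Type) (F : I -> set T) (s : seq I) (c : R) : 0 <= c ->
  (forall i, measurable (F i)) ->
  (\sum_(i <- s) (2 * c)%:E * mu (F i) <= mu (\big[setU/set0]_(i <- s) F i) +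
    \sum_(i <- s) \sum_(j <- s) (c ^+ 2)%:E * mu (F i `&` F j))%E.
Proof.
move=> c0 mF; set U := \big[setU/set0]_(i <- s) F i.
have mU : measurable U by apply: bigsetU_measurable.
have mind (A : set T) (k : R) : measurable A ->
    measurable_fun [set: T] (fun x => (k * \1_A x)%:E).
  by move=> mA; apply/measurable_EFinP; apply: measurable_funM => //; exact: measurable_indic.
have ind0 (A : set T) (k : R) x : 0 <= k -> (0 <= (k * \1_A x)%:E)%E.
  by move=> k0; rewrite lee_fin mulr_ge0.
have c20 : 0 <= 2 * c by rewrite mulr_ge0.
have cc0 : 0 <= c ^+ 2 by rewrite exprn_ge0.
have mFF i j : measurable (F i `&` F j) by apply: measurableI.
under eq_bigr do rewrite -integral_scaled_indic//.
rewrite -ge0_integral_sum//; [|by move=> i; exact: mind|by move=> i x _; exact: ind0].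
have -> : (\sum_(i <- s) \sum_(j <- s) (c ^+ 2)%:E * mu (F i `&` F j) =
    \int[mu]_x \sum_(i <- s) \sum_(j <- s) (c ^+ 2 * \1_(F i `&` F j) x)%:E)%E.
  rewrite ge0_integral_sum//; last first.
  - by move=> i x _; apply: sume_ge0 => j _; exact: ind0.
  - by move=> i; apply: emeasurable_sum => j; exact: mind.
  apply: eq_bigr => i _; rewrite ge0_integral_sum//.
  - by apply: eq_bigr => j _; rewrite integral_scaled_indic.
  - by move=> j; exact: mind.
  - by move=> j x _; exact: ind0.
rewrite -[mu U]mul1e -integral_scaled_indic// -ge0_integralD//; first last.
- by apply: emeasurable_sum => i; apply: emeasurable_sum => j; exact: mind.
- by move=> x _; apply: sume_ge0 => i _; apply: sume_ge0 => j _; exact: ind0.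
- exact: mind.
apply: ge0_le_integral => //.
- by move=> x _; apply: sume_ge0 => i _; exact: ind0.
- by apply: emeasurable_sum => i; exact: mind.
- apply: emeasurable_funD; first exact: mind.
  by apply: emeasurable_sum => i; apply: emeasurable_sum => j; exact: mind.
move=> x _; under [X in (_ <= _ + X)%E]eq_bigr do rewrite sumEFin.
rewrite !sumEFin -EFinD lee_fin.
rewrite -mulr_sumr; set Z := \sum_(i <- s) _.
have -> : \sum_(i <- s) \sum_(j <- s) (c ^+ 2 * \1_(F i `&` F j) x) = c ^+ 2 * Z ^+ 2.
  rewrite [Z ^+ 2]expr2 /Z big_distrlr mulr_sumr; apply: eq_bigr => i _ /=.
  by rewrite mulr_sumr; apply: eq_bigr => j _; rewrite indicI.
have [xU|xU] := pselect (U x).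
  rewrite (_ : \1_U x = 1); last by rewrite indicE mem_set.
  by have := sqr_ge0 (1 - c * Z); rewrite sqrrB; lra.
rewrite (_ : Z = 0) ?expr0n ?mulr0 ?addr0 ?mulr_ge0//.
rewrite /Z; have : ~ (\big[setU/set0]_(i <- s) F i) x by [].
elim: (s) => [|i s' IH]; first by rewrite !big_nil.
rewrite !big_cons => nx; rewrite IH; last by move=> h; apply: nx; right.
by rewrite addr0 indicE memNset// => h; apply: nx; left.
Qed.

Variables (x : nat -> R) (alpha beta x0 : R).
Hypotheses (x_ge0 : forall k, 0 <= x k) (alpha_gt0 : 0 < alpha) (beta_gt0 : 0 < beta).
Hypothesis x0_gt0 : 0 < x0.

Lemma sum_geometric_window (s : seq nat) k : uniq s ->
  \sum_(j <- s | (j <= k)%N) (2%:R ^+ (k - j))^-1 <= 2 :> R.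
Proof.
move=> us; apply: le_trans (@geometric_half_le R k.+1).
rewrite (reindex_inj rev_ord_inj) /=.
under [leRHS]eq_bigr do rewrite subSS.
rewrite -(big_mkord xpredT (fun j => (2%:R ^+ (k - j))^-1)).
rewrite -big_filter; apply: (@le_trans _ _ (\sum_(j <- index_iota 0 k.+1 |
    j \in [seq j <- s | (j <= k)%N]) (2%:R ^+ (k - j))^-1)).
  rewrite -[leRHS]big_filter; rewrite le_eqVlt; apply/orP; left; apply/eqP.
  apply: perm_big; apply: uniq_perm.
  - exact: filter_uniq.
  - by apply: filter_uniq; exact: iota_uniq.
  move=> j; rewrite !mem_filter mem_index_iota ltnS /=.
  by case: (j <= k)%N; case: (j \in s).
rewrite big_mkcond /=; apply: ler_sum => j _.
by case: ifP => // _; rewrite invr_ge0 exprn_ge0.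
Qed.

Lemma second_moment_levels : exists2 delta : R, 0 < delta &
  forall (I : nat -> finType) (F : forall k, I k -> set T) (a b : nat),
  (forall k i, measurable (F k i)) ->
  (forall k, (a <= k)%N -> ((alpha * x k)%:E <= \sum_(i : I k) mu (F k i))%E) ->
  (forall j k, (a <= j)%N -> (j <= k)%N ->
    (\sum_(i : I j) \sum_(i' : I k) mu (F j i `&` F k i') <=
      (beta * (x k * (x j + (2%:R ^+ (k - j))^-1)))%:E)%E) ->
  x0 <= \sum_(a <= k < b) x k ->
  (delta%:E <= mu (\bigcup_(k in [set k | (a <= k)%N]) \bigcup_(i : I k) F k i))%E.
Proof.
pose B := beta * (1 + 4 / x0).
have B0 : 0 < B by rewrite mulr_gt0// addr_gt0// divr_gt0.
exists (alpha ^+ 2 / B); first by rewrite divr_gt0// exprn_gt0.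
move=> I F a b mF hlow hpair; set X := \sum_(a <= k < b) x k => X0.
have Xp : 0 < X := lt_le_trans x0_gt0 X0.
(* The value that maximizes 2 c alpha X - c^2 B X^2. *)
pose c := alpha / (B * X).
have c0 : 0 < c by rewrite divr_gt0// mulr_gt0.
pose J : Type := {k : nat & I k}.
pose G (ki : J) : set T := F (tag ki) (tagged ki).
pose s : seq J := [seq Tagged I i | k <- index_iota a b, i <- index_enum (I k)].
have := second_moment s (ltW c0) (fun ki : J => mF (tag ki) (tagged ki) : measurable (G ki)).
have mGG i j k i' : (0 <= mu (F i j `&` F k i'))%E by [].
have -> : (\sum_(i <- s) (2 * c)%:E * mu (G i) =
    \sum_(a <= k < b) (2 * c)%:E * \sum_(i : I k) mu (F k i))%E.
  by rewrite big_allpairs_dep; apply: eq_bigr => k _; rewrite ge0_sume_distrr.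
have -> : (\sum_(i <- s) \sum_(j <- s) (c ^+ 2)%:E * mu (G i `&` G j) =
    (c ^+ 2)%:E * \sum_(a <= j < b) \sum_(a <= k < b)
      \sum_(i : I j) \sum_(i' : I k) mu (F j i `&` F k i'))%E.
  rewrite big_allpairs_dep ge0_sume_distrr; last first.
    by move=> j _; do 3![apply: sume_ge0 => ? _].
  apply: eq_bigr => j _; under eq_bigr do rewrite big_allpairs_dep.
  rewrite exchange_big ge0_sume_distrr; last by move=> k _; do 2![apply: sume_ge0 => ? _].
  apply: eq_bigr => k _; rewrite ge0_sume_distrr; last by move=> i _; apply: sume_ge0.
  by apply: eq_bigr => i _; rewrite ge0_sume_distrr.
have hU : (mu (\big[setU/set0]_(i <- s) G i) <=
    mu (\bigcup_(k in [set k | (a <= k)%N]) \bigcup_(i : I k) F k i))%E.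
  apply: le_measure; rewrite ?inE.
  - by apply: bigsetU_measurable => i _; exact: mF.
  - apply: bigcup_measurable => k _.
    by apply: fin_bigcup_measurable => //; exact: finite_finset.
  rewrite big_allpairs_dep big_nat; elim/big_ind: _ => //.
    by move=> A B' hA hB y [/hA|/hB].
  move=> k /andP[ak _]; elim/big_ind: _ => //.
    by move=> A B' hA hB y [/hA|/hB].
  by move=> i _ y Fy; exists k => //; exists i.
(* Vanishing for j > k, so that one bound symmetric in [j] and [k] holds for all pairs. *)
pose g j k : R := if (j <= k)%N then (2%:R ^+ (k - j))^-1 else 0.
have g0 j k : 0 <= g j k by rewrite /g; case: ifP => // _; rewrite invr_ge0 exprn_ge0.
have hall j k : (a <= j)%N -> (a <= k)%N ->
    (\sum_(i : I j) \sum_(i' : I k) mu (F j i `&` F k i') <=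
      (beta * (x j * x k + x k * g j k + x j * g k j))%:E)%E.
  wlog jk : j k / (j <= k)%N.
    move=> W; case: (leqP j k) => [|/ltnW kj] aj ak; first by move=> jk; exact: W.
    rewrite exchange_big /=.
    under eq_bigr do under eq_bigr do rewrite setIC.
    apply: le_trans (W _ _ kj ak aj) _.
    by rewrite lee_fin ler_wpM2l ?(ltW beta_gt0)// (mulrC (x k)) addrAC.
  move=> aj ak; apply: le_trans (hpair _ _ aj jk) _; rewrite lee_fin ler_wpM2l ?(ltW beta_gt0)//.
  have := mulr_ge0 (x_ge0 j) (g0 k j); have : g j k = (2%:R ^+ (k - j))^-1 by rewrite /g jk.
  by move=> ->; rewrite mulrDr (mulrC (x k) (x j)); lra.
have gsum k : \sum_(a <= j < b) g j k <= 2.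
  by rewrite -big_mkcond; apply: sum_geometric_window; exact: iota_uniq.
have lowX : ((2 * c * (alpha * X))%:E <=
    \sum_(a <= k < b) (2 * c)%:E * \sum_(i : I k) mu (F k i))%E.
  rewrite /X !mulr_sumr -sumEFin big_nat [leRHS]big_nat; apply: lee_sum => k /andP[ak _].
  by rewrite EFinM; apply: lee_wpmul2l; [rewrite lee_fin mulr_ge0// ltW|exact: hlow].
have upX : (\sum_(a <= j < b) \sum_(a <= k < b)
      \sum_(i : I j) \sum_(i' : I k) mu (F j i `&` F k i') <= (B * X ^+ 2)%:E)%E.
  apply: (@le_trans _ _ (\sum_(a <= j < b) \sum_(a <= k < b)
      (beta * (x j * x k + x k * g j k + x j * g k j))%:E)%E).
    rewrite big_nat [leRHS]big_nat; apply: lee_sum => j /andP[aj _].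
    by rewrite big_nat [leRHS]big_nat; apply: lee_sum => k /andP[ak _]; exact: hall.
  under eq_bigr do rewrite sumEFin; rewrite sumEFin lee_fin.
  under eq_bigr do rewrite -mulr_sumr; rewrite -mulr_sumr /B -mulrA ler_wpM2l ?(ltW beta_gt0)//.
  under eq_bigr do rewrite !big_split /=; rewrite !big_split /=.
  have -> : \sum_(a <= i < b) \sum_(a <= j < b) x i * x j = X ^+ 2.
    by rewrite expr2 big_distrlr.
  have e : \sum_(a <= j < b) \sum_(a <= k < b) x j * g k j <= 2 * X.
    rewrite mulr_sumr; apply: ler_sum => j _; rewrite -mulr_sumr mulrC ler_wpM2r//.
  rewrite [X in _ + X + _]exchange_big /= .
  have : X <= X ^+ 2 / x0 by rewrite ler_pdivlMr// expr2 ler_pM2l.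
  rewrite mulrDl mul1r mulrAC -mulrA; move: e; set y := \sum_(a <= j < b) _.
  by set z := X ^+ 2 / x0; lra.
move=> /(le_trans lowX) h.
have {}h : ((2 * c * (alpha * X))%:E <= mu (\bigcup_(k in [set k | (a <= k)%N])
    \bigcup_(i : I k) F k i) + (c ^+ 2 * (B * X ^+ 2))%:E)%E.
  apply: le_trans h _; apply: leeD => //.
  by rewrite [leRHS]EFinM; apply: lee_wpmul2l => //; rewrite lee_fin exprn_ge0// ltW.
have -> : alpha ^+ 2 / B = 2 * c * (alpha * X) - c ^+ 2 * (B * X ^+ 2).
  by rewrite /c; field; rewrite !gt_eqF.
by rewrite EFinB leeBlDr.
Qed.

End SecondMoment.

(** * The levels and their limsup set *)

Section Levels.
Variables (R : realType) (S : {fset place}).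
Hypothesis S_infinite : infinite_place \in S.
Variables m n : nat.
Local Notation QS := (QS R S).
Local Notation T := 'M[QS]_(m, n).
Local Notation BT := (borel T).
Local Notation re := (@re R S S_infinite).
Local Notation unit_cell := (@unit_cell R S S_infinite m n).
Local Notation cell := (@cell R S S_infinite m n).
Local Notation big_box := (@big_box R S S_infinite m n).
Local Notation strip := (@strip R S S_infinite m n).
Local Notation target := (@target R S S_infinite m n).
Local Notation l := #|` S|.
Local Notation M := (Sprod S).
Implicit Types (A X : T) (D E d k : nat) (q : 'cV[int]_n) (p : 'cV[int]_m).

Variable mu : {measure set BT -> \bar R}.
Hypothesis mu_inv : translation_invariant mu.
Variable u : R.
Hypothesis u_gt0 : 0 < u.
Hypothesis mu_unit : mu unit_cell = u%:E.
Hypotheses (m_gt0 : (0 < m)%N) (n_gt0 : (0 < n)%N).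
Local Notation cellvol := (cellvol m n u).

Lemma cell_sub_unit D E A : (0 < D)%N -> (0 < E)%N -> unit_cell A ->
  cell D E A `<=` unit_cell.
Proof.
move=> D0 E0 UA X hX; rewrite /unit_cell (cell_eq UA) => i j; have [fl fX] := hX i j.
rewrite !mul1r; split; first exact: floor_natM_inj fl.
by apply: fin_le_dvd fX => //; exact: dvd1n.
Qed.

(** Keep the cells that contain a point with a good approximation, and choose such a point in each.
    Together with the exceptional set, of measure at most u / 2, they cover the unit cell. *)
Lemma good_cells : exists c, forall N Q, (2 < N)%N -> (N ^ (l * m))%N = (Q ^ n)%N ->
  exists (I : finType) (A : I -> T) (q : I -> 'cV[int]_n) (p : I -> 'cV[int]_m),
  [/\ forall i, [/\ unit_cell (A i), good_int S c Q (q i) &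
        strip N%:R^-1 (smo S N) 1 (q i) (diag_int R S (p i)) (A i)],
      forall i j X, cell (N * Q) (smo S N) (A i) X -> cell (N * Q) (smo S N) (A j) X -> i = j &
      u / 2 <= #|I|%:R * cellvol (N * Q) (smo S N)].
Proof.
have [c hc] := bad_measure mu_inv u_gt0 mu_unit m_gt0 n_gt0.
exists c => N Q N3 NQ; have [V [mV muV hV]] := hc N Q N3 NQ.
have N0 : (0 < N)%N by rewrite (leq_trans _ N3).
have Q0 : (0 < Q)%N.
  by have : (0 < Q ^ n)%N by [rewrite -NQ expn_gt0 N0]; rewrite expn_gt0 -[n == 0%N]negbK -lt0n n_gt0 orbF.
have D0 : (0 < N * Q)%N by rewrite muln_gt0 N0.
have [J [h [_ hcov hsub hdis]]] :=
  @unit_cell_partition R S S_infinite m n _ _ D0 (smo_Spi S_infinite N).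
pose good (j : J) (w : T * ('cV[int]_n * 'cV[int]_m)) :=
  cell (N * Q) (smo S N) (h j) w.1 /\ good_int S c Q w.2.1 /\
  strip N%:R^-1 (smo S N) 1 w.2.1 (diag_int R S w.2.2) w.1.
pose I : finType := {j : J | `[< exists w, good j w >]}.
have /choice[w hw] (i : I) : exists w, good (val i) w by apply/asboolP; exact: (valP i).
exists I, (fun i => (w i).1), (fun i => (w i).2.1), (fun i => (w i).2.2).
have cw i : cell (N * Q) (smo S N) (w i).1 = cell (N * Q) (smo S N) (h (val i)).
  by have [hi _] := hw i; rewrite (cell_eq hi).
split.
- by move=> i; have [hi [gi si]] := hw i; split => //; exact: hsub hi.
- by move=> i j X; rewrite !cw => hi hj; apply: val_inj; exact: hdis hi hj.
pose F (i : I) : set BT := cell (N * Q) (smo S N) (w i).1.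
have mF i : measurable (F i) by exact: measurable_cell.
have mU : measurable (\bigcup_i F i).
  by apply: fin_bigcup_measurable => //; exact: finite_finset.
have UV : unit_cell `<=` V `|` \bigcup_i F i.
  move=> A UA; have [VA|nVA] := pselect (V A); first by left.
  right; have [q [p [gq sA]]] := hV A UA nVA; have [j hj] := hcov A UA.
  have gj : `[< exists w, good j w >] by apply/asboolP; exists (A, (q, p)).
  by exists (exist _ j gj : I) => //; rewrite /F cw.
have h1 : (u%:E <= (u / 2)%:E + (#|I|%:R * cellvol (N * Q) (smo S N))%:E)%E.
  rewrite -mu_unit; apply: (@le_trans _ _ (mu (V `|` \bigcup_i F i))).
    apply: le_measure; rewrite ?inE//; first exact: measurable_unit_cell.
    exact: measurableU.
  apply: le_trans (measureU2 _ _ _) _ => //; apply: leeD => //.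
  rewrite EFinM; apply: (measure_union_le (F := F)) => //; first by move=> X [i _ ?]; exists i.
  by move=> i; rewrite /F (measure_cellvol mu_inv mu_unit)//; exact: smo_Spi.
by move: h1; rewrite -EFinD lee_fin; lra.
Qed.

(* If two targets meet, the cell of the second one lies in a thickening of the
   first one; since these cells are disjoint, [thick_measure_le] bounds their number. *)
Lemma pair_bound c : exists2 C : R, 0 < C &
  forall N Q t r r0 Q' t' q (y : 'cV[QS]_m) A (I : finType) (q' : I -> 'cV[int]_n)
    (y' : I -> 'cV[QS]_m) (A' : I -> T),
  (0 < N)%N -> (0 < r)%N -> (r <= t)%N -> (r <= r0)%N -> (0 < t')%N -> (Q <= Q')%N ->
  good_int S c Q q -> (forall i, good_int S c Q' (q' i)) ->
  (forall i j X, cell (N * r0 * Q') (smo S (N * r0)) (A' i) X ->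
     cell (N * r0 * Q') (smo S (N * r0)) (A' j) X -> i = j) ->
  (\sum_i mu (target c N Q t q y A `&` target c (N * r0) Q' t' (q' i) (y' i) (A' i)) <=
    (C / (t' ^ (l * m))%N%:R / (r ^ (l * m))%N%:R * cellvol (N * Q) (smo S N))%:E)%E.
Proof.
pose K := (n.+1 * 2 ^ c).+1.
have [C1 C10 h1] := thick_measure_le mu_inv u_gt0 mu_unit m_gt0 c 0 K.
have [C2 C20 h2] := thick_measure_le mu_inv u_gt0 mu_unit m_gt0 c (n * K.+1) (2 * K).+1.
exists (C1 * C2); first exact: mulr_gt0.
move=> N Q t r r0 Q' t' q y A I q' y' A' N0 r0' rt rr0 t'0 QQ' gq gq' dis.
have r00 : (0 < r0)%N := leq_trans r0' rr0.
have N'0 : (0 < N * r0)%N by rewrite muln_gt0 N0.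
have [q0 qQ Qq _] := gq; have Q0 : (0 < Q)%N := leq_trans (supnorm_gt0 q0) qQ.
have Q'0 := leq_trans Q0 QQ'.
have D'0 : (0 < N * r0 * Q')%N by rewrite muln_gt0 N'0.
pose Th : set BT := big_box (2 * K).+1 (N * Q) (smo S N) (M ^ c) A `&`
  strip ((n * K.+1).+1%:R / (N * r)%:R) (smo S (N * r)) (M ^ c) q y.
have mTh : measurable Th.
  by apply: measurableI; [exact: measurable_big_box|exact: measurable_strip].
pose F i := target c N Q t q y A `&` target c (N * r0) Q' t' (q' i) (y' i) (A' i).
pose P : pred I := fun i => `[< exists X, F i X >].
have cellTh i : P i -> cell (N * r0 * Q') (smo S (N * r0)) (A' i) `<=` Th.
  (* [X] lies in both targets and [X'] in the cell of the second one. Their real parts differ by at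
     most (K + 1) / (N r0 Q') in each entry, which changes the value at [q] by at most n (K + 1) /
     (N r). *)
  move=> /asboolP[X [[bX sX] [bX' sX']]] X' hX'.
  have NQp : (0 : R) < (N * Q)%:R by rewrite ltr0n muln_gt0 N0.
  have D'p : (0 : R) < (N * r0 * Q')%:R by rewrite ltr0n.
  have Np : (0 : R) < N%:R by rewrite ltr0n.
  have rp : (0 : R) < r%:R by rewrite ltr0n.
  have EE : (smo S N %| smo S (N * r0))%N by apply: smo_dvd; rewrite leq_pmulr.
  have cX (j : 'I_m) (k : 'I_n) : `|re (X' j k - X j k)| <= K.+1%:R / (N * r0 * Q')%:R /\
      fin_le (smo S (N * r0)) ((M ^ c)%N%:R * (X' j k - X j k)).
    have -> : X' j k - X j k = (X' j k - A' i j k) - (X j k - A' i j k).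
      by rewrite opprB subrKA.
    have [br bf] := bX' j k; have [_ cf] := hX' j k; split.
      rewrite reB (le_trans (ler_normB _ _))// -natr1 mulrDl addrC lerD// mul1r.
      by apply: cell_re_le hX'.
    rewrite mulrBr; apply: fin_leB => //.
    by rewrite pmulrn mulrC; exact: fin_leMint.
  split.
    move=> j k; have [c1 c2] := cX j k; have [b1 b2] := bX j k.
    have -> : X' j k - A j k = (X' j k - X j k) + (X j k - A j k) by rewrite addrA subrK.
    split; last first.
      rewrite mulrDr; apply: fin_leD => //; apply: (fin_le_dvd _ EE) c2.
      exact: smo_gt0.
    rewrite reD (le_trans (ler_normD _ _))//.
    have -> : (2 * K).+1 = (K.+1 + K)%N by rewrite mul2n -addnn.
    rewrite natrD mulrDl lerD// (le_trans c1)// ler_wpM2l// lef_pV2 ?posrE// ler_nat.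
    by rewrite leq_mul// leq_pmulr.
  move=> j; have [s1 s2] := sX j.
  have -> : y j 0 + ap X' q j 0 = (y j 0 + ap X q j 0) + ap (X' - X) q j 0.
    by rewrite apB -addrA; congr (_ + _); rewrite addrC subrK.
  have Nr : (smo S (N * r) %| smo S (N * t))%N by apply: smo_dvd; rewrite leq_mul2l rt orbT.
  have Nr0 : (smo S (N * r) %| smo S (N * r0))%N by apply: smo_dvd; rewrite leq_mul2l rr0 orbT.
  split; last first.
    rewrite mulrDr; apply: fin_leD.
      rewrite pmulrn mulrC; apply: fin_leMint; rewrite mul1r in s2.
      by apply: fin_le_dvd s2; [rewrite muln_gt0 Sprod_gt0 smo_gt0|exact: dvdn_mull].
    rewrite -ap_dil; apply: fin_le_ap => j' k; rewrite !mxE.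
    have [_ c2] := cX j' k; apply: (fin_le_dvd _ Nr0) c2; exact: smo_gt0.
  rewrite reD (le_trans (ler_normD _ _))// -natr1 mulrDl addrC mul1r lerD//; last first.
    apply: (le_trans s1); rewrite lef_pV2 ?posrE ?ltr0n ?muln_gt0 ?N0 ?(leq_trans r0' rt)//.
    by rewrite ler_nat leq_mul2l rt orbT.
  have h : `|re (ap (X' - X) q j 0)| <=
      n%:R * (supnorm_int q)%:R * (K.+1%:R / (N * r0 * Q')%:R).
    by apply: re_ap_le => k; rewrite mxE [(- X) _ _]mxE; have [] := cX j k.
  apply: (le_trans h); rewrite -mulrA (natrM _ n) -[leRHS]mulrA ler_wpM2l//.
  rewrite mulrCA ler_wpM2l// ler_pdivrMr// ler_pdivlMl ?ltr0n ?muln_gt0 ?N0//.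
  rewrite -!natrM ler_nat.
  apply: (@leq_trans (N * r0 * Q')%N); last by [].
  by rewrite leq_mul ?(leq_trans qQ)// leq_mul2l rr0 orbT.
have cardP : #|P|%:R * cellvol (N * r0 * Q') (smo S (N * r0)) <=
    C2 / (r ^ (l * m))%N%:R * cellvol (N * Q) (smo S N).
  rewrite -lee_fin; apply: le_trans (h2 _ _ _ _ A y N0 r0' gq).
  rewrite EFinM -[#|P|]card_sig.
  apply: (@measure_union_ge R S m n mu {i | P i}
    (fun i => cell (N * r0 * Q') (smo S (N * r0)) (A' (val i)))) => //.
  - by move=> i; exact: measurable_cell.
  - by move=> [i Pi] /=; exact: cellTh.
  - by move=> i j X hi hj; apply: val_inj; exact: dis hi hj.
  - move=> i; rewrite (measure_cellvol mu_inv mu_unit)//; exact: smo_Spi.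
rewrite (bigID P) /= [X in (_ + X)%E]big1 ?adde0; last first.
  move=> i /negP nP; rewrite (_ : target _ _ _ _ _ _ _ `&` _ = set0) ?measure0//.
  by apply/seteqP; split => // X FX; apply: nP; apply/asboolP; exists X.
apply: (@le_trans _ _ (\sum_(i | P i)
    (C1 / (t' ^ (l * m))%N%:R * cellvol (N * r0 * Q') (smo S (N * r0)))%:E)%E).
  apply: lee_sum => i _; apply: le_trans (h1 _ _ _ _ (A' i) (y' i) N'0 t'0 (gq' i)).
  apply: le_measure; rewrite ?inE.
  - by apply: measurableI; exact: measurable_target.
  - by apply: measurableI; [exact: measurable_big_box|exact: measurable_strip].
  move=> X [_ [bX sX]]; split => // j; have [s1 s2] := sX j; rewrite div1r; split => //.
  rewrite mul1r in s2; rewrite pmulrn mulrC; apply: fin_leMint.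
  by apply: fin_le_dvd s2; [rewrite muln_gt0 Sprod_gt0 smo_gt0|exact: dvdn_mull].
rewrite sumEFin lee_fin sumr_const -[leLHS]mulr_natl mulrCA.
apply: le_trans (ler_wpM2l _ cardP) _; first by rewrite divr_ge0// ltW.
by rewrite le_eqVlt; apply/orP; left; apply/eqP; ring.
Qed.

(** The shift of [k] by 2 makes [Nlev k] larger than 2, as [near_measure_le] requires. *)
Definition Nlev k : nat := 2 ^ (n * k.+2).
Definition Qlev k : nat := 2 ^ (l * m * k.+2).

(* The constant [C] makes [Woo] invariant under dilations, so that the zero-one law applies. *)
Definition near_at (t : nat -> nat) (C k : nat) : set T := [set A | exists q p,
  [/\ q != 0, (supnorm_int q <= Qlev k)%N, (Qlev k <= C * supnorm_int q)%N &
  strip (C%:R / (Nlev k * t k)%N%:R) (smo S (Nlev k * t k)) C q (diag_int R S p) A]].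

Definition Woo (t : nat -> nat) : set T := [set A | exists2 C, (0 < C)%N &
  forall a, exists2 k, (a <= k)%N & near_at t C k A].

Lemma measurable_near_at t C k : measurable (near_at t C k : set BT).
Proof.
pose I : countType := ('cV[int]_n * 'cV[int]_m)%type.
pose P (w : I) := [/\ w.1 != 0, (supnorm_int w.1 <= Qlev k)%N &
  (Qlev k <= C * supnorm_int w.1)%N].
pose F w : set BT := if `[< P w >] then
  strip (C%:R / (Nlev k * t k)%N%:R) (smo S (Nlev k * t k)) C w.1 (diag_int R S w.2) else set0.
rewrite (_ : near_at t C k = \bigcup_w F w).
  apply: countable_bigcupT_measurable => // w; rewrite /F.
  by case: ifP => // _; exact: measurable_strip.
apply/seteqP; split => A; first move=> [q [p [q0 qQ Qq sA]]].
  by exists (q, p) => //; rewrite /F; case: asboolP => // /(_ (And3 q0 qQ Qq)).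
by move=> [[q p] _]; rewrite /F; case: asboolP => // -[q0 qQ Qq] sA; exists q, p.
Qed.

Lemma near_at_dil t C k d A : (0 < d)%N -> near_at t C k A ->
  near_at t (d * C) k (dil d A).
Proof.
move=> d0 [q [p [q0 qQ Qq sA]]]; exists q, (\col_i (d%:Z * p i 0)); split => //.
  by apply: leq_trans Qq _; rewrite leq_mul2r leq_pmull ?orbT.
move=> i; have [s1 s2] := sA i.
have -> : diag_int R S (\col_i (d%:Z * p i 0)) i 0 + ap (dil d A) q i 0 =
    d%:R * (diag_int R S p i 0 + ap A q i 0).
  by rewrite ap_dil mulrDr; congr (_ + _); rewrite !mxE intrM.
split.
  rewrite reM renat normrM normr_nat natrM -mulrA ler_wpM2l//.
have -> : (d * C)%:R * (d%:R * (diag_int R S p i 0 + ap A q i 0)) =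
    C%:R * (diag_int R S p i 0 + ap A q i 0) * (d * d)%:Z%:~R.
  rewrite -[(_ * _)%:Z%:~R]pmulrn !natrM.
  by rewrite mulrACA mulrC.
exact: fin_leMint.
Qed.

Lemma Woo_dil t d A : (0 < d)%N -> Woo t A -> Woo t (dil d A).
Proof.
move=> d0 [C C0 hC]; exists (d * C)%N; first by rewrite muln_gt0 d0.
by move=> a; have [k ak hk] := hC a; exists k => //; exact: near_at_dil.
Qed.

Lemma Woo_periodic t : zperiodic 1 (Woo t).
Proof.
have h z X : Woo t (shiftz R S 1 z + X) -> Woo t X.
  move=> [C C0 hC]; exists C => // a; have [k ak [q [p [q0 qQ Qq sA]]]] := hC a.
  exists k => //; exists q, (p + z *m q); split => // i; have := sA i.
  rewrite ap_shiftz [(_ + _ : 'cV__) i 0]mxE addrA.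
  by rewrite diag_intD [(_ + _ : 'cV__) i 0]mxE.
move=> z X; split; first exact: h.
have e : shiftz R S 1 (- z) + (shiftz R S 1 z + X) = X.
  by apply/matrixP => i j; rewrite !mxE !rmorphN mulNr addKr.
by move=> a; apply: (h (- z)); rewrite e.
Qed.

Lemma measurable_Woo t : measurable (Woo t : set BT).
Proof.
rewrite (_ : Woo t = \bigcup_C \bigcap_a \bigcup_k near_at t C.+1 (a + k)).
  apply: bigcupT_measurable => C; apply: bigcapT_measurable => a.
  by apply: bigcupT_measurable => k; exact: measurable_near_at.
apply/seteqP; split => A.
  move=> [[//|C] _ hC]; exists C => // a _; have [k ak hk] := hC a.
  by exists (k - a)%N => //; rewrite subnKC.
move=> [C _ hC]; exists C.+1 => // a; have [k _ hk] := hC a I.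
by exists (a + k)%N; rewrite ?leq_addr.
Qed.

Lemma target_near_at t c k q p A : good_int S c (Qlev k) q ->
  target c (Nlev k) (Qlev k) (t k) q (diag_int R S p) A `<=` near_at t (2 ^ c) k.
Proof.
move=> [q0 qQ Qq _] X [_ sX]; exists q, p; split => // i; have [s1 s2] := sX i; split.
  by apply: (le_trans s1); rewrite -[leLHS]div1r ler_wpM2r ?invr_ge0// ler1n expn_gt0.
rewrite mul1r in s2; rewrite pmulrn mulrC; apply: fin_leMint.
by apply: fin_le_dvd s2; [rewrite muln_gt0 Sprod_gt0 smo_gt0|exact: dvdn_mull].
Qed.

Lemma Nlev_gt2 k : (2 < Nlev k)%N.
Proof.
apply: (@leq_trans (2 ^ 2)%N) => //; rewrite leq_exp2l//.
by rewrite (@leq_trans k.+2)// leq_pmull.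
Qed.

Lemma Nlev_gt0 k : (0 < Nlev k)%N. Proof. by rewrite expn_gt0. Qed.
Lemma Qlev_gt0 k : (0 < Qlev k)%N. Proof. by rewrite expn_gt0. Qed.

Lemma Nlev_Qlev k : (Nlev k ^ (l * m) = Qlev k ^ n)%N.
Proof. by rewrite -!expnM; congr (_ ^ _)%N; rewrite mulnC mulnA mulnAC. Qed.

Lemma NlevD j k : (j <= k)%N -> (Nlev k = Nlev j * 2 ^ (n * (k - j)))%N.
Proof.
move=> jk; rewrite -expnD -mulnDr; congr (2 ^ (n * _))%N.
by rewrite addSn addSn subnKC.
Qed.

Variables (t : nat -> nat) (x0 : R).
Hypothesis t_gt0 : forall k, (0 < t k)%N.
Hypothesis x0_gt0 : 0 < x0.
Hypothesis t_window : forall a, exists b,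
  x0 <= \sum_(a <= k < b) ((t k) ^ (l * m))%N%:R^-1.

(** The second moment bound applies to every tail of levels with the same [delta]. The unions over
    the tails decrease and lie in a box of finite measure, so their intersection, which is contained
    in [Woo t], has measure at least [delta]. *)
Lemma measure_Woo_gt0 : (0 < mu (Woo t))%E.
Proof.
have [c hc] := good_cells.
have [Ca Ca0 low] := target_measure_ge mu_inv u_gt0 mu_unit m_gt0 n_gt0 c.
have [Cb Cb0 pair] := pair_bound c.
have l0 := card_places_gt0 S_infinite.
have lm0 : (0 < l * m)%N by rewrite muln_gt0 l0.
pose x k : R := ((t k) ^ (l * m))%N%:R^-1.
have x_ge0 k : 0 <= x k by rewrite invr_ge0.
pose data k (w : {I : finType & I -> T * ('cV[int]_n * 'cV[int]_m)}) :=
  [/\ forall i, [/\ unit_cell (tagged w i).1, good_int S c (Qlev k) (tagged w i).2.1 &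
        strip (Nlev k)%:R^-1 (smo S (Nlev k)) 1 (tagged w i).2.1
          (diag_int R S (tagged w i).2.2) (tagged w i).1],
      forall i j X, cell (Nlev k * Qlev k) (smo S (Nlev k)) (tagged w i).1 X ->
        cell (Nlev k * Qlev k) (smo S (Nlev k)) (tagged w j).1 X -> i = j &
      u / 2 <= #|tag w|%:R * cellvol (Nlev k * Qlev k) (smo S (Nlev k))].
have /choice[w hw] k : exists w, data k w.
  have [I [A [q [p [h1 h2 h3]]]]] := hc _ _ (Nlev_gt2 k) (Nlev_Qlev k).
  by exists (existT _ I (fun i => (A i, (q i, p i)))).
pose I k : finType := tag (w k).
pose F k (i : I k) : set BT := target c (Nlev k) (Qlev k) (t k) (tagged (w k) i).2.1
  (diag_int R S (tagged (w k) i).2.2) (tagged (w k) i).1.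
have mF k i : measurable (F k i) by exact: measurable_target.
have [delta delta0 hdelta] := second_moment_levels mu x_ge0
  (mulr_gt0 Ca0 (divr_gt0 u_gt0 (ltr0n R 2)) : 0 < Ca * (u / 2)) (mulr_gt0 Cb0 u_gt0) x0_gt0.
have cardle k : #|I k|%:R * cellvol (Nlev k * Qlev k) (smo S (Nlev k)) <= u.
  have [hi dis _] := hw k; rewrite -lee_fin EFinM -mu_unit.
  have D0 : (0 < Nlev k * Qlev k)%N by rewrite muln_gt0 Nlev_gt0 Qlev_gt0.
  apply: (@measure_union_ge R S m n mu (I k)
    (fun i => cell (Nlev k * Qlev k) (smo S (Nlev k)) (tagged (w k) i).1)) => //.
  - by move=> i; exact: measurable_cell.
  - exact: measurable_unit_cell.
  - by move=> i; have [? _ _] := hi i; apply: cell_sub_unit => //; exact: smo_gt0.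
  - by move=> i; rewrite (measure_cellvol mu_inv mu_unit)//; exact: smo_Spi.
pose U a : set BT := \bigcup_(k in [set k | (a <= k)%N]) \bigcup_i F k i.
have mU a : measurable (U a).
  by apply: bigcup_measurable => k _; apply: fin_bigcup_measurable => //; exact: finite_finset.
have Ulow a : (delta%:E <= mu (U a))%E.
  have [b hb] := t_window a; apply: (hdelta I F a b) => //.
  - move=> k _; have [hi _ cardge] := hw k.
    apply: (@le_trans _ _ (\sum_(i : I k)
        (Ca * x k * cellvol (Nlev k * Qlev k) (smo S (Nlev k)))%:E)%E).
      rewrite sumEFin lee_fin sumr_const -[leRHS]mulr_natl [leRHS]mulrCA.
      by rewrite [leLHS]mulrAC ler_wpM2l// mulr_ge0// ltW.
    by apply: lee_sum => i _; have [_ gi si] := hi i; exact: low (Nlev_gt0 k) (t_gt0 k) gi si.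
  - move=> j k _ jk; pose r0 := (2 ^ (n * (k - j)))%N; pose r := minn (t j) r0.
    have r0_gt0 : (0 < r0)%N by rewrite expn_gt0.
    have r_gt0 : (0 < r)%N by rewrite leq_min t_gt0.
    have [hj _ _] := hw j; have [hk dis _] := hw k.
    have QQ : (Qlev j <= Qlev k)%N by rewrite leq_exp2l// leq_mul2l !ltnS jk orbT.
    (* Either [r] is [t j] and the term is [x j], or r = 2^(n(k-j)), whose power n l m (k - j) >= k
       - j gives the geometric term. *)
    have rle : (r ^ (l * m))%N%:R^-1 <= x j + (2 ^+ (k - j))^-1 :> R.
      have [tr|tr] := leqP (t j) r0.
        by rewrite /r (minn_idPl tr) lerDl invr_ge0 exprn_ge0.
      rewrite /r (minn_idPr (ltnW tr)) (le_trans (_ : _ <= (2 ^+ (k - j))^-1))//; last first.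
        by rewrite lerDr.
      rewrite lef_pV2 ?posrE ?exprn_gt0// ?ltr0n ?expn_gt0 ?r0_gt0// -natrX ler_nat.
      by rewrite /r0 -expnM leq_exp2l// mulnAC leq_pmull// muln_gt0 n_gt0.
    apply: (@le_trans _ _ (\sum_(i : I j) (Cb * x k / (r ^ (l * m))%N%:R *
        cellvol (Nlev j * Qlev j) (smo S (Nlev j)))%:E)%E).
      apply: lee_sum => i _; have [_ gi _] := hj i.
      rewrite /F (NlevD jk); apply: pair => //; try exact: Nlev_gt0.
      + exact: geq_minl.
      + exact: geq_minr.
      + by move=> i'; have [_ ? _] := hk i'.
      + by move=> i1 i2 X; rewrite -(NlevD jk); exact: dis.
    rewrite sumEFin lee_fin sumr_const -[leLHS]mulr_natl mulrCA.
    apply: le_trans (ler_wpM2l _ (cardle j)) _.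
      by rewrite divr_ge0// mulr_ge0// ltW.
    rewrite mulrAC [leRHS]mulrA ler_pM ?invr_ge0 ?mulr_ge0 ?(ltW Cb0) ?(ltW u_gt0)//.
    by rewrite mulrAC.
have Uoo : (mu (U 0%N) < +oo)%E.
  have Mc0 : (0 < M ^ c)%N by rewrite expn_gt0 Sprod_gt0.
  apply: (@le_lt_trans _ _ (mu (big_box (n.+1 * 2 ^ c).+2 1 1 (M ^ c) 0))); last first.
    apply: le_lt_trans (measure_big_box S_infinite mu_inv _ _ _ _ Mc0) _ => //.
    by rewrite -/unit_cell mu_unit -EFinM ltry.
  apply: le_measure; rewrite ?inE//; first exact: measurable_big_box.
  move=> X [k _ [i _ [bX _]]] i' j'; have [hi _ _] := hw k; have [UA _ _] := hi i.
  have [b1 b2] := bX i' j'; have [a1 a2 a3] := (unit_cellP _ _).1 UA i' j'.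
  set A := (tagged (w k) i).1 in b1 b2 a1 a2 a3 *.
  have -> : X i' j' - (0 : T) i' j' = (X i' j' - A i' j') + A i' j'.
    by rewrite mxE subr0 subrK.
  split; last first.
    rewrite mulrDr; apply: fin_leD.
      by apply: fin_le_dvd b2; [exact: smo_gt0|exact: dvd1n].
    by rewrite pmulrn mulrC; exact: fin_leMint.
  rewrite reD (le_trans (ler_normD _ _))// divr1 -natr1 lerD//; last first.
    by rewrite ger0_norm// ltW.
  apply: (le_trans b1); rewrite ler_pdivrMr ?ltr0n ?muln_gt0 ?Nlev_gt0 ?Qlev_gt0//.
  by rewrite ler_peMr// ler1n muln_gt0 Nlev_gt0 Qlev_gt0.
have Ucap : (delta%:E <= mu (\bigcap_a U a))%E.
  have mcap : measurable (\bigcap_a U a) by apply: bigcapT_measurable.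
  have noninc : nonincreasing_seq U.
    move=> a b ab; apply/subsetPset => X [k /= bk ?]; exists k => //=.
    exact: leq_trans ab bk.
  have cv := nonincreasing_cvg_mu Uoo mU mcap noninc.
  rewrite -(cvg_lim _ cv)//; apply: lime_ge; first by apply/cvg_ex; eexists; exact: cv.
  by apply: nearW => a; exact: Ulow.
apply: lt_le_trans (_ : 0 < delta%:E)%E _; first by rewrite lte_fin.
apply: le_trans Ucap _; apply: le_measure; rewrite ?inE.
- by apply: bigcapT_measurable.
- exact: measurable_Woo.
move=> A UA; exists (2 ^ c)%N; first by rewrite expn_gt0.
move=> a; have [k /= ak [i _ FA]] := UA a Logic.I; exists k => //.
have [hi _ _] := hw k; have [_ gi _] := hi i; exact: target_near_at gi A FA.
Qed.

(** The targets may stick out of the unit cell, so positive measure must first be located inside it: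
    were [Woo t] null there, dilations would make it null everywhere. *)
Lemma Woo_full : mu (unit_cell `\` Woo t) = 0%E.
Proof.
apply: (zero_one mu_inv u_gt0 mu_unit (measurable_Woo t) (@Woo_periodic t)).
  by move=> d d0 _ A; exact: Woo_dil.
rewrite lt0e measure_ge0 andbT; apply/eqP => W0.
have : mu.-negligible (Woo t : set BT).
  apply: (negligible_of_dil mu_inv u_gt0 mu_unit (P := fun=> Woo t)) => //.
  - move=> d _; apply/negligibleP; last by rewrite setIC.
    by apply: measurableI; [exact: measurable_unit_cell|exact: measurable_Woo].
  - by move=> d; exact: Woo_periodic.
  - by move=> A d; exact: Woo_dil.
move/(negligibleP _ (measurable_Woo t)) => h.
by have := measure_Woo_gt0; rewrite h ltxx.
Qed.

End Levels.

(** * Divergence *)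

(** On the window from [a] to [b], every denominator is at most 1 plus the partial sum up to [b]. *)
Lemma abel_dini (R : realType) (s : nat -> R) : (forall k, 0 <= s k) ->
  (forall B : R, exists K, B <= \sum_(k < K) s k) ->
  forall a, exists b,
    2^-1 <= \sum_(a <= k < b) s k / (1 + \sum_(i < k.+1) s i).
Proof.
move=> s0 div a; pose P K : R := \sum_(k < K) s k.
have P0 K : 0 <= P K by apply: sumr_ge0.
have mono K L : (K <= L)%N -> P K <= P L.
  move=> KL; rewrite /P -!(big_mkord xpredT s) [leRHS](@big_cat_nat _ _ _ K)//=.
  by rewrite lerDl; apply: sumr_ge0.
(* With P_b >= 1 + 2 P_a the ratio (P_b - P_a) / (1 + P_b) is at least 1/2. *)
have [b hb] := div (1 + 2 * P a); exists b; rewrite -/(P b) in hb.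
have ab : (a <= b)%N.
  rewrite leqNgt; apply/negP => /ltnW /mono; have := P0 a; lra.
apply: (@le_trans _ _ (\sum_(a <= k < b) s k / (1 + P b))); last first.
  apply: ler_sum_nat => k /andP[_ kb]; rewrite ler_wpM2l// lef_pV2 ?posrE.
  - by rewrite lerD2l; exact: mono.
  - by have := P0 b; lra.
  - by have := P0 k.+1; rewrite /P; lra.
rewrite -mulr_suml ler_pdivlMr; last by have := P0 b; lra.
have : P b = P a + \sum_(a <= k < b) s k.
  by rewrite /P -!(big_mkord xpredT s) [LHS](@big_cat_nat _ _ _ a).
have := P0 a; lra.
Qed.

Section Divergence.
Variables (R : realType) (S : {fset place}).
Hypothesis S_infinite : infinite_place \in S.
Variables m n : nat.
Local Notation QS := (QS R S).
Local Notation T := 'M[QS]_(m, n).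
Local Notation BT := (borel T).
Local Notation re := (@re R S S_infinite).
Local Notation unit_cell := (@unit_cell R S S_infinite m n).
Local Notation l := #|` S|.
Local Notation M := (Sprod S).
Local Notation Woo := (@Woo R S S_infinite m n).
Local Notation near_at := (@near_at R S S_infinite m n).
Local Notation Nlev := (Nlev n).
Local Notation Qlev := (Qlev S m).
Implicit Types (A X : T) (D E d k : nat) (q : 'cV[int]_n) (p : 'cV[int]_m).

Lemma approximableP (psi : nat -> R) A : approximable psi A <->
  forall K, exists q p, (K <= supnorm_int q)%N /\
    (Snorm (diag_int R S p + ap A q) ^+ l) ^+ m <= psi (supnorm_int q ^ n)%N.
Proof.
split=> [h K|h fin].
  apply: contrapT => no; apply: h; apply: sub_finite_set (@finite_supnorm_lt n K).
  move=> q [p hp] /=; rewrite ltnNge; apply/negP => Kq; apply: no.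
  by exists q, p.
have /finite_seqP[s hs] := fin.
have [q [p [qK hp]]] := h (\max_(q <- s) supnorm_int q).+1.
have : q \in s.
  have : [set` s] q by rewrite -hs; exists p.
  by [].
by move=> qs; move: qK; rewrite ltnNge => /negP; apply; exact: leq_bigmax_seq.
Qed.

Lemma absv_nat_ge k (v : S) : (0 < k)%N -> is_fin (val v) ->
  k%:R^-1 <= absv (k%:R : Qv R (val v)).
Proof.
move=> k0 vf; rewrite absv_nat// lef_pV2 ?posrE ?exprn_gt0 ?ltr0n ?place_prime_gt0//.
by rewrite -natrX ler_nat dvdn_leq// pfactor_dvdnn.
Qed.

(** At a finite place the multiplier [C] and the factor M that turns [smo] into a true bound are
    cancelled by |k|_v >= 1/k, valid for every positive integer [k]. *)
Lemma near_at_Snorm t C k A : (0 < C)%N -> (0 < t k)%N -> near_at t C k A ->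
  exists q p, [/\ (supnorm_int q <= Qlev k)%N, (Qlev k <= C * supnorm_int q)%N &
    Snorm (diag_int R S p + ap A q) <= (C * M)%:R / (Nlev k * t k)%:R].
Proof.
move=> C0 t0 [q [p [q0 qQ Qq sA]]]; exists q, p; split => //.
have Ntp : (0 : R) < (Nlev k * t k)%:R by rewrite ltr0n muln_gt0 expn_gt0.
have Cp : (0 : R) < C%:R by rewrite ltr0n.
have Mp : (0 : R) < M%:R by rewrite ltr0n Sprod_gt0.
apply/Snorm_leP => [|i v]; first by rewrite divr_ge0// ltW.
have [s1 s2] := sA i; rewrite mxE; have [->|vf] := v0_or_finite S_infinite v.
  apply: (le_trans s1); rewrite ler_wpM2r ?invr_ge0 ?(ltW Ntp)//.
  by rewrite ler_nat leq_pmulr// Sprod_gt0.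
have := s2 v vf; rewrite QSM absvM QSnat.
set y := absv ((diag_int R S p i 0 + ap A q i 0) v) => h.
have := @absv_Sprod_smo_le R S S_infinite (Nlev k * t k) v; rewrite absv_natM.
have N0 : (0 < Nlev k * t k)%N by rewrite muln_gt0 expn_gt0.
move=> /(_ N0 vf) hM.
have y0 : 0 <= y := absv_ge0 _.
have h1 := absv_nat_ge C0 vf; have h2 := absv_nat_ge (Sprod_gt0 S) vf.
set c := absv (C%:R : Qv R (val v)) in h h1; set e := absv (M%:R : Qv R (val v)) in h2 hM.
have {}h1 : 1 <= c * C%:R by rewrite -ler_pdivrMr// div1r.
have {}h2 : 1 <= e * M%:R by rewrite -ler_pdivrMr// div1r.
rewrite natrM; apply: (@le_trans _ _ (y * (c * C%:R) * (e * M%:R))).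
  by rewrite -mulrA ler_peMr// mulr_ege1.
have -> : y * (c * C%:R) * (e * M%:R) = (C%:R * M%:R) * (e * (c * y)) by ring.
rewrite ler_wpM2l ?mulr_ge0// (le_trans _ hM)// ler_wpM2l//.
exact: absv_ge0.
Qed.

Variables (psi : nat -> R).
Hypothesis psi_ge0 : forall j, 0 <= psi j.
Hypothesis psi_noninc : forall i j, (i <= j)%N -> psi j <= psi i.
Hypothesis psi_div : forall B : R, exists K, B <= \sum_(1 <= j < K) psi j.
Hypotheses (m_gt0 : (0 < m)%N) (n_gt0 : (0 < n)%N).

Let s k : R := (Qlev k ^ n)%N%:R * psi (Qlev k ^ n)%N.

(** Cauchy condensation with base 2^(lmn). The levels start at exponent 2, so the terms of exponents
    0 and 1 are added to [B]. *)
Lemma level_sum_div (B : R) : exists K, B <= \sum_(k < K) s k.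
Proof.
have l0 := card_places_gt0 S_infinite.
pose b := (2 ^ (l * m * n))%N.
have b1 : (1 < b)%N by rewrite -{1}(expn0 2) ltn_exp2l// !muln_gt0 l0 m_gt0.
have bp : (0 : R) < b%:R by rewrite ltr0n ltnW.
pose f i : R := (b ^ i)%N%:R * psi (b ^ i)%N.
have sE k : s k = f k.+2.
  by rewrite /s /f /b /Qlev -!expnM mulnAC.
have [K hK] := psi_div (b%:R * (B + f 0 + f 1)).
exists K; have : b%:R * (B + f 0 + f 1) <= b%:R * \sum_(k < K.+2) f k.
  apply: (le_trans hK); apply: (@le_trans _ _ (\sum_(1 <= j < b ^ K) psi j)).
    have [K0|K0] := leqP K 1; first by rewrite big_geq// sumr_ge0.
    rewrite [leRHS](@big_cat_nat _ _ _ K)//=; last 2 first.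
      exact: ltnW.
      exact: ltnW (ltn_expl _ b1).
    by rewrite lerDl sumr_ge0.
  apply: (le_trans (condensation_ge psi_ge0 psi_noninc b1 K)).
  rewrite mulr_sumr !big_ord_recr /= -[leLHS]addr0 -!addrA lerD//.
    by apply: ler_sum => k _; rewrite /f mulrA -natrM expnS.
  by rewrite addr_ge0// !mulr_ge0.
rewrite ler_pM2l// !big_ord_recl /= => h.
have -> : \sum_(k < K) s k = \sum_(i < K) f (bump 0 (bump 0 i)).
  by apply: eq_bigr => k _; rewrite sE.
by move: h; lra.
Qed.

Let s_ge0 k : 0 <= s k. Proof. by rewrite mulr_ge0. Qed.

(** A single zero of [psi] at a level would, by monotonicity, annihilate all later terms and
    contradict divergence. Positivity is what allows a threshold to be extracted from [tau] with
    [max_power]. *)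
Let s_gt0 k : 0 < s k.
Proof.
rewrite lt_neqAle s_ge0 andbT eq_sym; apply/negP => /eqP sk.
have pk : psi (Qlev k ^ n)%N = 0.
  move/eqP: sk; rewrite mulf_eq0 pnatr_eq0 expn_eq0 -leqn0 leqNgt expn_gt0 /=.
  by move/eqP.
have sj j : (k <= j)%N -> s j = 0.
  move=> kj; rewrite /s (_ : psi _ = 0) ?mulr0//; apply/eqP.
  rewrite eq_le psi_ge0 andbT -pk psi_noninc// leq_exp2r// leq_exp2l//.
  by rewrite leq_mul2l !ltnS kj orbT.
have [K hK] := level_sum_div (1 + \sum_(i < k) s i).
have : \sum_(i < K) s i <= \sum_(i < k) s i; last by lra.
have [Kk|kK] := leqP K k; rewrite -!(big_mkord xpredT s).
  by rewrite [leRHS](@big_cat_nat _ _ _ K)//= lerDl sumr_ge0.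
rewrite [leLHS](@big_cat_nat _ _ _ k)//= 1?ltnW// -[leRHS]addr0 lerD2l.
by rewrite big_nat big1// => j /andP[kj _]; exact: sj.
Qed.

(** The Abel-Dini series: still divergent, but smaller than [s] by a factor tending to infinity. *)
Let tau k : R := s k / (1 + \sum_(i < k.+1) s i).

(** The threshold [t k] is one more than the integer part of tau_k^(-1/(lm)), so that t_k^(-lm) lies
    between 2^(-lm) tau_k and tau_k; the upper bound tau_k <= 1 covers the case where that integer
    part would not dominate 1. *)
Lemma level_thresholds : exists t : nat -> nat, [/\ forall k, (0 < t k)%N,
  forall k, ((t k) ^ (l * m))%N%:R^-1 <= tau k &
  forall a, exists b,
    (2 ^ (l * m))%N%:R^-1 / 2 <= \sum_(a <= k < b) ((t k) ^ (l * m))%N%:R^-1 :> R].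
Proof.
have lm0 : (0 < l * m)%N by rewrite muln_gt0 (card_places_gt0 S_infinite).
have den0 k : 0 < 1 + \sum_(i < k.+1) s i by rewrite ltr_pwDl// sumr_ge0.
have tau0 k : 0 < tau k by rewrite divr_gt0.
have tau1 k : tau k <= 1.
  by rewrite ler_pdivrMr// mul1r big_ord_recr /=; have : 0 <= \sum_(i < k) s i
    by [rewrite sumr_ge0]; lra.
have /choice[N hN] k := max_power lm0 (tau0 k).
exists (fun k => (N k).+1); split => //.
  move=> k; have [_ h] := hN k; rewrite -div1r ler_pdivrMr ?ltr0n ?expn_gt0//.
  by rewrite mulrC natrX ltW.
move=> a; have [b hb] := abel_dini s_ge0 level_sum_div a; exists b.
apply: (@le_trans _ _ (\sum_(a <= k < b) (2 ^ (l * m))%N%:R^-1 * tau k)).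
  by rewrite -mulr_sumr ler_wpM2l.
apply: ler_sum => k _; have [h _] := hN k.
rewrite mulrC ler_pdivrMr ?ltr0n ?expn_gt0// mulrC ler_pdivlMr ?ltr0n ?expn_gt0//.
have [N0|N0] := posnP (N k).
  rewrite N0 exp1n mulr1 (le_trans (tau1 k))// ler1n expn_gt0//.
apply: (@le_trans _ _ (tau k * ((2 * N k) ^ (l * m))%N%:R)).
  rewrite ler_wpM2l ?(ltW (tau0 k))// ler_nat leq_exp2r//.
  by rewrite mul2n -addnn -addn1 leq_add2l.
rewrite expnMn natrM mulrC -mulrA -[leRHS]mulr1 ler_wpM2l// natrX//.
Qed.

Variable t : nat -> nat.
Hypothesis t_gt0 : forall k, (0 < t k)%N.
Hypothesis t_tau : forall k, ((t k) ^ (l * m))%N%:R^-1 <= tau k.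

(** An approximation up to the factor [C] at level [k] has norm to the power lm at most (C M)^(lm)
    psi(Q^n) / (1 + s_0 + ... + s_k), and the denominator eventually exceeds (C M)^(lm). From |q| <=
    Q this is at most psi(|q|^n), and Q <= C |q| makes the vectors [q] unbounded. *)
Lemma Woo_approximable A : Woo t A -> approximable psi A.
Proof.
move=> [C C0 hC]; apply/approximableP => K.
pose B : R := (C * M)%:R ^+ (l * m).
have [a0 ha0] := level_sum_div B.
have [k ak hk] := hC (maxn a0 (C * K)).
have [q [p [qQ Qq sn]]] := near_at_Snorm C0 (t_gt0 k) hk.
exists q, p; move: ak; rewrite geq_max => /andP[a0k CKk]; split.
  rewrite -(leq_pmul2l C0) (leq_trans _ Qq)// (leq_trans CKk)//.
  apply: leq_trans (ltnW (ltn_expl _ (isT : (1 < 2)%N))) _; rewrite leq_exp2l//.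
  apply: leq_trans (leq_addr 2 k) _; rewrite addn2 leq_pmull//.
  by rewrite muln_gt0 (card_places_gt0 S_infinite).
apply: (@le_trans _ _ (psi (Qlev k ^ n)%N)); last first.
  by apply: psi_noninc; rewrite leq_exp2r.
rewrite -exprM; apply: (@le_trans _ _ (((C * M)%:R / (Nlev k * t k)%:R) ^+ (l * m))).
  by rewrite lerXn2r ?nnegrE ?Snorm_ge0 ?divr_ge0.
have Qp : (0 : R) < (Qlev k ^ n)%N%:R by rewrite ltr0n !expn_gt0.
have B0 : 0 <= B by rewrite exprn_ge0.
rewrite expr_div_n -/B -natrX expnMn natrM (Nlev_Qlev S m n k) invfM mulrA.
apply: (le_trans (ler_wpM2l _ (t_tau k))); first by rewrite divr_ge0// ltW.
have Sk : B <= 1 + \sum_(i < k.+1) s i.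
  apply: (le_trans ha0); apply: (@le_trans _ _ (\sum_(i < k.+1) s i)); last by rewrite lerDr.
  rewrite -!(big_mkord xpredT s) [leRHS](@big_cat_nat _ _ _ a0)//= 1?leqW//.
  by rewrite lerDl sumr_ge0.
have S0 : 0 < 1 + \sum_(i < k.+1) s i by rewrite ltr_pwDl// sumr_ge0.
rewrite /tau {1}/s; set y := 1 + _ in Sk S0 *; set x := psi _.
have -> : B / (Qlev k ^ n)%N%:R * ((Qlev k ^ n)%N%:R * x / y) = x * (B / y).
  by field; rewrite !gt_eqF.
by rewrite ler_piMr ?psi_ge0// ler_pdivrMr// mul1r.
Qed.

End Divergence.

Section DivergenceAll.
Variables (R : realType) (S : {fset place}).
Hypothesis S_infinite : infinite_place \in S.
Variables m n : nat.
Local Notation QS := (QS R S).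
Local Notation T := 'M[QS]_(m, n).
Local Notation BT := (borel T).
Local Notation unit_cell := (@unit_cell R S S_infinite m n).
Implicit Types (A X : T) (d k : nat) (q : 'cV[int]_n) (p : 'cV[int]_m).
Variable mu : {measure set BT -> \bar R}.
Hypothesis mu_inv : translation_invariant mu.
Variable u : R.
Hypothesis u_gt0 : 0 < u.
Hypothesis mu_unit : mu unit_cell = u%:E.
Hypotheses (m_gt0 : (0 < m)%N) (n_gt0 : (0 < n)%N).

Lemma not_approximable_unit_negligible (psi : nat -> R) : (forall j, 0 <= psi j) ->
  (forall i j, (i <= j)%N -> psi j <= psi i) ->
  (forall B : R, exists K, B <= \sum_(1 <= j < K) psi j) ->
  mu.-negligible (unit_cell `&` ~` approximable psi : set BT).
Proof.
move=> psi_ge0 psi_noninc psi_div.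
have [t [t0 ttau twin]] := level_thresholds S_infinite psi_ge0 psi_noninc psi_div m_gt0 n_gt0.
have x00 : (0 : R) < (2 ^ (#|` S| * m))%N%:R^-1 / 2.
  by rewrite divr_gt0// invr_gt0 ltr0n expn_gt0.
have := Woo_full mu_inv u_gt0 mu_unit m_gt0 n_gt0 t0 x00 twin.
have mUW : measurable (unit_cell `\` Woo S_infinite t : set BT).
  by apply: measurableD; [exact: measurable_unit_cell|exact: measurable_Woo].
move/(negligibleP _ mUW); apply: negligibleS => A [UA nA]; split => // WA.
by apply: nA; exact: (Woo_approximable psi_ge0 psi_noninc psi_div m_gt0 n_gt0 t0 ttau WA).
Qed.

(** Here the dilation is absorbed by [q] instead of [p]: an approximation of d A at [q] is one of
    [A] at d q. Hence the function psi(d^n j), whose sum still diverges, takes the place of [psi] on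
    the unit cell. *)
Theorem not_approximable_negligible (psi : nat -> R) : (forall j, 0 <= psi j) ->
  (forall i j, (i <= j)%N -> psi j <= psi i) ->
  (forall B : R, exists K, B <= \sum_(1 <= j < K) psi j) ->
  mu.-negligible (~` approximable psi : set BT).
Proof.
move=> psi_ge0 psi_noninc psi_div.
apply: (negligible_of_dil mu_inv u_gt0 mu_unit
  (P := fun d => ~` approximable (fun j => psi (d ^ n * j)%N))).
- move=> d d0; apply: not_approximable_unit_negligible => //.
    by move=> i j ij; apply: psi_noninc; rewrite leq_mul2l ij orbT.
  pose D := (d ^ n)%N; have D0 : (0 < D)%N by rewrite expn_gt0 d0.
  have Dp : (0 : R) < D%:R by rewrite ltr0n.
  (* Group the indices into blocks of length [D], and bound each block by its first term. *)
  have h K : \sum_(1 <= j < D * K.+1) psi j <=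
      D%:R * (psi 0%N + \sum_(1 <= j < K.+1) psi (D * j)%N).
    elim: K => [|K IH].
      rewrite muln1 [X in _ + X]big_geq// addr0.
      apply: (@le_trans _ _ (\sum_(1 <= j < D) psi 0%N)).
        by apply: ler_sum => j _; exact: psi_noninc.
      by rewrite sumr_const_nat -[leLHS]mulr_natl ler_wpM2r// ler_nat leq_subr.
    rewrite [X in _ * (_ + X)]big_nat_recr//= addrA mulrDr.
    rewrite [leLHS](@big_cat_nat _ _ _ (D * K.+1))//=; last 2 first.
      by rewrite muln_gt0 D0.
      by rewrite leq_mul2l leqnSn orbT.
    apply: lerD => //.
    apply: (@le_trans _ _ (\sum_(D * K.+1 <= j < D * K.+2) psi (D * K.+1)%N)).
      by apply: ler_sum_nat => j /andP[? _]; exact: psi_noninc.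
    by rewrite sumr_const_nat -[leLHS]mulr_natl -mulnBr subSnn muln1.
  move=> B; have [K hK] := psi_div (D%:R * (psi 0%N + B)); exists K.+1.
  rewrite -(lerD2l (psi 0%N)) -(ler_pM2l Dp); apply: (le_trans hK); apply: le_trans (h K).
  have [K1|K1] := leqP K 1.
    by rewrite big_geq// sumr_ge0.
  rewrite [leRHS](@big_cat_nat _ _ _ K)//=; last 2 first.
    exact: ltnW.
    by apply: (@leq_trans K.+1) => //; rewrite leq_pmull.
  by rewrite lerDl sumr_ge0.
- by move=> d z X; rewrite /setC /= approximable_periodic.
move=> A d d0; apply: contra_not => /approximableP h.
apply/approximableP => K; have [q [p [Kq hp]]] := h K.
pose dq : 'cV[int]_n := \col_j (d%:Z * q j 0); exists dq, p; split.
  apply: (leq_trans Kq); apply/bigmax_leqP => j _; apply: leq_trans (supnorm_le dq j).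
  by rewrite mxE abszM leq_pmull.
have -> : ap A dq = ap (dil d A) q.
  apply/colP => i; rewrite ap_dil !apE big_distrr; apply: eq_bigr => j _.
  by rewrite mxE intrM /= mulrCA.
apply: (le_trans hp); apply: psi_noninc; rewrite -expnMn leq_exp2r//.
apply/bigmax_leqP => j _; rewrite mxE abszM leq_mul2l.
by apply/orP; right; exact: supnorm_le.
Qed.

End DivergenceAll.

Theorem theorem1p17 (R : realType) (S : {fset place})
    (S_infinite : infinite_place \in S) (m n : nat)
    (m_gt0 : (0 < m)%N) (n_gt0 : (0 < n)%N)
    (psi : nat -> R) (psi_ge0 : forall j, 0 <= psi j)
    (psi_noninc : forall i j, (i <= j)%N -> psi j <= psi i)
    (mu : {measure set (borel 'M[QS R S]_(m, n)) -> \bar R})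
    (mu_haar : is_haar_measure mu) :
  (~ cvgn (fun k => \sum_(1 <= j < k) psi j) ->
     {ae mu, forall A, approximable psi A}) /\
  (cvgn (fun k => \sum_(1 <= j < k) psi j) ->
     {ae mu, forall A, ~ approximable psi A}).
Proof.
have mu_inv := haar_translation_invariant mu_haar.
have [u u_gt0 mu_unit] := haar_unit_cell S_infinite mu_haar.
split=> [ncv|cv].
  apply: (not_approximable_negligible mu_inv u_gt0 mu_unit m_gt0 n_gt0) => // B.
  (* The partial sums are nondecreasing, so their divergence means that they are unbounded. *)
  apply: contrapT => bounded; apply: ncv.
  apply: nondecreasing_is_cvgn.
    apply/nondecreasing_seqP => -[|j]; first by rewrite !big_geq.
    by rewrite [leRHS]big_nat_recr//= lerDl.
  exists B => _ [K _ <-]; rewrite leNgt; apply/negP => /ltW h.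
  by apply: bounded; exists K.
have := approximable_negligible mu_inv u_gt0 mu_unit m_gt0 n_gt0 psi_ge0 psi_noninc cv.
by apply: negligibleS => A /= /contrapT.
Qed.
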